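(* Let $K\ge1$ be fixed and let $\boldsymbol{\beta}_0=(\beta_{1,0},\dots,\beta_{k_0,0},0,\dots,0)^t\in\mathbb{R}^K$ with $\beta_{1,0},\dots,\beta_{k_0,0}$ all nonzero, $1\le k_0\le K$. For each $n>K$ let the $n\times K$ design matrix $\mathbf{X}$ with rows $\mathbf{x}_i$ satisfy: (i) $\sum_{i=1}^n x_{i,k}=0$ and $\sum_{i=1}^n x_{i,k}^2=n$ for each $k$; (ii) $\max_i\|\mathbf{x}_i\|/\sqrt n\to0$; (iii) $\mathbf{X}^t\mathbf{X}$ positive definite; (iv) $\mathbf{X}^t\mathbf{X}/n\to\boldsymbol{\Sigma}_0$ positive definite. Suppose $Y_i=\mathbf{x}_i^t\boldsymbol{\beta}_0+\varepsilon_i$ with $\varepsilon_i$ independent, $\mathbb{E}(\varepsilon_i)=0$, $\mathbb{E}(\varepsilon_i^2)=\sigma_0^2>0$, $\mathbb{E}(\varepsilon_i^4)\le M<\infty$. Fix $\alpha_1,\dots,\alpha_K\in(0,1)$ and set $\alpha_{K+1}=0$. Then for each $1\le k\le K$, as $n\to\infty$: (a) $\mathbb{P}\{\hat k_B=k\}\to 0$ if $k<k_0$; $\to(1-\alpha_{k_0+1})\cdots(1-\alpha_K)$ if $k=k_0$; $\to\alpha_k(1-\alpha_{k+1})\cdots(1-\alpha_K)$ if $k>k_0$. Moreover, if $\mathbf{X}^t\mathbf{X}/n=\boldsymbol{\Sigma}_0=\mathbf{I}$ for all $n$: (b) $\mathbb{P}\{\hat k_F=k\}\to0$ if $k<k_0$;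 $\to 1-\alpha_{k_0+1}$ if $k=k_0$; $\to(1-\alpha_{k+1})\alpha_{k_0+1}\cdots\alpha_k$ if $k>k_0$; (c) $\mathbb{P}\{\hat k_O=k\}\to0$ if $k<k_0$; $\to\mathbb{P}\{B_{k_0+1}+\cdots+B_K=k-k_0\}$ if $k\ge k_0$, where $B_{k_0+1},\dots,B_K$ are independent with $B_j\sim\mathrm{Bernoulli}(\alpha_j)$. (Empty products equal $1$.)
   Context: $\mathbf{Y}=(Y_1,\dots,Y_n)^t$, OLS $\widehat{\boldsymbol{\beta}}_n^\circ=(\mathbf{X}^t\mathbf{X})^{-1}\mathbf{X}^t\mathbf{Y}=(\widehat\beta_{1,n}^\circ,\dots,\widehat\beta_{K,n}^\circ)^t$, $\widehat\sigma_n^2=\|\mathbf{Y}-\mathbf{X}\widehat{\boldsymbol{\beta}}_n^\circ\|^2/(n-K)$; $z_{a}$ denotes the $100(1-a)$ percentile of $N(0,1)$, with $z_0=+\infty$. For $1\le k\le K$ let $\mathbf{X}[k]$ be the first $k$ columns of $\mathbf{X}$, $\widehat{\boldsymbol{\beta}}^\circ[k]=(\mathbf{X}[k]^t\mathbf{X}[k])^{-1}\mathbf{X}[k]^t\mathbf{Y}$ with last coordinate $\widehat\beta_k^\circ[k]$, $s_{kk}[k]$ the $k$th diagonal entry of $(\mathbf{X}[k]^t\mathbf{X}[k]/n)^{-1}$, and $\tilde Z_{k,n}=n^{1/2}\widehat\beta_k^\circ[k]/(\widehat\sigma_n s_{kk}[k]^{1/2})$; set $\tilde Z_{0,n}=0$,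 $z_{\alpha_0/2}=0$, $\tilde Z_{K+1,n}=0$. Backward estimator: $\hat k_B=\max\{k\in\{0,\dots,K\}:|\tilde Z_{k,n}|\ge z_{\alpha_k/2}\}$. Forward estimator: $\hat k_F=\min\{k-1: k\in\{1,\dots,K+1\},\ |\tilde Z_{k,n}|<z_{\alpha_k/2}\}$. OLS-hard estimator: with $s_{kk}$ the $k$th diagonal entry of $(\mathbf{X}^t\mathbf{X}/n)^{-1}$ and $\widehat Z_{k,n}=n^{1/2}\widehat\beta_{k,n}^\circ/(\widehat\sigma_n s_{kk}^{1/2})$, $\hat k_O=\#\{k\le K:|\widehat Z_{k,n}|\ge z_{\alpha_k/2}\}$. *)

(* Defs.v *)
From HB Require Import structures.
From mathcomp Require Import all_boot all_order all_algebra.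
From mathcomp Require Import all_classical all_reals all_analysis.
From mathcomp Require Import normal_distribution.

Set Implicit Arguments.
Unset Strict Implicit.
Unset Printing Implicit Defensive.

Import Order.TTheory GRing.Theory Num.Theory.
Import numFieldNormedType.Exports.

Local Open Scope classical_set_scope.
Local Open Scope ring_scope.

Section defs.
Context {R : realType}.

Definition Phi (x : R) : R := fine (normal_prob 0 1 `]-oo, x]).

(** z_a = 100(1-a) percentile of N(0,1), as an extended real:
    inf {x | Phi x >= 1 - a}; for a = 0 this is +oo (z_0 = +oo). *)
Definition zq (a : R) : \bar R :=
  ereal_inf [set x%:E | x in [set x : R | 1 - a <= Phi x]].

Definition posdefmx (p : nat) (A : 'M[R]_p) : Prop :=
  forall v : 'cV[R]_p, v != 0 -> 0 < (v^T *m A *m v) 0 0.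

Definition mutual_indep d (T : measurableType d) (P : probability T R)
    (I : set nat) (X : nat -> T -> R) : Prop :=
  forall (s : seq nat) (B : nat -> set R), uniq s -> (forall i, i \in s -> I i) ->
    (forall i, measurable (B i)) ->
    P (\bigcap_(i in [set j | j \in s]) (X i @^-1` B i)) =
    (\prod_(i <- s) P (X i @^-1` B i))%E.

Definition firstcols n K (X : 'M[R]_(n, K)) (k : nat) : 'M[R]_(n, k) :=
  \matrix_(i < n, j < k) oapp (X i) 0 (insub (nat_of_ord j) : option 'I_K).

Definition ols n p (X : 'M[R]_(n, p)) (Y : 'cV[R]_n) : 'cV[R]_p :=
  invmx (X^T *m X) *m X^T *m Y.

Definition sigma2hat n K (X : 'M[R]_(n, K)) (Y : 'cV[R]_n) : R :=
  (\sum_(i < n) ((Y - X *m ols X Y) i 0) ^+ 2) / (n - K)%:R.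

Definition lastcoord p (v : 'cV[R]_p) : R :=
  oapp (fun i : 'I_p => v i 0) 0 (insub p.-1).

Definition lastdiag p (A : 'M[R]_p) : R :=
  oapp (fun i : 'I_p => A i i) 0 (insub p.-1).

Definition Ztilde n K (X : 'M[R]_(n, K)) (Y : 'cV[R]_n) (k : nat) : R :=
  if (k == 0)%N || (K < k)%N then 0 else
  let Xk := firstcols X k in
  Num.sqrt n%:R * lastcoord (ols Xk Y) /
    (Num.sqrt (sigma2hat X Y) *
     Num.sqrt (lastdiag (invmx (n%:R^-1 *: (Xk^T *m Xk))))).

(** hat Z_{k,n} for the full model, index i : 'I_K stands for k = i+1. *)
Definition Zhat n K (X : 'M[R]_(n, K)) (Y : 'cV[R]_n) (i : 'I_K) : R :=
  Num.sqrt n%:R * ols X Y i 0 /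
    (Num.sqrt (sigma2hat X Y) *
     Num.sqrt ((invmx (n%:R^-1 *: (X^T *m X))) i i)).

Definition thr (alpha : nat -> R) (k : nat) : \bar R :=
  if (k == 0)%N then 0%E else zq (alpha k / 2).

Definition khatB (alpha : nat -> R) n K (X : 'M[R]_(n, K)) (Y : 'cV[R]_n) : nat :=
  \big[maxn/0%N]_(k < K.+1 | (thr alpha k <= (`|Ztilde X Y k|)%:E)%E) k.

Definition khatF (alpha : nat -> R) n K (X : 'M[R]_(n, K)) (Y : 'cV[R]_n) : nat :=
  \big[minn/K]_(k < K.+2 | (0 < k)%N && ((`|Ztilde X Y k|)%:E < thr alpha k)%E) k.-1.

Definition khatO (alpha : nat -> R) n K (X : 'M[R]_(n, K)) (Y : 'cV[R]_n) : nat :=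
  #|[set i : 'I_K | (zq (alpha i.+1 / 2) <= (`|Zhat X Y i|)%:E)%E]|.

Definition Yvec d (T : measurableType d) n K (X : 'M[R]_(n, K)) (beta0 : 'cV[R]_K)
    (eps : nat -> T -> R) (w : T) : 'cV[R]_n :=
  X *m beta0 + \col_(i < n) eps i w.

End defs.

(* Main.v *)
(** The [k]-th nested statistic is, up to the factor [sigma0 / sigmahat], the
    [k]-th coordinate of the Gram-Schmidt orthogonalization of the columns of [X]
    applied to [Y]. These coordinates are orthonormal linear statistics of the
    errors with asymptotically negligible coefficients, shifted by a drift that
    vanishes for [k > k0] and, for [k = k0] (for every [k <= k0] when the design
    is orthogonal), diverges.

    Joint asymptotic normality is obtained by Stein's method. If [g_k] has
    Gaussian mean [c_k] and [f_k] solves [g_k - c_k = f_k' - x f_k], then for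
    orthonormal linear statistics [W] the expectation of
    [f_k'(W_k) F - W_k f_k(W_k) F] tends to zero for every smooth [F] of the
    other coordinates, so in [E (\prod_k g_k(W_k))] the factors can be replaced
    by the [c_k] one at a time. The test functions are differences of smooth
    steps of [Phi(x)], whose Gaussian mean is exactly [1 - alpha] and whose Stein
    equations are solved explicitly. They differ from the acceptance indicator
    by at most a function of the same kind with small mean, and
    [sigmahat^2 -> sigma0^2] in L1 by the fourth moment bound.

    Each event about the backward and forward estimators prescribes the outcomes
    of some of the tests, and the OLS-hard estimator counts rejections; for an
    orthogonal design its statistics coincide with the nested ones. *)

Require Import Defs.
From HB Require Import structures.
From mathcomp Require Import all_boot all_order all_algebra.
From mathcomp Require Import all_classical all_reals all_analysis.
From mathcomp Require Import normal_distribution measurable_realfun ring lra zify.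
Set Implicit Arguments.
Unset Strict Implicit.
Unset Printing Implicit Defensive.
Import Order.TTheory GRing.Theory Num.Theory.
Import numFieldNormedType.Exports.
Local Open Scope classical_set_scope.
Local Open Scope ring_scope.

(** * Calculus and the Gaussian distribution *)

(** All events of interest are Boolean combinations of events about one statistic each, so
    convergence of expectations of products of one-variable functions suffices, without weak
    convergence of vectors. The steps are smoothed on the scale of [Phi x] because [Phi] of a
    standard normal is uniform: a symmetric smooth step at level [t] then has mean exactly [1 - t],
    and since [phi' = - x phi] its Stein equation reduces to an antiderivative in [p = Phi x],
    divided by [phi]. The price is control of that quotient in the tails, where it is a multiple of
    the Mills ratio.

    The factor [sigmahat / sigma0] is random, common to all statistics and not linear in the errors.
    It is absorbed beforehand: unless a linear statistic lies near its threshold or the factor is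
    far from 1, the decision of the test is unchanged, and both exceptions have small expectation.
    Fourth moments serve twice, for the Taylor remainder and for the variance of the squared errors.

    In a general design the drifts of the tests before [k0] are uncontrolled, so the limits for the
    backward estimator rest only on the tests from [k0] on. *)

Section derivatives.
Context {R : realType}.
Implicit Types (f g : R -> R) (x a b c : R).

Lemma is_derive1_eq f x a b : is_derive x 1 f a -> a = b -> is_derive x 1 f b.
Proof. by move=> + <-. Qed.

Lemma is_derive1D f g x a b : is_derive x 1 f a -> is_derive x 1 g b ->
  is_derive x 1 (fun y => f y + g y) (a + b).
Proof. exact: is_deriveD. Qed.

Lemma is_derive1N f x a : is_derive x 1 f a -> is_derive x 1 (fun y => - f y) (- a).
Proof. exact: is_deriveN. Qed.

Lemma is_derive1B f g x a b : is_derive x 1 f a -> is_derive x 1 g b ->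
  is_derive x 1 (fun y => f y - g y) (a - b).
Proof. by move=> Hf Hg; apply: is_derive1D => //; exact: is_derive1N. Qed.

Lemma is_derive1M f g x a b : is_derive x 1 f a -> is_derive x 1 g b ->
  is_derive x 1 (fun y => f y * g y) (a * g x + f x * b).
Proof.
move=> Hf Hg; have := is_deriveM Hf Hg.
by rewrite addrC [g x *: a]mulrC.
Qed.

Lemma is_derive1Ml c f x a : is_derive x 1 f a -> is_derive x 1 (fun y => c * f y) (c * a).
Proof. by move=> Hf; exact: is_deriveZ. Qed.

Lemma is_derive1V f x a : f x != 0 -> is_derive x 1 f a ->
  is_derive x 1 (fun y => (f y)^-1) (- a / f x ^+ 2).
Proof.
move=> fx Hf; have := is_deriveV fx Hf.
by rewrite /GRing.scale/= mulNr mulrC mulNr.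
Qed.

Lemma is_derive1_sqr x : is_derive x 1 (fun y : R => y ^+ 2) (2 * x).
Proof.
have := is_derive1M (is_derive_id x 1) (is_derive_id x 1).
by rewrite mul1r mulr1 -mulr2n mulr_natl.
Qed.

Lemma is_derive1_continuous f f' : (forall x, is_derive x 1 f (f' x)) -> continuous f.
Proof.
move=> Hf x; apply/differentiable_continuous/derivable1_diffP.
by have [] := Hf x.
Qed.

(** Meant for splines at their knots: a two-sided quadratic bound settles differentiability there
    without one-sided limits. *)
Lemma is_derive1_quadratic f x a c :
  (forall y, `|f y - f x - a * (y - x)| <= c * (y - x) ^+ 2) -> is_derive x 1 f a.
Proof.
move=> H.
have cvgf : h^-1 *: ((f \o shift x) (h *: 1) - f x) @[h --> 0^'] --> a.
  apply/cvgrPdist_le => e e0.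
  near=> h.
  have h0 : h != 0 by near: h; exact: nbhs_dnbhs_neq.
  have := H (h + x); rewrite addrK /= /GRing.scale/= mulr1 => Hh.
  have hn : 0 < `|h| by rewrite normr_gt0.
  have -> : a - h^-1 * (f (h + x) - f x) = - h^-1 * (f (h + x) - f x - a * h) by field.
  rewrite normrM normrN normfV ler_pdivrMl// (le_trans Hh)//.
  rewrite -[h ^+ 2]real_normK ?num_real// expr2 mulrCA ler_wpM2l//.
  have ch : `|h| <= e / (`|c| + 1).
    near: h; apply: dnbhs0_le; rewrite divr_gt0// ltr_wpDl//.
  apply: (@le_trans _ _ ((`|c| + 1) * `|h|)).
    by rewrite ler_wpM2r// (le_trans (ler_norm c))// lerDl.
  by rewrite mulrC -ler_pdivlMr// ltr_wpDl.
split; first by apply/cvg_ex; exists a.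
exact/cvg_lim.
Unshelve. all: by end_near. Qed.

Lemma lipschitz_derive f f' c : (forall x, is_derive x 1 f (f' x)) ->
  (forall x, `|f' x| <= c) -> forall x y, `|f x - f y| <= c * `|x - y|.
Proof.
move=> Hf Hc x y; wlog xy : x y / y <= x.
  move=> H; have [/H//|/ltW/H] := leP y x.
  by rewrite distrC [`|y - x|]distrC.
have [z _ ->] : exists2 z, z \in `[y, x]%R & f x - f y = f' z * (x - y).
  apply: MVT_segment => //.
  by apply: continuous_subspaceT; exact: is_derive1_continuous Hf.
by rewrite normrM ler_wpM2r.
Qed.

Lemma bounded_on_segment f (l : R) : continuous f ->
  exists c, forall x, `|x| <= l -> `|f x| <= c.
Proof.
move=> cf; have [l0|l0] := leP 0 l; last first.
  by exists 0 => x /le_lt_trans /(_ l0); rewrite normr_lt0.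
have [||c _ Hc] := @EVT_max R (fun x => `|f x|) (- l) l; first lra.
  apply: continuous_subspaceT => x; apply: continuous_comp; first exact: cf.
  exact: norm_continuous.
exists `|f c| => x; rewrite ler_norml => xl; apply: Hc.
by rewrite in_itv.
Qed.

End derivatives.

Section gaussian.
Context {R : realType}.
Implicit Types x y t : R.

Definition phi : R -> R := normal_pdf 0 1.

Lemma phiE x : phi x = normal_peak 1 * expR (- (x ^+ 2) / 2).
Proof.
rewrite /phi normal_pdfE ?oner_neq0// /normal_fun; congr (_ * expR _).
by rewrite subr0 expr1n.
Qed.

Lemma phi_gt0 x : 0 < phi x.
Proof. by rewrite phiE mulr_gt0 ?expR_gt0// normal_peak_gt0 ?oner_neq0. Qed.

Lemma phiN x : phi (- x) = phi x.
Proof. by rewrite !phiE sqrrN. Qed.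

Lemma phi_continuous : continuous phi.
Proof. by apply: continuous_normal_pdf; rewrite oner_neq0. Qed.

Lemma is_derive_phi x : is_derive x 1 phi (- x * phi x).
Proof.
have h : is_derive x 1 (fun x : R => - (x ^+ 2) / 2) (- x).
  have := is_derive1M (is_derive1N (is_derive1_sqr x)) (is_derive_cst (2^-1 : R) x 1).
  by move=> H; apply: (is_derive1_eq H) => /=; lra.
have := is_derive1Ml (normal_peak 1)
  (@is_derive1_comp R expR _ x _ _ (is_derive_expR (- (x ^+ 2) / 2)) h).
rewrite mulrA -phiE mulrC.
by have -> : phi = fun y => normal_peak 1 * (expR \o (fun y => - y ^+ 2 / 2)) y by apply/funext => y; rewrite phiE.
Qed.

Lemma Phi_cdf x : (Phi x)%:E = normal_prob 0 1 `]-oo, x].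
Proof. by rewrite /Phi fineK// fin_num_measure. Qed.

Lemma is_derive_Phi x : is_derive x 1 Phi (phi x).
Proof.
have xx1 : x < x + 1 by rewrite ltrDl.
have hi : lebesgue_measure.-integrable [set` Interval -oo%O (BRight (x + 1))] (EFin \o phi).
  by apply: (integrableS _ _ (subsetT _)) => //; exact: integrable_normal_pdf.
have [||h1 h2] := continuous_FTC1 xx1 hi; [by rewrite ltNyr|exact: phi_continuous|].
by split; [exact: h1|rewrite -derive1E; exact: h2].
Qed.

Lemma Phi_ge0 x : 0 <= Phi x.
Proof. by rewrite fine_ge0. Qed.

Lemma Phi_continuous : continuous (Phi : R -> R).
Proof.
move=> x; apply/differentiable_continuous/derivable1_diffP.
by have [] := is_derive_Phi x.
Qed.

(** The limit of [Phi] at minus infinity; the extra [y < x] lets monotonicity arguments on a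
    half-line end at [x]. *)
Lemma Phi_small_left x t : 0 < t -> exists2 y, y < x & Phi y < t.
Proof.
(* The identity becomes a random variable under the normal law, so that [Phi] is its distribution
   function. *)
move=> t0; pose idR : measurableTypeR R -> R := idfun.
pose idm := isMeasurableFun.Build _ _ _ _ idR (@measurable_id _ _ setT).
pose X : {RV (normal_prob 0 1 : probability _ R) >-> R} := HB.pack idR idm.
have := cvg_cdfNy0 X.
move/fine_cvg => /cvgrPdist_lt /(_ _ t0)[M [_ h]].
exists (Num.min x M - 1); first by rewrite ltrBlDr (le_lt_trans (_ : _ <= x)) ?ge_min ?lexx// ltrDl.
have /h : Num.min x M - 1 < M by rewrite ltrBlDr (le_lt_trans (_ : _ <= M)) ?ge_min ?lexx ?orbT// ltrDl.
by rewrite /= sub0r normrN /Phi => /(le_lt_trans (ler_norm _)).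
Qed.

Lemma Phi_opp x : Phi (- x) = 1 - Phi x.
Proof.
apply: EFin_inj; rewrite EFinB !Phi_cdf /normal_prob.
rewrite ge0_integration_by_substitutionNy; first last.
- by move=> y _; exact: normal_pdf_ge0.
- by apply: continuous_subspaceT => y; exact: phi_continuous.
transitivity (normal_prob (0:R) 1 `[x, +oo[); rewrite /normal_prob.
  by apply: eq_integral => y _ /=; rewrite -/phi phiN.
have -> : [set` `[x, +oo[] = ~` [set` `]-oo, x[] by rewrite setCitvl.
rewrite -/(normal_prob 0 1 _) probability_setC//; congr (_ - _)%E.
rewrite -[LHS]/(\int[lebesgue_measure]_(t in `]-oo, x[) (normal_pdf 0 1 t)%:E)%E integral_itv_bndo_bndc//.
by apply/measurable_EFinP/measurable_funTS; exact: measurable_normal_pdf.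
Qed.

Lemma Phi_lt x y : x < y -> Phi x < Phi y.
Proof.
move=> xy; have [z _ E] : exists2 z, z \in `]x, y[%R & Phi y - Phi x = phi z * (y - x).
  apply: MVT => //.
  by move=> z _; exact: is_derive_Phi.
  by apply: continuous_subspaceT => z; exact: Phi_continuous.
by rewrite -subr_gt0 E mulr_gt0 ?phi_gt0 ?subr_gt0.
Qed.

Lemma Phi_le x y : x <= y -> Phi x <= Phi y.
Proof. by rewrite le_eqVlt => /predU1P[->//|/Phi_lt/ltW]. Qed.

(** [Phi] is continuous and strictly increasing, so the infimum defining [zq] is attained at the
    solution of [Phi z = 1 - a / 2], which is positive because [Phi 0] is one half and [a < 1]. *)
Lemma zq_half (a : R) : 0 < a < 1 ->
  exists z, [/\ 0 < z, zq (a / 2) = z%:E & Phi z = 1 - a / 2].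
Proof.
move=> /andP[a0 a1].
have [y y0 Hy] : exists2 y : R, y < 0 & Phi y < a / 2 by apply: Phi_small_left; lra.
have Phi0 : Phi (0 : R) = 1 / 2 by have := Phi_opp 0; rewrite oppr0; lra.
have PhiNy := Phi_opp y.
have [z zI Ez] : exists2 z, z \in `[0, - y]%R & Phi z = 1 - a / 2.
  apply: IVT; [lra| |].
    by apply: continuous_subspaceT => z; exact: Phi_continuous.
  by rewrite Phi0 PhiNy ge_min le_max; apply/andP; split; apply/orP; [left|right]; lra.
have z0 : 0 < z.
  have : 0 <= z by move: zI; rewrite in_itv/= => /andP[].
  rewrite le_eqVlt => /predU1P[z0|//]; move: Ez; rewrite -z0 Phi0; lra.
exists z; split => //; apply/eqP; rewrite eq_le; apply/andP; split.
  by apply: ereal_inf_lbound; exists z => //=; rewrite Ez.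
apply: le_ereal_inf_tmp => _ [x /= Hx <-]; rewrite lee_fin leNgt; apply/negP => /Phi_lt.
by rewrite Ez ltNge Hx.
Qed.

Lemma phi_le_peak x : phi x <= normal_peak 1.
Proof. by apply: normal_pdf_ub; rewrite oner_neq0. Qed.

(** [exp u >= 1 + u] at [u = x^2 / 2], together with [1 + x^2 / 2 >= |x|]. Since [phi' = - x phi],
    this gives a Lipschitz constant for [phi]. *)
Lemma normr_Mphi_le x : `|x * phi x| <= normal_peak 1.
Proof.
have pk : 0 <= normal_peak 1 :> R := normal_peak_ge0 1.
rewrite normrM (gtr0_norm (phi_gt0 x)) phiE mulrCA ler_piMr//.
rewrite mulNr expRN ler_pdivrMr ?expR_gt0// mul1r.
apply: le_trans (expR_ge1Dx _).
have /= := sqr_ge0 (`|x| - 1); rewrite -[x ^+ 2]real_normK ?num_real//; nra.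
Qed.

(** The three quantities are the Mills ratio [A] and its derivatives [A' = 1 + x A] and
    [A'' = A (1 + x^2) + x]. All bounds follow from the classical
    [- x phi / (1 + x^2) <= Phi <= - phi / x] for negative [x]. *)
Lemma mills (x : R) : x <= -1 -> let A := Phi x / phi x in
  [/\ 0 <= A <= 1, 0 <= 1 + x * A <= 1 & 0 <= A * (1 + x ^+ 2) + x <= 1].
Proof.
move=> x1 A.
have x0 : x < 0 by lra.
have nd (F dF : R -> R) : (forall y, y <= x -> is_derive y 1 F (dF y)) ->
    (forall y, y <= x -> 0 <= dF y) -> forall y, y < x -> F y <= F x.
  move=> HF HdF y yx; have [c cI E] : exists2 c, c \in `]y, x[%R & F x - F y = dF c * (x - y).
    apply: MVT => //.
      by move=> c; rewrite in_itv/= => /andP[_ /ltW cx]; exact: HF.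
    apply: derivable_within_continuous => c; rewrite in_itv/= => /andP[_ cx].
    by have [] := HF _ cx.
  rewrite -subr_ge0 E mulr_ge0 ?subr_ge0 ?(ltW yx)//; apply: HdF.
  by move: cI; rewrite in_itv/= => /andP[_ /ltW].
(* [- phi / x - Phi] has derivative [phi / x^2] and is at least [- e] far to the left; the slack [e]
   replaces a limit. *)
have up : Phi x <= - phi x / x.
  apply/ler_addgt0Pr => e e0; have [y yx ye] := Phi_small_left x e0.
  have := nd (fun y => - phi y / y - Phi y) (fun y => phi y / y ^+ 2) _ _ y yx.
  have y0 : y < 0 by lra.
  have : 0 <= - phi y / y by rewrite mulNr -mulrN -invrN divr_ge0 ?ltW ?phi_gt0// ltrNr oppr0.
  move=> h1 h2; have {}h2 : - phi y / y - Phi y <= - phi x / x - Phi x.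
    apply: h2 => w wx; last by rewrite divr_ge0 ?sqr_ge0// ltW// phi_gt0.
    have w0 : w != 0 by rewrite lt_eqF//; lra.
    have := is_derive1B (is_derive1M (is_derive1N (is_derive_phi w)) (is_derive1V w0 (is_derive_id w 1))) (is_derive_Phi w).
    by move=> H; apply: (is_derive1_eq H) => /=; field.
  lra.
have lo : - x * phi x / (1 + x ^+ 2) <= Phi x.
  apply/ler_addgt0Pr => e e0.
  (* The second argument makes [|y| e] at least the peak of [phi], whence
     [y phi(y) / (1 + y^2) >= - e]. The function [Phi + y phi / (1 + y^2)] increases. *)
  pose y := Num.min (x - 1) (- normal_peak 1 / e).
  have yx : y < x by rewrite (le_lt_trans (_ : _ <= x - 1)) ?ge_min ?lexx// ltrBlDr ltrDl.
  have y0 : y < 0 by lra.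
  have ye : normal_peak 1 <= - y * e.
    by rewrite -ler_pdivrMr// lerNr -mulNr ge_min lexx orbT.
  have := nd (fun y => Phi y + y * phi y / (1 + y ^+ 2)) (fun y => 2 * phi y / (1 + y ^+ 2) ^+ 2) _ _ y yx.
  have h1 : - e <= y * phi y / (1 + y ^+ 2).
    rewrite ler_pdivlMr; last by have := sqr_ge0 y; lra.
    have := phi_le_peak y; have := phi_gt0 y; rewrite expr2; nra.
  have := Phi_ge0 y => h0 h2; have {}h2 : Phi y + y * phi y / (1 + y ^+ 2) <= Phi x + x * phi x / (1 + x ^+ 2).
    apply: h2 => w wx; last first.
      by rewrite divr_ge0 ?sqr_ge0// mulr_ge0// ltW// phi_gt0.
    have w0 : 1 + w ^+ 2 != 0 by rewrite gt_eqF//; have := sqr_ge0 w; lra.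
    have := is_derive1D (is_derive_Phi w) (is_derive1M (is_derive1M (is_derive_id w 1) (is_derive_phi w))
      (@is_derive1V _ (fun y => 1 + y ^+ 2) _ _ w0 (is_derive1D (is_derive_cst (1 : R) w 1) (is_derive1_sqr w)))).
    by move=> H; apply: (is_derive1_eq H) => /=; field.
  rewrite !mulNr; lra.
have p0 := phi_gt0 x; have xx : 0 < 1 + x ^+ 2 by have := sqr_ge0 x; lra.
have A0 : 0 <= A by rewrite divr_ge0 ?Phi_ge0 ?ltW.
have up' : A * - x <= 1.
  rewrite mulrAC ler_pdivrMr// mul1r -ler_pdivlMr; last lra.
  by rewrite invrN mulrN -mulNr.
have lo' : - x <= A * (1 + x ^+ 2).
  by rewrite mulrAC ler_pdivlMr// -ler_pdivrMr.
split; apply/andP; split => //; nra.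
Qed.

End gaussian.

(** * Univariate Stein equations *)

Section splines.
Context {R : realType}.
Implicit Types x y : R.

Definition posp x : R := Num.max x 0.

Lemma posp_cases x : (x <= 0 /\ posp x = 0) \/ (0 <= x /\ posp x = x).
Proof. by rewrite /posp; case: (leP x 0) => h; [left|right]; split => //; exact: ltW. Qed.

Lemma is_derive_posp2 x : is_derive x 1 (fun y => posp y ^+ 2) (2 * posp x).
Proof.
apply: (@is_derive1_quadratic _ _ _ _ 1) => y; rewrite ler_norml !expr2.
have hp (u v : R) : 0 <= u -> 0 <= v -> 0 <= u * v by exact: mulr_ge0.
have := sqr_ge0 (y - x); have := sqr_ge0 x; have := sqr_ge0 y; rewrite !expr2 => s1 s2 s3.
case: (posp_cases x) => -[hx ->]; case: (posp_cases y) => -[hy ->]; apply/andP.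
- by split; nra.
- by have := hp (- x) y; rewrite oppr_ge0 => /(_ hx hy) ?; split; nra.
- by have := hp x (- y); rewrite oppr_ge0 => /(_ hx hy) ?; split; nra.
- by split; nra.
Qed.

Lemma is_derive_posp3 x : is_derive x 1 (fun y => posp y ^+ 3) (3 * posp x ^+ 2).
Proof.
have -> : (fun y => posp y ^+ 3) = (fun y => y * posp y ^+ 2).
  by apply/funext => y; case: (posp_cases y) => -[_ ->]; ring.
apply: (is_derive1_eq (is_derive1M (is_derive_id x 1) (is_derive_posp2 x))).
by case: (posp_cases x) => -[_ ->]; ring.
Qed.

Lemma is_derive1_shift (f : R -> R) x a b : is_derive (x + a) 1 f b ->
  is_derive x 1 (fun y => f (y + a)) b.
Proof.
move=> Hf; have H := is_derive1D (is_derive_id x 1) (is_derive_cst a x 1).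
by apply: (is_derive1_eq (@is_derive1_comp R f _ x _ _ Hf H)); rewrite addr0 mulr1.
Qed.

(** The linear B-spline and its first two antiderivatives, written as second differences of [posp],
    [posp^2 / 2] and [posp^3 / 6]. *)
Definition hat x := posp (x + 1) - 2 * posp x + posp (x - 1).
Definition smooth_step x := (posp (x + 1) ^+ 2 - 2 * posp x ^+ 2 + posp (x - 1) ^+ 2) / 2.
Definition smooth_ramp x := (posp (x + 1) ^+ 3 - 2 * posp x ^+ 3 + posp (x - 1) ^+ 3) / 6.

Lemma is_derive_smooth_step x : is_derive x 1 smooth_step (hat x).
Proof.
have d a := is_derive1_shift (is_derive_posp2 (x + a)).
have := is_derive1M (is_derive1D (is_derive1B (d 1) (is_derive1Ml 2 (is_derive_posp2 x))) (d (-1)))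
  (is_derive_cst (2^-1 : R) x 1).
by move=> H; apply: (is_derive1_eq H) => /=; rewrite /hat; field.
Qed.

Lemma is_derive_smooth_ramp x : is_derive x 1 smooth_ramp (smooth_step x).
Proof.
have d a := is_derive1_shift (is_derive_posp3 (x + a)).
have := is_derive1M (is_derive1D (is_derive1B (d 1) (is_derive1Ml 2 (is_derive_posp3 x))) (d (-1)))
  (is_derive_cst (6^-1 : R) x 1).
by move=> H; apply: (is_derive1_eq H) => /=; rewrite /smooth_step; field.
Qed.

Lemma hat_ge0_le1 x : 0 <= hat x <= 1.
Proof.
rewrite /hat; case: (posp_cases x) => -[hx ->]; case: (posp_cases (x + 1)) => -[h1 ->];
  case: (posp_cases (x - 1)) => -[h2 ->]; apply/andP; split; lra.
Qed.

Lemma posp_lipschitz x y : `|posp x - posp y| <= `|x - y|.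
Proof.
case: (posp_cases x) => -[hx ->]; case: (posp_cases y) => -[hy ->];
 rewrite ler_norml; (have [h|h] := leP 0 (x - y); [rewrite ger0_norm//|rewrite ltr0_norm//]); apply/andP; split; lra.
Qed.

Lemma hat_lipschitz x y : `|hat x - hat y| <= 4 * `|x - y|.
Proof.
have h1 := posp_lipschitz (x + 1) (y + 1); have h2 := posp_lipschitz x y.
have h3 := posp_lipschitz (x - 1) (y - 1).
have e1 : x + 1 - (y + 1) = x - y by ring.
have e3 : x - 1 - (y - 1) = x - y by ring.
rewrite e1 in h1; rewrite e3 in h3; rewrite /hat.
move: h1 h2 h3; rewrite !ler_norml => /andP[? ?] /andP[? ?] /andP[? ?].
by apply/andP; split; lra.
Qed.

Lemma smooth_step0 x : x <= -1 -> smooth_step x = 0.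
Proof.
move=> hx; rewrite /smooth_step; case: (posp_cases x) => -[? ->]; case: (posp_cases (x + 1)) => -[? ->];
  case: (posp_cases (x - 1)) => -[? ->]; nra.
Qed.

Lemma smooth_step1 x : 1 <= x -> smooth_step x = 1.
Proof.
move=> hx; rewrite /smooth_step; case: (posp_cases x) => -[? ->]; case: (posp_cases (x + 1)) => -[? ->];
  case: (posp_cases (x - 1)) => -[? ->]; nra.
Qed.

Lemma hat0 x : 1 <= `|x| -> hat x = 0.
Proof.
rewrite ler_normr => hx; rewrite /hat; case: (posp_cases x) => -[? ->]; case: (posp_cases (x + 1)) => -[? ->];
  case: (posp_cases (x - 1)) => -[? ->]; case/orP: hx => hx; lra.
Qed.

Lemma smooth_ramp0 x : x <= -1 -> smooth_ramp x = 0.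
Proof.
move=> hx.
have h a : a <= 1 -> posp (x + a) = 0 by move=> ?; case: (posp_cases (x + a)) => -[? ->]; lra.
rewrite /smooth_ramp -[in posp x](addr0 x) !h; [by field|lra..].
Qed.

(** No additive constant remains, because [smooth_step] has integral exactly 1 over [[-1, 1]]; this
    is what makes the Gaussian mean of [step] exact. *)
Lemma smooth_ramp_id x : 1 <= x -> smooth_ramp x = x.
Proof.
move=> hx.
have h a : -1 <= a -> posp (x + a) = x + a by move=> ?; case: (posp_cases (x + a)) => -[? ->]; lra.
rewrite /smooth_ramp -[in posp x](addr0 x) !h; [by field|lra..].
Qed.

Lemma smooth_step_homo x y : x <= y -> smooth_step x <= smooth_step y.
Proof.
rewrite le_eqVlt => /predU1P[->//|xy].
have [z _ E] : exists2 z, z \in `]x, y[%R & smooth_step y - smooth_step x = hat z * (y - x).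
  apply: MVT => //; first by move=> z _; exact: is_derive_smooth_step.
  by apply: continuous_subspaceT; exact: is_derive1_continuous is_derive_smooth_step.
rewrite -subr_ge0 E mulr_ge0 ?subr_ge0 ?(ltW xy)//.
by have /andP[] := hat_ge0_le1 z.
Qed.

Lemma smooth_step_ge0_le1 x : 0 <= smooth_step x <= 1.
Proof.
apply/andP; split.
  have [h|h] := leP x (-1); first by rewrite smooth_step0.
  by rewrite -(@smooth_step0 (-1))// smooth_step_homo// ltW.
have [h|h] := leP 1 x; first by rewrite smooth_step1.
by rewrite -(@smooth_step1 1)// smooth_step_homo// ltW.
Qed.

End splines.

Section stein_class.
Context {R : realType}.
Implicit Types (f g : R -> R).

Definition C11 g g' (C : R) := [/\ forall x : R, is_derive x 1 g (g' x),
  forall x, `|g x| <= C, forall x, `|g' x| <= C &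
  forall x y, `|g' x - g' y| <= C * `|x - y|].

(* Stein's equation: [g - c = f' - x f] has a solution smooth enough for the
   exchange argument, which forces [c] to be the Gaussian mean of [g]. *)
Definition stein_nice g c := exists g' f f' C,
  [/\ C11 g g' C, C11 f f' C & forall x, f' x - x * f x = g x - c].

Lemma C11_lin a b f f' g g' C D : C11 f f' C -> C11 g g' D ->
  C11 (fun x => a * f x + b * g x) (fun x => a * f' x + b * g' x) (`|a| * C + `|b| * D).
Proof.
move=> [f1 f2 f3 f4] [g1 g2 g3 g4]; split.
- by move=> x; apply: is_derive1D; exact: is_derive1Ml.
- by move=> x; rewrite (le_trans (ler_normD _ _))// !normrM lerD// ler_wpM2l.
- by move=> x; rewrite (le_trans (ler_normD _ _))// !normrM lerD// ler_wpM2l.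
- move=> x y; have -> : a * f' x + b * g' x - (a * f' y + b * g' y) =
    a * (f' x - f' y) + b * (g' x - g' y) by ring.
  by rewrite (le_trans (ler_normD _ _))// !normrM mulrDl -!mulrA lerD// ler_wpM2l.
Qed.

Lemma stein_nice_lin a b f g c d : stein_nice f c -> stein_nice g d ->
  stein_nice (fun x => a * f x + b * g x) (a * c + b * d).
Proof.
move=> [f' [u [u' [C [h1 h2 h3]]]]] [g' [v [v' [D [k1 k2 k3]]]]].
exists (fun x => a * f' x + b * g' x), (fun x => a * u x + b * v x), (fun x => a * u' x + b * v' x), (`|a| * C + `|b| * D).
split; [exact: C11_lin|exact: C11_lin|move=> x].
have -> : a * f x + b * g x - (a * c + b * d) = a * (f x - c) + b * (g x - d) by ring.
rewrite -h3 -k3; ring.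
Qed.

Lemma stein_nice_cst c : stein_nice (fun=> c) c.
Proof.
exists (fun=> 0), (fun=> 0), (fun=> 0), `|c|; split.
- split => *; rewrite ?normr0 ?subrr ?normr0 ?mulr_ge0//; exact: is_derive_cst.
- split => *; rewrite ?normr0 ?subrr ?normr0 ?mulr_ge0//; exact: is_derive_cst.
- by move=> x; rewrite mulr0 !subrr.
Qed.

Lemma normrM_le1 (c b : R) : 0 <= c <= 1 -> 0 <= b <= 1 -> `|c * b| <= 1.
Proof.
move=> /andP[c0 c1] /andP[b0 b1]; rewrite ger0_norm ?mulr_ge0//.
by rewrite -[leRHS]mul1r ler_pM.
Qed.

Definition step (t eta x : R) := smooth_step ((Phi x - t) / eta).

(** Try [f = V(Phi) / phi]. Then [f' - x f = V'(Phi)], so [V] must be an antiderivative of the step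
    minus its mean, in the variable [p = Phi x]. The margins on [t] and [eta] make the step constant
    near [p = 0] and [p = 1], which keeps [f] bounded. *)
Lemma step_nice (t eta : R) : 0 < eta -> 0 < t - eta -> t + eta < 1 ->
  stein_nice (step t eta) (1 - t).
Proof.
move=> e0 te0 te1.
pose pk : R := normal_peak 1.
have pk0 : 0 <= pk := normal_peak_ge0 1.
pose u x := (Phi x - t) / eta.
have du (x : R) : is_derive x 1 u (phi x / eta).
  have := is_derive1M (is_derive1B (is_derive_Phi x) (is_derive_cst t x 1)) (is_derive_cst eta^-1 x 1).
  by move=> H; apply: (is_derive1_eq H) => /=; ring.
pose g' x := hat (u x) * (phi x / eta).
have dg (x : R) : is_derive x 1 (step t eta) (g' x).
  exact: (is_derive1_comp (is_derive_smooth_step (u x)) (du x)).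
have phib x : `|phi x| <= pk by rewrite gtr0_norm ?phi_gt0// phi_le_peak.
have hatb (x : R) : `|hat x| <= 1.
  by have /andP[h1 h2] := hat_ge0_le1 x; rewrite ger0_norm.
have stepb (x : R) : 0 <= step t eta x <= 1 by exact: smooth_step_ge0_le1.
have ulip x y : `|u x - u y| <= pk / eta * `|x - y|.
  apply: lipschitz_derive du _ _ _ => z.
  by rewrite normrM (gtr0_norm (_ : 0 < eta^-1)) ?invr_gt0// ler_wpM2r// invr_ge0 ltW.
have philip x y : `|phi x - phi y| <= pk * `|x - y|.
  apply: lipschitz_derive is_derive_phi _ _ _ => z.
  by rewrite mulNr normrN normr_Mphi_le.
have g'lip x y : `|g' x - g' y| <= ((4 * (pk / eta)) * (pk / eta) + pk / eta) * `|x - y|.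
  have -> : g' x - g' y = (hat (u x) - hat (u y)) * (phi x / eta) + hat (u y) * ((phi x - phi y) / eta).
    by rewrite /g'; ring.
  rewrite (le_trans (ler_normD _ _))// [leRHS]mulrDl lerD//.
    rewrite normrM [leRHS]mulrAC ler_pM//; last first.
      by rewrite normrM (gtr0_norm (_ : 0 < eta^-1)) ?invr_gt0// ler_wpM2r// invr_ge0 ltW.
    by rewrite (le_trans (hat_lipschitz _ _))// -[leRHS]mulrA ler_wpM2l.
  rewrite normrM -[leRHS]mul1r ler_pM// normrM (gtr0_norm (_ : 0 < eta^-1)) ?invr_gt0//.
  by rewrite mulrAC ler_wpM2r// invr_ge0 ltW.
have g'b x : `|g' x| <= pk / eta.
  rewrite normrM -[leRHS]mul1r ler_pM// normrM (gtr0_norm (_ : 0 < eta^-1)) ?invr_gt0//.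
  by rewrite ler_wpM2r// invr_ge0 ltW.
(* [V 0 = V 1 = 0]; a nonzero boundary value would make [V(Phi) / phi] explode in a tail. *)
pose V p := eta * smooth_ramp ((p - t) / eta) - (1 - t) * p.
pose f x := V (Phi x) / phi x.
pose f' x := step t eta x - (1 - t) + x * f x.
pose f'' x := g' x + (f x + x * f' x).
have phi0 (x : R) : phi x != 0 by rewrite gt_eqF// phi_gt0.
have df (x : R) : is_derive x 1 f (f' x).
  have d1 : is_derive x 1 (fun x => V (Phi x)) ((step t eta x - (1 - t)) * phi x).
    have := is_derive1B (is_derive1Ml eta (is_derive1_comp (is_derive_smooth_ramp (u x)) (du x)))
      (is_derive1Ml (1 - t) (is_derive_Phi x)).
    move=> H; apply: (is_derive1_eq H); rewrite /step -/(u x); field.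
    by rewrite gt_eqF.
  have := is_derive1M d1 (is_derive1V (phi0 x) (is_derive_phi x)).
  move=> H; apply: (is_derive1_eq H); rewrite /f' /f; field; exact: phi0.
have df' (x : R) : is_derive x 1 f' (f'' x).
  have := is_derive1D (is_derive1B (dg x) (is_derive_cst (1 - t) x 1)) (is_derive1M (is_derive_id x 1) (df x)).
  by move=> H; apply: (is_derive1_eq H); rewrite /f'' subr0 mul1r.
(* Beyond [L], [Phi x] is below [t - eta] or above [t + eta]. The step is constant there, [g']
   vanishes, and [mills] bounds [f] and its two derivatives. *)
have [L L1 tail] : exists2 L, 1 <= L & forall x, L < `|x| -> [/\ `|f x| <= 1, `|f' x| <= 1 & `|f'' x| <= 1].
  have [y1 y1n Hy1] := Phi_small_left (-1) te0.
  have te1' : 0 < 1 - (t + eta) by lra.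
  have [y2 y2n Hy2] := Phi_small_left (-1) te1'.
  exists (Num.max (- y1) (- y2)); first by rewrite le_max; apply/orP; left; lra.
  move=> x; rewrite gt_max => /andP[x1 x2].
  have [x0|x0] := leP x 0.
    rewrite ler0_norm// in x1 x2.
    have xm : x <= -1 by lra.
    have um : u x <= -1.
      rewrite ler_pdivrMr//; have : Phi x <= Phi y1 by apply: Phi_le; lra.
      lra.
    have fE : f x = - (1 - t) * (Phi x / phi x).
      by rewrite /f /V -/(u x) smooth_ramp0//; ring.
    have sE : step t eta x = 0 by exact: smooth_step0.
    have gE : g' x = 0 by rewrite /g' hat0 ?mul0r// ler0_norm; lra.
    have [] := mills xm; rewrite /f'' gE /f' sE fE; set A := Phi x / phi x => a1 a3 a5.
    have t01 : 0 <= 1 - t <= 1 by apply/andP; split; clear -te0 te1 e0; lra.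
    split.
    - by rewrite mulNr normrN normrM_le1.
    - have -> : 0 - (1 - t) + x * (- (1 - t) * A) = - ((1 - t) * (1 + x * A)) by ring.
      by rewrite normrN normrM_le1.
    - have -> : 0 + (- (1 - t) * A + x * (0 - (1 - t) + x * (- (1 - t) * A))) =
        - ((1 - t) * (A * (1 + x ^+ 2) + x)) by ring.
      by rewrite normrN normrM_le1.
  rewrite gtr0_norm// in x1 x2.
  have xm : - x <= -1 by lra.
  have um : 1 <= u x.
    rewrite ler_pdivlMr// mul1r; have : Phi (- x) <= Phi y2 by apply: Phi_le; lra.
    rewrite Phi_opp; lra.
  (* Near [p = 1] one has [V p = - t (1 - p)], so by symmetry the right tail is again a Mills ratio,
     at [- x]. *)
  have fE : f x = - t * (Phi (- x) / phi (- x)).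
    rewrite /f /V -/(u x) smooth_ramp_id// /u phiN Phi_opp; field.
    by rewrite phi0 gt_eqF.
  have sE : step t eta x = 1 by exact: smooth_step1.
  have gE : g' x = 0 by rewrite /g' hat0 ?mul0r// ger0_norm; lra.
  have [] := mills xm; rewrite sqrrN.
  rewrite /f'' gE /f' sE fE; set A := Phi (- x) / phi (- x) => a1 a3 a5.
  have t01 : 0 <= t <= 1 by apply/andP; split; clear -te0 te1 e0; lra.
  split.
  - by rewrite mulNr normrN normrM_le1.
  - have -> : 1 - (1 - t) + x * (- t * A) = t * (1 + - x * A) by ring.
    by rewrite normrM_le1.
  - have -> : 0 + (- t * A + x * (1 - (1 - t) + x * (- t * A))) =
      - (t * (A * (1 + x ^+ 2) + - x)) by ring.
    by rewrite normrN normrM_le1.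
(* On [[-L, L]] continuity bounds [f]; the Stein equation and its derivative then bound [f'] and
   [f'']. *)
have [B HB] := bounded_on_segment L (is_derive1_continuous df).
have B0 : 0 <= B by apply: le_trans (HB 0 _); rewrite ?normr0//; lra.
pose C2 := 1 + L * B.
pose C3 := pk / eta + (B + L * C2).
have C20 : 0 <= C2 by rewrite /C2; nra.
have C30 : 0 <= C3 by rewrite /C3 !addr_ge0// ?mulr_ge0// ?invr_ge0; lra.
have f'in x : `|x| <= L -> `|f' x| <= C2.
  move=> xL; rewrite (le_trans (ler_normD _ _))// lerD//.
    by have /andP[s0 s1] := stepb x; rewrite ler_norml; apply/andP; clear -s0 s1 te0 te1 e0; split; lra.
  by rewrite normrM ler_pM// HB.
have f''in x : `|x| <= L -> `|f'' x| <= C3.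
  move=> xL; rewrite (le_trans (ler_normD _ _))// lerD//.
  rewrite (le_trans (ler_normD _ _))// lerD//; first exact: HB.
  by rewrite normrM ler_pM// f'in.
pose C := 1 + B + C2 + C3 + pk / eta + (4 * (pk / eta)) * (pk / eta).
have pe : 0 <= pk / eta by rewrite divr_ge0// ltW.
have pe2 : 0 <= (4 * (pk / eta)) * (pk / eta) by rewrite mulr_ge0// mulr_ge0.
have [CC1 CB CC2 CC3 [CC4 CC5]] : [/\ 1 <= C, B <= C, C2 <= C, C3 <= C &
    pk / eta <= C /\ (4 * (pk / eta)) * (pk / eta) + pk / eta <= C].
  rewrite /C; move: pe pe2 B0 C20 C30; clear; move: (pk / eta) (4 * _ * _) => u v; clear.
  by move=> *; split; [| | | |split]; lra.
exists g', f, f', C; split; last by move=> x; rewrite /f'; ring.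
- split=> //.
  + by move=> x; have /andP[s0 s1] := stepb x; rewrite ger0_norm// (le_trans s1).
  + by move=> x; rewrite (le_trans (g'b x)).
  + by move=> x y; rewrite (le_trans (g'lip x y))// ler_wpM2r.
- split=> //.
  + move=> x; have [xL|/tail[xL _ _]] := leP `|x| L; last by rewrite (le_trans xL).
    by rewrite (le_trans (HB _ xL)).
  + move=> x; have [xL|/tail[_ xL _]] := leP `|x| L; last by rewrite (le_trans xL).
    by rewrite (le_trans (f'in _ xL)).
  + apply: lipschitz_derive df' _ => x; have [xL|/tail[_ _ xL]] := leP `|x| L; last by rewrite (le_trans xL).
    by rewrite (le_trans (f''in _ xL)).
Qed.

Lemma Phi_lipschitz (x y : R) : `|Phi x - Phi y| <= normal_peak 1 * `|x - y|.
Proof.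
apply: lipschitz_derive is_derive_Phi _ _ _ => z.
by rewrite gtr0_norm ?phi_gt0// phi_le_peak.
Qed.

(** Rescaling the threshold by [rho] moves it by less than [z * kappa], too little to cross a [w]
    that far from both endpoints. *)
Lemma lt_norm_perturb (z kappa w rho : R) : 0 < z -> `|rho - 1| < kappa ->
  z * kappa < `|w - z| -> z * kappa < `|w - - z| ->
  (`|w| < z * rho) = (- z < w < z).
Proof.
move=> z0; rewrite ltr_norml => /andP[r1 r2] h1 h2.
have zr1 : z * rho < z + z * kappa by nra.
have zr2 : z - z * kappa < z * rho by nra.
have zk : 0 < z * kappa by rewrite mulr_gt0//; lra.
rewrite opprK in h2; rewrite ltr_norml.
have [wz|wz|wz] := ltgtP w z; last by move: h1; rewrite wz subrr normr0; lra.
- rewrite andbT; rewrite ltr0_norm in h1; last lra.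
  have [wz2|wz2|wz2] := ltgtP (- z) w; last by move: h2; rewrite -wz2 addNr normr0; lra.
  + by rewrite gtr0_norm in h2; [apply/andP; split|]; lra.
  + rewrite ltr0_norm in h2; last lra.
    by apply/negP => /andP[? ?]; lra.
- rewrite andbF; rewrite gtr0_norm in h1; last lra.
  by apply/negP => /andP[? ?]; lra.
Qed.

(** [g] imitates the indicator of [(-z, z)] by a step at [a / 2] minus a step at [1 - a / 2]. Only
    near the endpoints can it differ from the acceptance decision, even with a perturbed scale
    [rho]; there the bump [b] is at least 1. *)
Lemma acceptance_approx (a z e : R) : 0 < a < 1 -> 0 < z -> Phi z = 1 - a / 2 -> 0 < e ->
  exists g b cb kappa, [/\ stein_nice g (1 - a) /\ stein_nice b cb, cb <= e, 0 < kappa, (forall w, 0 <= g w <= 1) &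
    forall w rho, `|rho - 1| < kappa ->
      `|((`|w| < z * rho)%R)%:R - g w| <= b w].
Proof.
move=> /andP[a0 a1] z0 Pz e0.
pose t1 := a / 2; pose t2 := 1 - a / 2.
have Pz' : Phi (- z) = t1 by rewrite Phi_opp Pz /t1; ring.
(* The bumps have total mean [12 * eta]. The bound by [a / 20] keeps every shifted level, with
   margin [eta], inside the unit interval. *)
pose eta := Num.min (e / 12) (Num.min a (1 - a) / 20).
have m0 : 0 < Num.min a (1 - a) by rewrite lt_min a0 subr_gt0.
have ma : Num.min a (1 - a) <= a by rewrite ge_min lexx.
have ma' : Num.min a (1 - a) <= 1 - a by rewrite ge_min lexx orbT.
have eta0 : 0 < eta by rewrite lt_min !divr_gt0.
have etae : eta <= e / 12 by rewrite ge_min lexx.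
have etam : eta <= Num.min a (1 - a) / 20 by rewrite ge_min lexx orbT.
have nice t : t1 - 3 * eta <= t <= t2 + 3 * eta -> stein_nice (step t eta) (1 - t).
  by move=> /andP[h1 h2]; apply: step_nice => //; rewrite /t1 /t2 in h1 h2; lra.
pose g x := 1 * step t1 eta x + (-1) * step t2 eta x.
(* With shifts of [3 * eta] and transitions of half-width [eta], [b1] equals 1 as soon as [Phi x] is
   within [2 * eta] of [t1]; likewise [b2] at [t2]. *)
pose b1 x := 1 * step (t1 - 3 * eta) eta x + (-1) * step (t1 + 3 * eta) eta x.
pose b2 x := 1 * step (t2 - 3 * eta) eta x + (-1) * step (t2 + 3 * eta) eta x.
pose b x := 1 * b1 x + 1 * b2 x.
(* Since [Phi] is Lipschitz with constant [normal_peak 1], a move of [z * kappa] changes [Phi] by at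
   most [eta]. *)
pose kappa := eta / (normal_peak 1 + 1) / z.
have pk0 : 0 <= normal_peak 1 :> R := normal_peak_ge0 1.
have k0 : 0 < kappa by rewrite !divr_gt0// ltr_wpDl.
exists g, b, (12 * eta), kappa; split => //; last 2 first.
- move=> w; rewrite /g mul1r mulN1r.
  have /andP[s10 s11] : 0 <= step t1 eta w <= 1 by exact: smooth_step_ge0_le1.
  have /andP[s20 s21] : 0 <= step t2 eta w <= 1 by exact: smooth_step_ge0_le1.
  rewrite subr_ge0 smooth_step_homo/=; last by rewrite ler_pM2r ?invr_gt0// lerD2l lerN2 /t1 /t2; clear -a0 a1; lra.
  by clear -s11 s20; lra.
- move=> w rho Hrho; rewrite /g /b /b1 /b2 !mul1r !mulN1r.
  set p := Phi w.
  have st t : 0 <= step t eta w <= 1 by exact: smooth_step_ge0_le1.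
  have st0 t : p <= t - eta -> step t eta w = 0.
    by move=> h; apply: smooth_step0; rewrite ler_pdivrMr// -/p; lra.
  have st1 t : t + eta <= p -> step t eta w = 1.
    by move=> h; apply: smooth_step1; rewrite ler_pdivlMr// -/p; lra.
  have homo t t' : t <= t' -> step t' eta w <= step t eta w.
    by move=> h; apply: smooth_step_homo; rewrite ler_pM2r ?invr_gt0//; lra.
  have b1ge := homo (t1 - 3 * eta) (t1 + 3 * eta) ltac:(lra).
  have b2ge := homo (t2 - 3 * eta) (t2 + 3 * eta) ltac:(lra).
  have gge := homo t1 t2 ltac:(rewrite /t1 /t2; lra).
  have /andP[s10 s11] := st t1; have /andP[s20 s21] := st t2.
  have I01 : 0 <= (((`|w| < z * rho)%R)%:R : R) <= 1 by case: (_ < _); rewrite /= ?lexx ler01.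
  have [n1|f1] := leP `|p - t1| (2 * eta).
    move: n1; rewrite ler_norml => /andP[n1 n2].
    rewrite (st1 (t1 - 3 * eta)) ?(st0 (t1 + 3 * eta)); [|lra..].
    case/andP: I01 => ? ?; rewrite ler_norml; apply/andP; split; lra.
  have [n1|f2] := leP `|p - t2| (2 * eta).
    move: n1; rewrite ler_norml => /andP[n1 n2].
    rewrite (st1 (t2 - 3 * eta)) ?(st0 (t2 + 3 * eta)); [|lra..].
    case/andP: I01 => ? ?; rewrite ler_norml; apply/andP; split; lra.
  have far x : `|p - Phi x| > 2 * eta -> `|w - x| > z * kappa.
    move=> h; rewrite ltNge; apply/negP => hwx; move: h; rewrite ltNge => /negP; apply.
    rewrite (le_trans (Phi_lipschitz _ _))// (le_trans (ler_wpM2l pk0 hwx))//.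
    have pk1 : 0 < normal_peak 1 + 1 :> R by rewrite ltr_wpDl.
    have -> : z * kappa = eta / (normal_peak 1 + 1) by rewrite /kappa; field; rewrite !gt_eqF.
    rewrite mulrA ler_pdivrMr//; nra.
  have w1 := far z; rewrite Pz in w1; have {}w1 := w1 f2.
  have w2 := far (- z); rewrite Pz' in w2; have {}w2 := w2 f1.
  rewrite (lt_norm_perturb z0 Hrho w1 w2).
  have Pw x : x <= w -> Phi x <= p by exact: Phi_le.
  have Pw' x : w <= x -> p <= Phi x by exact: Phi_le.
  have t12 : t1 <= t2 by rewrite /t1 /t2; clear -a0 a1; lra.
  have {}Pz : Phi z = t2 by [].
  (* Away from both levels each step is exactly 0 or 1, so [g] coincides with the indicator. *)
  suff -> : step t1 eta w - step t2 eta w = ((- z < w < z)%R)%:R.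
    by rewrite subrr normr0 addr_ge0// subr_ge0.
  have [wz|wz] := ltP w z; last first.
    have pt2 : t2 <= p by rewrite -Pz; exact: Pw.
    rewrite ger0_norm in f2; last by rewrite subr_ge0.
    by rewrite (st1 t1) ?(st1 t2) ?andbF ?subrr//; clear -pt2 f2 t12 eta0; lra.
  have {}wz := Pw' _ (ltW wz); rewrite Pz in wz.
  rewrite ler0_norm in f2; last by rewrite subr_le0.
  rewrite (st0 t2) ?andbT; last by clear -wz f2 eta0; lra.
  have [wz2|wz2] := ltP (- z) w.
    have {}wz2 := Pw _ (ltW wz2); rewrite Pz' in wz2.
    rewrite ger0_norm in f1; last by rewrite subr_ge0.
    by rewrite (st1 t1) ?subr0//; clear -wz2 f1 eta0; lra.
  have {}wz2 := Pw' _ wz2; rewrite Pz' in wz2.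
  rewrite ler0_norm in f1; last by rewrite subr_le0.
  by rewrite (st0 t1) ?subr0//; clear -wz2 f1 eta0; lra.
- split.
  have -> : 1 - a = 1 * (1 - t1) + (-1) * (1 - t2) by rewrite /t1 /t2; field.
  by apply: stein_nice_lin; apply: nice; rewrite /t1 /t2; apply/andP; clear -eta0 a0 a1; split; lra.
  have -> : 12 * eta = 1 * (1 * (1 - (t1 - 3 * eta)) + (-1) * (1 - (t1 + 3 * eta))) + 1 * (1 * (1 - (t2 - 3 * eta)) + (-1) * (1 - (t2 + 3 * eta))) by ring.
  apply: stein_nice_lin; apply: stein_nice_lin; apply: nice; rewrite /t1 /t2; apply/andP; clear -eta0 a0 a1; split; lra.
- lra.
Qed.

End stein_class.

(** * Expectations and independence *)

Section real_expectation.
Context d (T : measurableType d) (R : realType) (P : probability T R).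
Implicit Types (f g : T -> R).

(** Real-valued expectations with a separate integrability predicate keep the later estimates in
    ordered-field arithmetic. *)
Definition intg f := P.-integrable setT (EFin \o f).
Definition Ex f : R := \int[P]_w f w.

Lemma intg_measurable f : intg f -> measurable_fun setT f.
Proof. by move=> /integrableP[/measurable_EFinP]. Qed.

Lemma intg_le f g : measurable_fun setT f -> intg g ->
  (forall w, `|f w| <= g w) -> intg f.
Proof.
move=> mf ig fg; apply: (le_integrable measurableT _ _ ig); first exact/measurable_EFinP.
by move=> w _ /=; rewrite lee_fin (le_trans (fg w))// ler_norm.
Qed.

Lemma intg_cst c : intg (fun=> c).
Proof. by apply: finite_measure_integrable_cst. Qed.

Lemma intg_bounded f c : measurable_fun setT f -> (forall w, `|f w| <= c) -> intg f.
Proof. by move=> mf fc; apply: intg_le mf (intg_cst c) fc. Qed.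

Lemma intgD f g : intg f -> intg g -> intg (fun w => f w + g w).
Proof. by move=> hf hg; apply: (integrableD measurableT hf hg). Qed.

Lemma intgZ c f : intg f -> intg (fun w => c * f w).
Proof. by move=> hf; apply: (integrableZl measurableT c hf). Qed.

Lemma intgN f : intg f -> intg (fun w => - f w).
Proof.
move=> hf; have := intgZ (-1) hf; congr intg.
by apply/funext => w; rewrite mulN1r.
Qed.

Lemma intgB f g : intg f -> intg g -> intg (fun w => f w - g w).
Proof. by move=> hf hg; apply: intgD => //; exact: intgN. Qed.

Lemma intg_norm f : intg f -> intg (fun w => `|f w|).
Proof. by move=> hf; have := integrable_abse hf. Qed.

Lemma intg_sum (I : Type) (s : seq I) (h : I -> T -> R) :
  (forall i, intg (h i)) -> intg (fun w => \sum_(i <- s) h i w).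
Proof.
move=> H; elim: s => [|i s IH].
  have := intg_cst 0; congr intg.
  by apply/funext => w; rewrite big_nil.
have := intgD (H i) IH; congr intg.
by apply/funext => w; rewrite big_cons.
Qed.

Lemma intgM_bounded f g c : measurable_fun setT f -> (forall w, `|f w| <= c) ->
  intg g -> intg (fun w => f w * g w).
Proof.
move=> mf fc ig; apply: (@intg_le _ (fun w => c * `|g w|)).
- by apply: measurable_funM => //; exact: intg_measurable.
- by apply: intgZ; exact: intg_norm.
- by move=> w; rewrite normrM ler_wpM2r.
Qed.

Lemma ExD f g : intg f -> intg g -> Ex (fun w => f w + g w) = Ex f + Ex g.
Proof. exact: RintegralD. Qed.

Lemma ExB f g : intg f -> intg g -> Ex (fun w => f w - g w) = Ex f - Ex g.
Proof. exact: RintegralB. Qed.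

Lemma ExZ c f : intg f -> Ex (fun w => c * f w) = c * Ex f.
Proof. exact: RintegralZl. Qed.

Lemma Ex_cst c : Ex (fun=> c) = c.
Proof. by rewrite /Ex Rintegral_cst//= (@probability_setT _ _ _ P) mulr1. Qed.

Lemma eq_Ex f g : (forall w, f w = g w) -> Ex f = Ex g.
Proof. by move=> fg; congr Ex; exact/funext. Qed.

Lemma Ex_sum (I : Type) (s : seq I) (h : I -> T -> R) :
  (forall i, intg (h i)) -> Ex (fun w => \sum_(i <- s) h i w) = \sum_(i <- s) Ex (h i).
Proof.
move=> H; elim: s => [|i s IH].
  rewrite big_nil -[RHS](Ex_cst 0); apply: eq_Ex => w; exact: big_nil.
rewrite big_cons -IH -ExD//; last exact: intg_sum.
by apply: eq_Ex => w; rewrite big_cons.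
Qed.

Lemma Ex_le f g : intg f -> intg g -> (forall w, f w <= g w) -> Ex f <= Ex g.
Proof. by move=> hf hg fg; apply: le_Rintegral. Qed.

Lemma Ex_ge0 f : (forall w, 0 <= f w) -> 0 <= Ex f.
Proof. by move=> f0; apply: Rintegral_ge0. Qed.

Lemma ler_norm_Ex f : intg f -> `|Ex f| <= Ex (fun w => `|f w|).
Proof. by move=> hf; apply: le_normr_Rintegral. Qed.

Lemma ler_norm_Ex_le f g : intg f -> intg g -> (forall w, `|f w| <= g w) -> `|Ex f| <= Ex g.
Proof.
move=> hf hg fg; rewrite (le_trans (ler_norm_Ex hf))//.
by apply: Ex_le => //; exact: intg_norm.
Qed.

Lemma Ex_indic (A : set T) : measurable A -> (Ex \1_A)%:E = P A.
Proof.
move=> mA; rewrite /Ex /Rintegral integral_indic// setIT fineK//.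
exact: fin_num_measure.
Qed.

Lemma intg_indic (A : set T) : measurable A -> intg \1_A.
Proof.
move=> mA; apply: (@intg_bounded _ 1); first exact: measurable_indic.
by move=> w; rewrite indicE; case: (_ \in _); rewrite ?normr1 ?normr0.
Qed.

Lemma expectation_Ex f c : intg f -> ('E_P[f] = c%:E)%E -> Ex f = c.
Proof. by move=> hf; rewrite unlock /Ex /Rintegral => ->. Qed.

End real_expectation.

Section independence.
Context d (T : measurableType d) (R : realType) (P : probability T R).
Implicit Types U V : T -> R.

Definition indep2 U V := forall A B : set R, measurable A -> measurable B ->
  (P (U @^-1` A `&` V @^-1` B) = P (U @^-1` A) * P (V @^-1` B))%E.

(** The joint law agrees with the product of the marginals on rectangles, hence everywhere. Tonelli
    then gives integrability of the product and Fubini its value. *)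
Lemma indep2_Ex U V : indep2 U V -> intg P U -> intg P V ->
  intg P (fun w => U w * V w) /\ Ex P (fun w => U w * V w) = Ex P U * Ex P V.
Proof.
move=> UV iU iV.
have mU := intg_measurable iU; have mV := intg_measurable iV.
pose U' : {RV P >-> R} := HB.pack U (isMeasurableFun.Build _ _ _ _ U mU).
pose V' : {RV P >-> R} := HB.pack V (isMeasurableFun.Build _ _ _ _ V mV).
pose W w := (U w, V w).
have mW : measurable_fun setT W by apply: measurable_fun_pair.
pose W' : {RV P >-> (R * R)%type} := HB.pack W (isMeasurableFun.Build _ _ _ _ W mW).
pose m1 := distribution P U'; pose m2 := distribution P V'.
pose f (z : R * R) := (z.1 * z.2)%:E.
have mf : measurable_fun setT f.
  by apply/measurable_EFinP; apply: measurable_funM; [exact: measurable_fst|exact: measurable_snd].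
have prodE X : measurable X -> (m1 \x m2)%E X = distribution P W' X.
  by apply: product_measure_unique => A B mA mB; rewrite -UV.
have absE X (iX : intg P X) (X' : {RV P >-> R}) : X' =1 X ->
    (\int[distribution P X']_x `|x|%:E)%E = (Ex P (fun w => `|X w|))%:E.
  move=> XX'; rewrite ge0_integral_distribution//=; last first.
    by apply/measurable_EFinP; exact: normr_measurable.
  rewrite /Ex /Rintegral fineK; last by apply: integrable_fin_num => //; exact: intg_norm.
  by apply: eq_integral => w _ /=; rewrite XX'.
have expE X (iX : intg P X) (X' : {RV P >-> R}) : X' =1 X ->
    (\int[distribution P X']_x x%:E)%E = (Ex P X)%:E.
  move=> XX'; have iX' : P.-integrable setT (EFin \o X').
    by apply: eq_integrable iX => // w _ /=; rewrite XX'.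
  rewrite integral_distribution//=.
  rewrite /Ex /Rintegral fineK; last by apply: integrable_fin_num.
  by apply: eq_integral => w _ /=; rewrite XX'.
have iid X (iX : intg P X) (X' : {RV P >-> R}) : X' =1 X ->
    (distribution P X').-integrable setT (fun x => x%:E).
  move=> XX'; apply/integrableP; split; first exact/measurable_EFinP.
  by rewrite /= (absE X)// ltry.
have imf : (m1 \x m2)%E.-integrable setT f.
  apply/integrable12ltyP => //=.
  under eq_integral => x _.
    under eq_integral => y _ do rewrite normrM EFinM.
    rewrite ge0_integralZl//=; last by apply/measurable_EFinP; exact: normr_measurable.
    rewrite (absE V)// muleC.
    over.
  rewrite ge0_integralZl//=; last 2 first.
  - by apply/measurable_EFinP; exact: normr_measurable.
  - by rewrite lee_fin; exact: Ex_ge0.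
  by rewrite (absE U)// -EFinM ltry.
have iUV : intg P (fun w => U w * V w).
  apply/integrableP; split; first by apply/measurable_EFinP; exact: measurable_funM.
  have := @ge0_integral_distribution _ _ _ _ _ P W' (abse \o f).
  move=> /(_ (measurableT_comp (@abse_measurable R setT) mf) (fun=> abse_ge0 _)) => <-.
  rewrite (eq_measure_integral (m1 \x m2)%E); last by move=> A mA _; exact/esym/prodE.
  by move/integrableP : imf => [].
split => //; apply: EFin_inj.
rewrite {1}/Ex /Rintegral fineK; last exact: integrable_fin_num.
transitivity (\int[distribution P W']_z f z)%E.
  by rewrite integral_distribution.
rewrite (eq_measure_integral (m1 \x m2)%E); last by move=> A mA _; exact/esym/prodE.
rewrite -integral12_prod_meas1//= /fubini_F/=.
transitivity (\int[m1]_x ((Ex P V)%:E * x%:E))%E.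
  apply: eq_integral => x _; rewrite -[LHS]/(\int[m2]_y (x%:E * y%:E))%E.
  by rewrite integralZl//; [rewrite (expE V)// muleC|exact: (iid V)].
rewrite integralZl//=; last exact: (iid U).
by rewrite (expE U)// -EFinM mulrC.
Qed.

Variables (eps : nat -> T -> R).
Hypothesis meps : forall i, measurable_fun setT (eps i).
Hypothesis ieps : mutual_indep P setT eps.

(** A pi-system generating the sigma-algebra of all errors other than the [i]-th. Measurability with
    respect to it expresses that a variable does not involve [eps i]. *)
Definition cylinders_avoiding (i : nat) : set (set T) :=
  [set C | exists (s : seq nat) B, [/\ i \notin s, forall j : nat, measurable (B j : set R) &
    C = \bigcap_(j in [set j | j \in s]) (eps j @^-1` B j)]].

Lemma cylinders_setI i : setI_closed (cylinders_avoiding i).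
Proof.
move=> _ _ [s [B [si mB ->]]] [s' [B' [si' mB' ->]]].
exists (s ++ s'), (fun j => (if j \in s then B j else setT) `&` (if j \in s' then B' j else setT)); split.
- by rewrite mem_cat negb_or si.
- by move=> j; apply: measurableI; case: ifP.
- apply/seteqP; split => [w [h1 h2] j /=|w h].
    by rewrite mem_cat => /orP js; split; case: ifP => // ?; [exact: h1|exact: h2].
  by split => j /= js; have := h j; rewrite /= mem_cat js ?orbT => /(_ isT)[].
Qed.

Lemma cylinders_measurable i : cylinders_avoiding i `<=` measurable.
Proof.
move=> _ [s [B [_ mB ->]]]; apply: bigcap_measurableType.
by move=> j _; rewrite -[X in measurable X]setTI; exact: meps.
Qed.

(** For fixed [A], both sides are finite measures in [C]. They agree on the pi-system by mutual
    independence, so they agree on the sigma-algebra it generates. *)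
Lemma indep_cylinders i (A : set R) C : measurable A -> <<s cylinders_avoiding i >> C ->
  (P (eps i @^-1` A `&` C) = P (eps i @^-1` A) * P C)%E.
Proof.
move=> mA hC.
have mepsA : measurable (eps i @^-1` A) by rewrite -[X in measurable X]setTI; exact: meps.
have cT : cylinders_avoiding i setT.
  exists [::], (fun=> setT); split => //.
  by apply/seteqP; split => // w _ j /=; rewrite in_nil.
pose r := fine (P (eps i @^-1` A)).
have r0 : 0 <= r by rewrite fine_ge0.
have rE : (r%:E = P (eps i @^-1` A))%E by rewrite fineK// fin_num_measure.
have := @g_sigma_algebra_measure_unique _ R T (cylinders_avoiding i) (@cylinders_measurable i)
  (fun=> setT) (fun=> cT) _ (mrestr P mepsA) (mscale (NngNum r0) P) (@cylinders_setI i) _ _ C hC.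
rewrite /mrestr/= setIC /mscale/= rE; apply.
- by apply/seteqP; split => // w _; exists 0%N.
- move=> _ [s [B [si mB ->]]].
  (* [mutual_indep] speaks of duplicate-free lists, whereas a cylinder may repeat an index. *)
  have sE : [set j | j \in s] = [set j | j \in undup s] by apply/seteqP; split => j /=; rewrite mem_undup.
  rewrite /mrestr/= sE ieps//; last exact: undup_uniq.
  have -> : \bigcap_(j in [set j | j \in undup s]) eps j @^-1` B j `&` eps i @^-1` A =
    \bigcap_(j in [set j | j \in i :: undup s]) eps j @^-1` (if j == i then A else B j).
    apply/seteqP; split => [w [h1 h2] j /=|w h].
      rewrite inE => /predU1P[->|js]; first by rewrite eqxx.
      by case: eqP => [->//|_]; exact: h1.
    split=> [j /= js|]; last by have := h i; rewrite /= inE eqxx => /(_ isT).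
    have := h j; rewrite /= inE js orbT => /(_ isT).
    by case: eqP => // ji; move: si; rewrite -ji -mem_undup js.
  rewrite ieps//=; last 2 first.
  - by rewrite mem_undup si undup_uniq.
  - by move=> j; case: ifP.
  rewrite big_cons eqxx; congr (_ * _)%E.
  apply: eq_big_seq => j js; case: eqP => // ji; by move: si; rewrite -ji -mem_undup js.
- by move=> k; rewrite /mrestr/= setTI (le_lt_trans (probability_le1 _ _))// ltry.
Qed.

Lemma eps_cyl_measurable i j : j != i ->
  measurable_fun setT (eps j : g_sigma_algebraType (cylinders_avoiding i) -> R).
Proof.
move=> ji _ B mB; rewrite setTI; apply: sub_sigma_algebra.
exists [:: j], (fun=> B); split => //; first by rewrite inE eq_sym.
apply/seteqP; split => [w h k /=|w /(_ j)/=]; first by rewrite inE => /eqP ->.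
by rewrite inE eqxx; exact.
Qed.

Lemma indep_Ex i (u : R -> R) (V : T -> R) : measurable_fun setT u ->
  measurable_fun setT (V : g_sigma_algebraType (cylinders_avoiding i) -> R) ->
  intg P (fun w => u (eps i w)) -> intg P V ->
  intg P (fun w => u (eps i w) * V w) /\
  Ex P (fun w => u (eps i w) * V w) = Ex P (fun w => u (eps i w)) * Ex P V.
Proof.
move=> mu mV iU iV; apply: indep2_Ex => // A B mA mB.
rewrite (_ : (fun w => u (eps i w)) @^-1` A = eps i @^-1` (u @^-1` A))//.
apply: indep_cylinders; first by rewrite -[X in measurable X]setTI; exact: mu.
by have := mV measurableT B mB; rewrite setTI.
Qed.

End independence.

(** * Stein's method for linear statistics *)

Section C11_measurable.
Context {R : realType}.

Lemma C11_measurable (g g' : R -> R) C : C11 g g' C -> measurable_fun setT g /\ measurable_fun setT g'.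
Proof.
move=> [dg _ _ g'L]; split; apply: continuous_measurable_fun.
  exact: is_derive1_continuous dg.
have C0 : 0 <= C by have := g'L 0 1; rewrite sub0r normrN normr1 mulr1; exact: le_trans.
move=> x; apply/cvgrPdist_le => e e0; near=> y.
rewrite (le_trans (g'L _ _))//.
rewrite (@le_trans _ _ ((C + 1) * `|x - y|))// ?ler_wpM2r ?lerDl//.
rewrite mulrC -ler_pdivlMr ?ltr_wpDl//.
near: y; exists (e / (C + 1)) => [|z /= /ltW//]; by rewrite /= divr_gt0// ltr_wpDl.
Unshelve. all: by end_near. Qed.

End C11_measurable.

Section smooth_multivariate.
Context {R : realType} (m : nat).
Implicit Types (w h : 'I_m -> R) (F G : ('I_m -> R) -> R) (D : 'I_m -> ('I_m -> R) -> R).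

Definition l1 h : R := \sum_(k < m) `|h k|.

Lemma l1_ge0 h : 0 <= l1 h.
Proof. by apply: sumr_ge0. Qed.

Lemma ler_l1 h k : `|h k| <= l1 h.
Proof. by rewrite /l1 (bigD1 k)//= lerDl sumr_ge0. Qed.

Lemma l1_sqr_le h : l1 h ^+ 2 <= m%:R * \sum_(k < m) h k ^+ 2.
Proof.
rewrite expr2 /l1 mulr_suml.
apply: (@le_trans _ _ (\sum_(k < m) \sum_(l < m) (h k ^+ 2 + h l ^+ 2) / 2)).
  apply: ler_sum => k _; rewrite mulr_sumr; apply: ler_sum => l _.
  have := sqr_ge0 (`|h k| - `|h l|); rewrite sqrrB !real_normK ?num_real//; lra.
rewrite le_eqVlt; apply/orP; left; apply/eqP.
set S := \sum_(k < m) h k ^+ 2.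
have hk k : \sum_(l < m) (h k ^+ 2 + h l ^+ 2) / 2 = m%:R / 2 * h k ^+ 2 + S / 2.
  by rewrite -mulr_suml big_split/= sumr_const card_ord -/S -[_ *+ m]mulr_natl; field.
rewrite (eq_bigr _ (fun k _ => hk k)) big_split/= -mulr_sumr -/S sumr_const card_ord.
by rewrite -[_ *+ m]mulr_natl; field.
Qed.

Definition vadd w h : 'I_m -> R := fun k => w k + h k.

(* The gradient [D] is only Lipschitz (the test functions are splines of class
   C^{1,1}), so the Taylor bounds are part of the definition. *)
Definition smooth_fun F D (C : R) :=
  [/\ forall w, `|F w| <= C, forall k w, `|D k w| <= C,
    (forall w h, `|F (vadd w h) - F w| <= C * l1 h),
    (forall w h, `|F (vadd w h) - F w - \sum_(k < m) h k * D k w| <= C * l1 h ^+ 2) &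
    (forall k w h, `|D k (vadd w h) - D k w| <= C * l1 h)].

(** Quantifying over all measurable spaces lets the same fact be used for the full sigma-algebra and
    for the one that omits an error. *)
Definition measurable_along F := forall (d : measure_display) (T : measurableType d)
  (W : T -> 'I_m -> R), (forall k, measurable_fun setT (W ^~ k)) ->
  measurable_fun setT (F \o W).

Lemma smooth_fun_ge0 F D C : smooth_fun F D C -> 0 <= C.
Proof. by move=> [h _ _ _ _]; exact: le_trans (normr_ge0 _) (h (fun=> 0)). Qed.

Lemma smooth_cst (c : R) : smooth_fun (fun=> c) (fun _ _ => 0) `|c|.
Proof.
split=> // *; rewrite ?subrr ?normr0 ?mulr_ge0 ?l1_ge0//.
by rewrite big1 => [|i _]; rewrite ?mulr0// subr0 normr0 mulr_ge0 ?sqr_ge0.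
Qed.

Lemma smooth_coord g g' C k : C11 g g' C ->
  smooth_fun (fun w => g (w k)) (fun j w => if j == k then g' (w k) else 0) C.
Proof.
move=> [dg gC g'C g'L].
have C0 : 0 <= C := le_trans (normr_ge0 _) (gC 0).
have gL := lipschitz_derive dg g'C.
split.
- by move=> w; exact: gC.
- by move=> j w; case: eqP => _; [exact: g'C|rewrite normr0].
- move=> w h; rewrite (le_trans (gL _ _))// /vadd addrAC subrr add0r.
  by rewrite ler_wpM2l// ler_l1.
- move=> w h; rewrite (bigD1 k)//= eqxx big1 ?addr0; last first.
    by move=> j /negbTE ->; rewrite mulr0.
  have [x E] : exists2 x, `|x - w k| <= `|h k| & g (vadd w h k) - g (w k) = g' x * h k.
    rewrite /vadd; have [h0|h0] := leP 0 (h k).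
      have [|x|x xI E] := @MVT_segment R g g' (w k) (w k + h k); rewrite ?lerDl//.
        by apply: continuous_subspaceT; exact: is_derive1_continuous dg.
      exists x; last by rewrite E addrAC subrr add0r.
      move: xI; rewrite in_itv/= => /andP[x1 x2].
      by rewrite !ger0_norm ?subr_ge0//; lra.
    have [|x|x xI E] := @MVT_segment R g g' (w k + h k) (w k); rewrite ?gerDl ?ltW//.
      by apply: continuous_subspaceT; exact: is_derive1_continuous dg.
    exists x; last by rewrite -opprB E; ring.
    move: xI; rewrite in_itv/= => /andP[x1 x2].
    by rewrite [leRHS]ltr0_norm// ler0_norm ?subr_le0//; lra.
  move=> ->; rewrite [h k * _]mulrC -mulrBl normrM expr2 mulrA.
  rewrite ler_pM ?ler_l1// (le_trans (g'L _ _))// ler_wpM2l// (le_trans E)//.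
  exact: ler_l1.
- move=> j w h; case: eqP => _; last by rewrite subrr normr0 mulr_ge0 ?l1_ge0.
  rewrite (le_trans (g'L _ _))// /vadd addrAC subrr add0r.
  by rewrite ler_wpM2l// ler_l1.
Qed.

(** The factor 4 counts the terms in the Lipschitz bound of the new gradient, where the most terms
    occur. *)
Lemma smooth_mul F D C G D' C' : smooth_fun F D C -> smooth_fun G D' C' ->
  smooth_fun (fun w => F w * G w) (fun k w => F w * D' k w + G w * D k w) (4 * (C * C')).
Proof.
move=> sF sG; have C0 := smooth_fun_ge0 sF; have C'0 := smooth_fun_ge0 sG.
move: sF sG => [F1 F2 F3 F4 F5] [G1 G2 G3 G4 G5].
have CC : 0 <= C * C' by exact: mulr_ge0.
have nM (a b x y : R) : `|a| <= x -> `|b| <= y -> `|a * b| <= x * y.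
  by move=> h1 h2; rewrite normrM ler_pM.
split.
- by move=> w; rewrite (le_trans (nM _ _ _ _ (F1 w) (G1 w)))//; lra.
- move=> k w; rewrite (le_trans (ler_normD _ _))//.
  have := nM _ _ _ _ (F1 w) (G2 k w); have := nM _ _ _ _ (G1 w) (F2 k w).
  by rewrite [C' * C]mulrC; lra.
- move=> w h; have S0 := l1_ge0 h.
  have -> : F (vadd w h) * G (vadd w h) - F w * G w =
    (F (vadd w h) - F w) * G (vadd w h) + F w * (G (vadd w h) - G w) by ring.
  rewrite (le_trans (ler_normD _ _))//.
  have := nM _ _ _ _ (F3 w h) (G1 (vadd w h)); have := nM _ _ _ _ (F1 w) (G3 w h).
  have : 0 <= C * C' * l1 h by rewrite mulr_ge0.
  rewrite mulrAC [C * (C' * _)]mulrA -[4 * _ * _]mulrA; lra.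
- move=> w h; have S0 := l1_ge0 h.
  set a := F (vadd w h) - F w; set b := G (vadd w h) - G w.
  set u := \sum_(k < m) h k * D k w; set v := \sum_(k < m) h k * D' k w.
  have -> : \sum_(k < m) h k * (F w * D' k w + G w * D k w) = F w * v + G w * u.
    by rewrite /u /v !mulr_sumr -big_split/=; apply: eq_bigr => k _; ring.
  have -> : F (vadd w h) * G (vadd w h) - F w * G w - (F w * v + G w * u) =
    a * b + F w * (b - v) + G w * (a - u) by rewrite /a /b; ring.
  have := nM _ _ _ _ (F3 w h) (G3 w h); have := nM _ _ _ _ (F1 w) (G4 w h).
  have := nM _ _ _ _ (G1 w) (F4 w h); rewrite -/a -/b -/u -/v => h1 h2 h3.
  have : 0 <= C * C' * l1 h ^+ 2 by rewrite mulr_ge0// sqr_ge0.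
  have e1 : C' * (C * l1 h ^+ 2) = C * C' * l1 h ^+ 2 by ring.
  have e2 : C * (C' * l1 h ^+ 2) = C * C' * l1 h ^+ 2 by ring.
  have e3 : C * l1 h * (C' * l1 h) = C * C' * l1 h ^+ 2 by ring.
  rewrite e1 in h1; rewrite e2 in h2; rewrite e3 in h3 => h4.
  have := ler_normD (a * b + F w * (b - v)) (G w * (a - u)).
  have := ler_normD (a * b) (F w * (b - v)).
  rewrite -[4 * _ * _]mulrA; clear -h1 h2 h3 h4; lra.
- move=> k w h; have S0 := l1_ge0 h.
  set w' := vadd w h.
  have -> : F w' * D' k w' + G w' * D k w' - (F w * D' k w + G w * D k w) =
    ((F w' - F w) * D' k w' + F w * (D' k w' - D' k w)) +
    ((G w' - G w) * D k w' + G w * (D k w' - D k w)) by ring.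
  have h1 := nM _ _ _ _ (F3 w h) (G2 k w'); have h2 := nM _ _ _ _ (F1 w) (G5 k w h).
  have h3 := nM _ _ _ _ (G3 w h) (F2 k w'); have h4 := nM _ _ _ _ (G1 w) (F5 k w h).
  have e1 : C * l1 h * C' = C * C' * l1 h by ring.
  have e2 : C * (C' * l1 h) = C * C' * l1 h by ring.
  have e3 : C' * l1 h * C = C * C' * l1 h by ring.
  have e4 : C' * (C * l1 h) = C * C' * l1 h by ring.
  rewrite -/w' e1 in h1; rewrite -/w' e2 in h2; rewrite -/w' e3 in h3; rewrite -/w' e4 in h4.
  have h5 := ler_normD ((F w' - F w) * D' k w' + F w * (D' k w' - D' k w)) ((G w' - G w) * D k w' + G w * (D k w' - D k w)).
  have h6 := ler_normD ((F w' - F w) * D' k w') (F w * (D' k w' - D' k w)).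
  have h7 := ler_normD ((G w' - G w) * D k w') (G w * (D k w' - D k w)).
  rewrite -[4 * _ * _]mulrA; clear -h1 h2 h3 h4 h5 h6 h7; lra.
Qed.

(** The last clause matters in the induction of [stein_clt]: a product over [s] has no derivative in
    a coordinate outside [s]. *)
Lemma smooth_prod (g : 'I_m -> R -> R) (s : seq 'I_m) :
  (forall k, exists g' C, C11 (g k) g' C) ->
  exists D C, [/\ smooth_fun (fun w => \prod_(k <- s) g k (w k)) D C,
    measurable_along (fun w => \prod_(k <- s) g k (w k)),
    forall k, measurable_along (D k) &
    forall k w, k \notin s -> D k w = 0].
Proof.
move=> Hg; elim: s => [|k s [D [C [sF mF mD D0]]]].
  exists (fun _ _ => 0), `|1|; split => //.
  - rewrite (_ : (fun w => _) = (fun=> 1)); first exact: smooth_cst.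
    by apply/funext => w; rewrite big_nil.
  - move=> d T W mW /=; rewrite (_ : _ \o _ = cst 1)//.
    by apply/funext => t /=; rewrite big_nil.
  - by move=> k d T W mW; exact: measurable_cst.
have [g' [C' cg]] := Hg k.
have [mg mg'] := C11_measurable cg.
have := smooth_mul (smooth_coord k cg) sF; set D' := (fun _ _ => _ + _).
have -> : (fun w => g k (w k) * \prod_(j <- s) g j (w j)) = (fun w => \prod_(j <- k :: s) g j (w j)).
  by apply/funext => w; rewrite big_cons.
have mgk : measurable_along (fun w => g k (w k)).
  by move=> d T W mW; exact: (measurableT_comp mg (mW k)).
move=> sF'; exists D', (4 * (C' * C)); split => //.
- move=> d T W mW; rewrite (_ : _ \o _ = (fun t => g k (W t k)) \* ((fun w => \prod_(j <- s) g j (w j)) \o W)).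
    by apply: measurable_funM; [exact: mgk|exact: mF].
  by apply/funext => t /=; rewrite big_cons.
- move=> j d T W mW; apply: measurable_funD; apply: measurable_funM.
  + exact: mgk.
  + exact: mD.
  + exact: mF.
  + by case: (eqVneq j k) => _ /=; [exact: (measurableT_comp mg' (mW k))|exact: measurable_cst].
- move=> j w; rewrite inE negb_or => /andP[jk js]; rewrite /D' D0// (negbTE jk).
  by rewrite !mulr0 addr0.
Qed.

End smooth_multivariate.

Section stein_clt.
Context d (T : measurableType d) (R : realType) (P : probability T R).
Variables (eps : nat -> T -> R) (s2 M : R).
Hypothesis meps : forall i, measurable_fun setT (eps i).
Hypothesis ieps : mutual_indep P setT eps.
Hypothesis e4i : forall i, intg P (fun w => eps i w ^+ 4).
Hypothesis e1 : forall i, Ex P (eps i) = 0.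
Hypothesis e2 : forall i, Ex P (fun w => eps i w ^+ 2) = s2.
Hypothesis e4 : forall i, Ex P (fun w => eps i w ^+ 4) <= M.
Hypothesis s20 : 0 < s2.

(** Lets the fourth moment bound alone supply integrability and uniform bounds for all lower
    absolute moments. *)
Lemma pow4_ge (x : R) : [/\ `|x| <= 1 + x ^+ 4, x ^+ 2 <= 1 + x ^+ 4 & `|x| ^+ 3 <= 1 + x ^+ 4].
Proof.
have -> : x ^+ 4 = `|x| ^+ 4 by rewrite -normrX ger0_norm// exprn_even_ge0.
have -> : x ^+ 2 = `|x| ^+ 2 by rewrite -normrX ger0_norm// exprn_even_ge0.
have y0 := normr_ge0 x; set y := `|x| in y0 *.
have [y1|y1] := leP y 1.
  have y4 : 0 <= y ^+ 4 by exact: exprn_ge0.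
  have ? : y ^+ 2 <= 1 by exact: exprn_ile1.
  have ? : y ^+ 3 <= 1 by exact: exprn_ile1.
  by split; lra.
have h (n : nat) : (n <= 4)%N -> y ^+ n <= y ^+ 4 by move=> ?; apply: ler_weXn2l => //; exact: ltW.
have := h 1%N isT; have := h 2%N isT; have := h 3%N isT; rewrite expr1 => *; split; lra.
Qed.

Lemma intg_b4 i : intg P (fun w => 1 + eps i w ^+ 4).
Proof. by apply: intgD => //; exact: intg_cst. Qed.

Lemma intg1 i : intg P (eps i).
Proof. by apply: (intg_le _ (intg_b4 i)) => // w; have [] := pow4_ge (eps i w). Qed.

Lemma intg2 i : intg P (fun w => eps i w ^+ 2).
Proof.
apply: (intg_le _ (intg_b4 i)); first exact: measurable_funX.
by move=> w; have [] := pow4_ge (eps i w); rewrite normrX real_normK ?num_real.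
Qed.

Lemma intg3 i : intg P (fun w => `|eps i w| ^+ 3).
Proof.
apply: (intg_le _ (intg_b4 i)).
  by apply: measurable_funX; exact: measurableT_comp (@normr_measurable _ _) (meps i).
by move=> w; have [] := pow4_ge (eps i w); rewrite normrX normr_id.
Qed.

Lemma Ex_b4 i : Ex P (fun w => 1 + eps i w ^+ 4) <= 1 + M.
Proof. by rewrite ExD ?Ex_cst ?lerD//; exact: intg_cst. Qed.

Lemma Ex_abs1 i : Ex P (fun w => `|eps i w|) <= 1 + M.
Proof.
apply: le_trans (Ex_b4 i); apply: Ex_le; [exact/intg_norm/intg1|exact: intg_b4|].
by move=> w; have [] := pow4_ge (eps i w).
Qed.

Lemma Ex_abs3 i : Ex P (fun w => `|eps i w| ^+ 3) <= 1 + M.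
Proof.
apply: le_trans (Ex_b4 i); apply: Ex_le; [exact: intg3|exact: intg_b4|].
by move=> w; have [] := pow4_ge (eps i w).
Qed.

Lemma M_ge0 : 0 <= M.
Proof. by apply: le_trans (e4 0%N); apply: Ex_ge0 => w; exact: exprn_even_ge0. Qed.

Definition linstat n m (a : 'I_n -> 'I_m -> R) (w : T) : 'I_m -> R :=
  fun k => \sum_(i < n) a i k * eps i w.

(** The omitted term is set to 0 rather than removed, so the index type stays ['I_n] and
    measurability can be checked term by term. *)
Definition linstat_but n m (a : 'I_n -> 'I_m -> R) (i : 'I_n) (w : T) : 'I_m -> R :=
  fun k => \sum_(j < n) (if j == i then 0 else a j k * eps j w).

Lemma linstatE n m (a : 'I_n -> 'I_m -> R) i w :
  linstat a w = vadd (linstat_but a i w) (fun k => a i k * eps i w).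
Proof.
apply/funext => k; rewrite /vadd /linstat /linstat_but (bigD1 i)//= addrC; congr (_ + _).
by rewrite [RHS](bigD1 i)//= eqxx add0r; apply: eq_bigr => j /negbTE ->.
Qed.

Lemma measurable_linstat n m (a : 'I_n -> 'I_m -> R) k :
  measurable_fun setT ((linstat a) ^~ k).
Proof. by apply: measurable_sum => i; apply: measurable_funM. Qed.

Lemma measurable_linstat_but n m (a : 'I_n -> 'I_m -> R) i k :
  measurable_fun setT ((linstat_but a i) ^~ k).
Proof.
by apply: measurable_sum => j; case: (j == i) => //; apply: measurable_funM.
Qed.

Lemma measurable_cyl_linstat_but n m (a : 'I_n -> 'I_m -> R) (i : 'I_n) k :
  measurable_fun setT ((linstat_but a i) ^~ k : g_sigma_algebraType (cylinders_avoiding eps i) -> R).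
Proof.
apply: measurable_sum => j; case: (eqVneq j i) => [//|ji].
by apply: measurable_funM => //; apply: eps_cyl_measurable.
Qed.

(** With errors of variance [s2], the right-hand side makes the covariance matrix of [linstat] the
    identity. *)
Definition orthonormal_coefs n m (a : 'I_n -> 'I_m -> R) :=
  forall k l, \sum_(i < n) a i k * a i l = (k == l)%:R / s2.

Lemma sum_l1_sqr n m (a : 'I_n -> 'I_m -> R) : orthonormal_coefs a ->
  \sum_(i < n) l1 (a i) ^+ 2 <= (m%:R * m%:R) / s2.
Proof.
move=> ao.
rewrite (le_trans (ler_sum _ (fun i _ => l1_sqr_le (a i))))// -mulr_sumr exchange_big/=.
rewrite (eq_bigr (fun=> s2^-1)); last first.
  by move=> k _; under eq_bigr do rewrite expr2; rewrite ao eqxx mul1r.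
by rewrite sumr_const card_ord -[s2^-1 *+ m]mulr_natl mulrA.
Qed.

(** Expand [F] around the sum that omits [eps i]. The zeroth-order term vanishes by independence and
    centering, and the first-order one gives [s2] times the gradient. Summed against [a i k],
    orthonormality selects the [k]-th partial derivative. The errors are of third order in the
    coefficients: one factor is at most [delta], and the other two sum to a bounded quantity. *)
Lemma stein_identity m F D C : @smooth_fun R m F D C -> measurable_along F ->
  (forall k, measurable_along (D k)) ->
  forall n (a : 'I_n -> 'I_m -> R) (delta : R), orthonormal_coefs a ->
  (forall i k, `|a i k| <= delta) -> forall k,
  `| Ex P (fun w => linstat a w k * F (linstat a w)) - Ex P (fun w => D k (linstat a w)) |
    <= delta * (C * ((1 + M) * (1 + s2)) * ((m%:R * m%:R) / s2)).
Proof.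
move=> sF mF mD n a delta ao ad k.
have C0 := smooth_fun_ge0 sF; have M0 := M_ge0.
have [F1 F2 F3 F4 F5] := sF.
have mFW : measurable_fun setT (fun w => F (linstat a w)).
  by apply: mF => j; exact: measurable_linstat.
have mDW l : measurable_fun setT (fun w => D l (linstat a w)).
  by apply: mD => j; exact: measurable_linstat.
have mFWi i : measurable_fun setT (fun w => F (linstat_but a i w)).
  by apply: mF => j; exact: measurable_linstat_but.
have mDWi i l : measurable_fun setT (fun w => D l (linstat_but a i w)).
  by apply: mD => j; exact: measurable_linstat_but.
have iDW l : intg P (fun w => D l (linstat a w)) by apply: intg_bounded (mDW l) (fun w => F2 l _).
have iDWi i l : intg P (fun w => D l (linstat_but a i w)) by apply: intg_bounded (mDWi i l) (fun w => F2 l _).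
have iFWi i : intg P (fun w => F (linstat_but a i w)) by apply: intg_bounded (mFWi i) (fun w => F1 _).
have ieF i : intg P (fun w => eps i w * F (linstat a w)).
  have := intgM_bounded mFW (fun w => F1 _) (intg1 i); congr intg.
  by apply/funext => w; rewrite mulrC.
(* Per index, the error collects the Taylor remainder, which costs a third moment, and the return
   from the omitted sum to the full sum inside [D l]. *)
have key (i : 'I_n) : `|Ex P (fun w => eps i w * F (linstat a w)) - s2 * \sum_(l < m) a i l * Ex P (fun w => D l (linstat a w))|
    <= C * ((1 + M) * (1 + s2)) * l1 (a i) ^+ 2.
  have [i0 E0] : intg P (fun w => eps i w * F (linstat_but a i w)) /\ Ex P (fun w => eps i w * F (linstat_but a i w)) = 0.
    have [||||h1 h2] := @indep_Ex _ _ _ P eps meps ieps i id (fun w => F (linstat_but a i w)).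
    - by [].
    - by apply: mF => j; exact: measurable_cyl_linstat_but.
    - exact: intg1.
    - exact: iFWi.
    by split; [exact: h1|rewrite h2 e1 mul0r].
  have isq l : intg P (fun w => eps i w ^+ 2 * D l (linstat_but a i w)) /\
      Ex P (fun w => eps i w ^+ 2 * D l (linstat_but a i w)) = s2 * Ex P (fun w => D l (linstat_but a i w)).
    have [||||h1 h2] := @indep_Ex _ _ _ P eps meps ieps i (fun x => x ^+ 2) (fun w => D l (linstat_but a i w)).
    - exact: measurable_funX.
    - by apply: mD => j; exact: measurable_cyl_linstat_but.
    - exact: intg2.
    - exact: iDWi.
    by split; [exact: h1|rewrite h2 e2].
  pose r w := F (linstat a w) - F (linstat_but a i w) - \sum_(l < m) (a i l * eps i w) * D l (linstat_but a i w).
  have l1E w : l1 (fun l => a i l * eps i w) = l1 (a i) * `|eps i w|.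
    by rewrite /l1 mulr_suml; apply: eq_bigr => l _; rewrite normrM.
  have rb w : `|eps i w * r w| <= C * l1 (a i) ^+ 2 * `|eps i w| ^+ 3.
    have := F4 (linstat_but a i w) (fun l => a i l * eps i w); rewrite -linstatE -/(r w) l1E => h.
    rewrite normrM (le_trans (ler_wpM2l (normr_ge0 _) h))// le_eqVlt; apply/orP; left; apply/eqP; ring.
  have rE w : eps i w * r w = eps i w * F (linstat a w) - eps i w * F (linstat_but a i w) -
      \sum_(l < m) a i l * (eps i w ^+ 2 * D l (linstat_but a i w)).
    rewrite /r !mulrBr mulr_sumr; congr (_ - _); apply: eq_bigr => l _; ring.
  have iS : intg P (fun w => \sum_(l < m) a i l * (eps i w ^+ 2 * D l (linstat_but a i w))).
    by apply: intg_sum => l; apply: intgZ; have [] := isq l.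
  have iB := intgB (ieF i) i0.
  have ir : intg P (fun w => eps i w * r w).
    by have := intgB iB iS; congr intg; apply/funext => w; rewrite rE.
  have ErE : Ex P (fun w => eps i w * r w) = Ex P (fun w => eps i w * F (linstat a w)) -
      s2 * \sum_(l < m) a i l * Ex P (fun w => D l (linstat_but a i w)).
    rewrite (eq_Ex _ rE) ExB// ExB// E0 subr0 Ex_sum; last first.
      by move=> l; apply: intgZ; have [] := isq l.
    rewrite mulr_sumr; congr (_ - _); apply: eq_bigr => l _.
    have [h1 h2] := isq l; rewrite ExZ// h2; ring.
  have Erb : `|Ex P (fun w => eps i w * r w)| <= C * l1 (a i) ^+ 2 * (1 + M).
    apply: (le_trans (ler_norm_Ex_le ir (intgZ (C * l1 (a i) ^+ 2) (intg3 i)) rb)).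
    by rewrite ExZ; [rewrite ler_wpM2l ?Ex_abs3// mulr_ge0// sqr_ge0|exact: intg3].
  have Dd l : `|Ex P (fun w => D l (linstat_but a i w)) - Ex P (fun w => D l (linstat a w))| <= C * l1 (a i) * (1 + M).
    rewrite distrC -ExB//.
    apply: (le_trans (ler_norm_Ex_le (intgB (iDW l) (iDWi i l)) (intgZ (C * l1 (a i)) (intg_norm (intg1 i))) _)).
      by move=> w; have := F5 l (linstat_but a i w) (fun l => a i l * eps i w); rewrite -linstatE l1E mulrA.
    by rewrite ExZ; [rewrite ler_wpM2l ?Ex_abs1// mulr_ge0// l1_ge0|exact/intg_norm/intg1].
  have Dsum : `|\sum_(l < m) a i l * Ex P (fun w => D l (linstat_but a i w)) - \sum_(l < m) a i l * Ex P (fun w => D l (linstat a w))|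
     <= C * l1 (a i) ^+ 2 * (1 + M).
    rewrite -sumrB (le_trans (ler_norm_sum _ _ _))//.
    have -> : C * l1 (a i) ^+ 2 * (1 + M) = \sum_(l < m) `|a i l| * (C * l1 (a i) * (1 + M)).
      by rewrite -mulr_suml -/(l1 (a i)); ring.
    by apply: ler_sum => l _; rewrite -mulrBr normrM ler_wpM2l.
  have -> : Ex P (fun w => eps i w * F (linstat a w)) - s2 * \sum_(l < m) a i l * Ex P (fun w => D l (linstat a w)) =
    Ex P (fun w => eps i w * r w) + s2 * (\sum_(l < m) a i l * Ex P (fun w => D l (linstat_but a i w)) - \sum_(l < m) a i l * Ex P (fun w => D l (linstat a w))).
    by rewrite ErE; ring.
  rewrite (le_trans (ler_normD _ _))// normrM (gtr0_norm s20).
  have -> : C * ((1 + M) * (1 + s2)) * l1 (a i) ^+ 2 =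
    C * l1 (a i) ^+ 2 * (1 + M) + s2 * (C * l1 (a i) ^+ 2 * (1 + M)) by ring.
  by rewrite lerD// ler_wpM2l// ltW.
have -> : Ex P (fun w => linstat a w k * F (linstat a w)) - Ex P (fun w => D k (linstat a w)) =
  \sum_(i < n) a i k * (Ex P (fun w => eps i w * F (linstat a w)) - s2 * \sum_(l < m) a i l * Ex P (fun w => D l (linstat a w))).
  under eq_bigr do rewrite mulrBr.
  rewrite sumrB; congr (_ - _).
    under eq_bigr do rewrite -ExZ//.
    rewrite -Ex_sum; last by move=> i; exact: intgZ.
    by apply: eq_Ex => w; rewrite /linstat mulr_suml; apply: eq_bigr => i _; rewrite mulrA.
  (* Orthonormality: the inner sum is [(k == l)%:R / s2], which leaves only [l = k]. *)
  transitivity (\sum_(l < m) (s2 * \sum_(i < n) a i k * a i l) * Ex P (fun w => D l (linstat a w))).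
    rewrite (bigD1 k)//= ao eqxx mul1r divff ?gt_eqF// mul1r big1 ?addr0// => l /negbTE lk.
    by rewrite ao eq_sym lk mul0r mulr0 mul0r.
  under [RHS]eq_bigr do rewrite mulrCA mulr_sumr mulr_sumr.
  rewrite exchange_big/=; apply: eq_bigr => l _.
  rewrite mulr_sumr mulr_suml; apply: eq_bigr => i _; ring.
rewrite (le_trans (ler_norm_sum _ _ _))//.
apply: (@le_trans _ _ (\sum_(i < n) delta * (C * ((1 + M) * (1 + s2)) * l1 (a i) ^+ 2))).
  by apply: ler_sum => i _; rewrite normrM ler_pM.
rewrite -mulr_sumr -mulr_sumr.
(* An entry of [a] is needed to know [0 <= delta]; for [n = 0] orthonormality would say
   [0 = 1 / s2]. *)
have [n0|] := posnP n.
  subst n; rewrite !big_ord0 !mulr0.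
  have := ao k k; rewrite big_ord0 eqxx mul1r => /esym/eqP.
  by rewrite invr_eq0 gt_eqF.
move=> n0; have d0 : 0 <= delta := le_trans (normr_ge0 _) (ad (Ordinal n0) k).
rewrite ler_wpM2l// ler_wpM2l// ?sum_l1_sqr//.
by rewrite !mulr_ge0// addr_ge0// ltW.
Qed.

(** Induction on [s] replaces one factor by its mean at a time. The constant depends neither on [n]
    nor on the coefficients, so it can be used along a sequence with [delta] tending to 0. *)
Lemma stein_clt m (g : 'I_m -> R -> R) (c : 'I_m -> R) : (forall k, stein_nice (g k) (c k)) ->
  forall s : seq 'I_m, uniq s -> exists C, forall n (a : 'I_n -> 'I_m -> R) (delta : R),
   orthonormal_coefs a -> (forall i k, `|a i k| <= delta) ->
   `|Ex P (fun w => \prod_(k <- s) g k (linstat a w k)) - \prod_(k <- s) c k| <= C * delta.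
Proof.
move=> gn; have gC k : exists g' C, C11 (g k) g' C.
  by have [g' [f [f' [C [h _ _]]]]] := gn k; exists g', C.
elim=> [_|k s IH /= /andP[ks us]].
  exists 0 => n a delta _ _; rewrite big_nil (_ : Ex _ _ = 1) ?subrr ?normr0 ?mul0r//.
  by rewrite -[RHS](Ex_cst P 1); apply: eq_Ex => w; rewrite big_nil.
have [C1 H1] := IH us.
have [g' [f [f' [Cf [cg cf fE]]]]] := gn k.
have [D [C [sH mH mD D0]]] := smooth_prod s gC.
(* Stein's identity is applied to [f (w k)] times the remaining product; its [k]-th derivative is
   [f' (w k)] times that product, as [k] is not in [s]. *)
have sF := smooth_mul (smooth_coord k cf) sH.
have [mf mf'] := C11_measurable cf; have [mg _] := C11_measurable cg.
have mfk : measurable_along (fun w : 'I_m -> R => f (w k)).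
  by move=> ? ? W mW; exact: (measurableT_comp mf (mW k)).
have mF : measurable_along (fun w => f (w k) * \prod_(k <- s) g k (w k)).
  by move=> ? ? W mW; apply: measurable_funM; [exact: mfk|exact: mH].
have mDF j : measurable_along (fun w => f (w k) * D j w + (\prod_(k <- s) g k (w k)) * (if j == k then f' (w k) else 0)).
  move=> ? ? W mW; apply: measurable_funD; apply: measurable_funM.
  - exact: mfk.
  - exact: mD.
  - exact: mH.
  - by case: (j == k) => //=; exact: (measurableT_comp mf' (mW k)).
have S := stein_identity sF mF mDF.
exists (4 * (Cf * C) * ((1 + M) * (1 + s2)) * ((m%:R * m%:R) / s2) + `|c k| * C1) => n a delta ao ad.
have {S} := S n a delta ao ad k; set K := 4 * (Cf * C) * _ * _ => S.
have {}H1 := H1 n a delta ao ad.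
pose H w := \prod_(k <- s) g k (linstat a w k).
have mHW : measurable_fun setT H by apply: mH => j; exact: measurable_linstat.
have [Hb _ _ _ _] := sH.
have iH : intg P H by apply: intg_bounded mHW (fun w => Hb _).
have mW := measurable_linstat a k.
have [_ gb _ _] := cg; have [_ fb f'b _] := cf.
have igH : intg P (fun w => g k (linstat a w k) * H w).
  by apply: (intgM_bounded _ (fun w => gb _) iH); exact: (measurableT_comp mg mW).
have iW : intg P (fun w => linstat a w k).
  by apply: intg_sum => i; apply: intgZ; exact: intg1.
have ifH : intg P (fun w => f (linstat a w k) * H w).
  by apply: (intgM_bounded _ (fun w => fb _) iH); exact: (measurableT_comp mf mW).
have if'H : intg P (fun w => f' (linstat a w k) * H w).
  by apply: (intgM_bounded _ (fun w => f'b _) iH); exact: (measurableT_comp mf' mW).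
have iWfH : intg P (fun w => linstat a w k * (f (linstat a w k) * H w)).
  have := @intgM_bounded _ _ _ P (fun w => f (linstat a w k) * H w) (fun w => linstat a w k) (Cf * C).
  move=> /(_ (intg_measurable ifH)) h.
  have : intg P (fun w => f (linstat a w k) * H w * linstat a w k).
    by apply: h => // w; rewrite normrM ler_pM// Hb.
  by congr intg; apply/funext => w; rewrite mulrC.
have E1 : Ex P (fun w => f (linstat a w k) * D k (linstat a w) +
      (\prod_(j <- s) g j (linstat a w j)) * (if k == k then f' (linstat a w k) else 0)) =
    Ex P (fun w => f' (linstat a w k) * H w).
  by apply: eq_Ex => w; rewrite D0// mulr0 add0r eqxx mulrC.
rewrite E1 in S.
(* The Stein equation turns the defect of the identity into the replacement of [g k] by [c k]. *)
have E2 : Ex P (fun w => f' (linstat a w k) * H w) - Ex P (fun w => linstat a w k * (f (linstat a w k) * H w)) =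
   Ex P (fun w => g k (linstat a w k) * H w) - c k * Ex P H.
  rewrite -ExB// -ExZ// -ExB//; last exact: intgZ.
  apply: eq_Ex => w; have := fE (linstat a w k); rewrite mulrA -!mulrBl => ->; ring.
rewrite distrC E2 in S.
have -> : Ex P (fun w => \prod_(j <- k :: s) g j (linstat a w j)) = Ex P (fun w => g k (linstat a w k) * H w).
  by apply: eq_Ex => w; rewrite big_cons.
rewrite big_cons.
have -> : Ex P (fun w => g k (linstat a w k) * H w) - c k * \prod_(j <- s) c j =
  (Ex P (fun w => g k (linstat a w k) * H w) - c k * Ex P H) + c k * (Ex P H - \prod_(j <- s) c j) by ring.
rewrite (le_trans (ler_normD _ _))// normrM [leRHS]mulrDl lerD//; first by rewrite [leRHS]mulrC.
by rewrite -[leRHS]mulrA ler_wpM2l.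
Qed.

Lemma Ex_eps_mul (i j : nat) : intg P (fun w => eps i w * eps j w) /\
  Ex P (fun w => eps i w * eps j w) = (i == j)%:R * s2.
Proof.
have [->|ij] := eqVneq i j.
  have E : (fun w => eps j w * eps j w) = (fun w => eps j w ^+ 2) by apply/funext => w; rewrite expr2.
  by rewrite E mul1r e2; split => //; exact: intg2.
have [||||h1 h2] := @indep_Ex _ _ _ P eps meps ieps i id (eps j).
- by [].
- by apply: eps_cyl_measurable; rewrite eq_sym.
- exact: intg1.
- exact: intg1.
by split; [exact: h1|rewrite h2 e1 !mul0r].
Qed.

Lemma Ex_quadratic n (A : 'I_n -> 'I_n -> R) :
  intg P (fun w => \sum_(i < n) \sum_(j < n) A i j * (eps i w * eps j w)) /\
  Ex P (fun w => \sum_(i < n) \sum_(j < n) A i j * (eps i w * eps j w)) = s2 * \sum_(i < n) A i i.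
Proof.
have h i j : intg P (fun w => A i j * (eps i w * eps j w)).
  by apply: intgZ; have [] := Ex_eps_mul i j.
have h' i : intg P (fun w => \sum_(j < n) A i j * (eps i w * eps j w)) by exact: intg_sum.
split; first exact: intg_sum.
rewrite Ex_sum// mulr_sumr; apply: eq_bigr => i _.
rewrite Ex_sum// (bigD1 i)//= big1 ?addr0.
  have [h1 h2] := Ex_eps_mul i i.
  by rewrite ExZ// h2 eqxx mul1r mulrC.
move=> j ji; have [h1 h2] := Ex_eps_mul i j.
by rewrite ExZ// h2 (_ : (nat_of_ord i == j) = false) ?mul0r ?mulr0//; apply/negbTE; rewrite eq_sym.
Qed.

Lemma Ex_linstat_sqr n m (a : 'I_n -> 'I_m -> R) k : orthonormal_coefs a ->
  intg P (fun w => linstat a w k ^+ 2) /\ Ex P (fun w => linstat a w k ^+ 2) = 1.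
Proof.
move=> ao; have [h1 h2] := Ex_quadratic (fun i j => a i k * a j k).
have E : (fun w => linstat a w k ^+ 2) =
    (fun w => \sum_(i < n) \sum_(j < n) a i k * a j k * (eps i w * eps j w)).
  apply/funext => w; rewrite expr2 /linstat mulr_suml; apply: eq_bigr => i _.
  by rewrite mulr_sumr; apply: eq_bigr => j _; ring.
by rewrite E; split => //; rewrite h2 ao eqxx mul1r divff ?gt_eqF.
Qed.

(** The cross terms vanish by independence, and each diagonal term is the fourth moment minus
    [s2 ^+ 2], hence at most [M]. *)
Lemma Ex_centered_sqr n :
  intg P (fun w => (\sum_(i < n) (eps i w ^+ 2 - s2)) ^+ 2) /\
  Ex P (fun w => (\sum_(i < n) (eps i w ^+ 2 - s2)) ^+ 2) <= n%:R * M.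
Proof.
pose X (i : nat) w := eps i w ^+ 2 - s2.
have iX i : intg P (X i) by apply: intgB; [exact: intg2|exact: intg_cst].
have EX i : Ex P (X i) = 0 by rewrite ExB ?e2 ?Ex_cst ?subrr//; [exact: intg2|exact: intg_cst].
have mu : measurable_fun setT (fun x : R => x ^+ 2 - s2).
  by apply: measurable_funB => //; exact: measurable_funX.
have hX (i j : nat) : intg P (fun w => X i w * X j w) /\
    Ex P (fun w => X i w * X j w) <= (i == j)%:R * M.
  have [->|ij] := eqVneq i j.
    have E : (fun w => X j w * X j w) = (fun w => eps j w ^+ 4 + (- (2 * s2)) * eps j w ^+ 2 + s2 ^+ 2).
      by apply/funext => w; rewrite /X; ring.
    have i1 := e4i j; have i2 := intgZ (- (2 * s2)) (intg2 j); have i3 := intg_cst P (s2 ^+ 2).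
    rewrite E; split; first by apply: intgD => //; exact: intgD.
    rewrite ExD//; last exact: intgD.
    rewrite ExD// ExZ; last exact: intg2.
    by rewrite e2 Ex_cst mul1r; have := e4 j; have := sqr_ge0 s2; rewrite expr2; lra.
  have [||||h1 h2] := @indep_Ex _ _ _ P eps meps ieps i (fun x => x ^+ 2 - s2) (X j) => //.
    have mj : measurable_fun setT (eps j : g_sigma_algebraType (cylinders_avoiding eps i) -> R).
      by apply: eps_cyl_measurable; rewrite eq_sym.
    exact: (measurableT_comp mu mj).
  - exact: iX.
  by split; [exact: h1|rewrite h2 EX mulr0 mul0r].
have E : (fun w => (\sum_(i < n) (eps i w ^+ 2 - s2)) ^+ 2) =
    (fun w => \sum_(i < n) \sum_(j < n) X i w * X j w).
  apply/funext => w; rewrite expr2 mulr_suml; apply: eq_bigr => i _.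
  by rewrite mulr_sumr.
have h1 i j : intg P (fun w => X i w * X j w) by have [] := hX i j.
have h2 (i : 'I_n) : intg P (fun w => \sum_(j < n) X i w * X j w) by exact: intg_sum.
rewrite E; split; first exact: intg_sum.
rewrite Ex_sum//; apply: (@le_trans _ _ (\sum_(i < n) M)); last first.
  by rewrite sumr_const card_ord mulr_natl.
apply: ler_sum => i _; rewrite Ex_sum// (bigD1 i)//=.
have [_] := hX i i; rewrite eqxx mul1r => hM.
have : \sum_(j < n | j != i) Ex P (fun w => X i w * X j w) <= 0.
  apply: sumr_le0 => j ji; have [_] := hX i j.
  by rewrite (_ : (nat_of_ord i == j) = false) ?mul0r//; apply/negbTE; rewrite eq_sym.
lra.
Qed.

End stein_clt.

(** * Nested least squares *)

Section posdef.
Context {R : realType}.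
Implicit Types p : nat.

Lemma mx11_mul p (u v : 'cV[R]_p) : (u^T *m v) 0 0 = \sum_i u i 0 * v i 0.
Proof. by rewrite mxE; apply: eq_bigr => i _; rewrite mxE. Qed.

Lemma posdefmx_unit p (A : 'M[R]_p) : posdefmx A -> A \in unitmx.
Proof.
move=> pA; rewrite -row_free_unit -kermx_eq0; apply/negPn/negP => /rowV0Pn[v vk v0].
have vA : v *m A = 0 by apply/sub_kermxP.
have := pA v^T; rewrite trmxK vA mul0mx mxE ltxx => h.
by have : false by apply: h; apply: contra v0 => /eqP E; rewrite -[v]trmxK E trmx0.
Qed.

Definition bform p (A : 'M[R]_p) (u v : 'cV[R]_p) : R := (u^T *m A *m v) 0 0.

Lemma bformE p (A : 'M[R]_p) u v : bform A u v = \sum_i \sum_j A i j * (u i 0 * v j 0).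
Proof.
rewrite /bform mxE exchange_big/=; apply: eq_bigr => j _.
rewrite mxE mulr_suml; apply: eq_bigr => i _; rewrite mxE; ring.
Qed.

Lemma bformC p (A : 'M[R]_p) u v : A^T = A -> bform A u v = bform A v u.
Proof.
move=> At; rewrite /bform -[LHS](mxE trmx_key (fun i j => (u^T *m A *m v) j i) 0 0) -[X in fun_of_matrix X]/((_)^T).
by rewrite !trmx_mul trmxK At mulmxA.
Qed.

Lemma bform_ge0 p (A : 'M[R]_p) u : posdefmx A -> 0 <= bform A u u.
Proof.
move=> pA; have [->|u0] := eqVneq u 0; first by rewrite /bform mulmx0 mxE.
by apply/ltW/pA.
Qed.

(** The form is nonnegative at the residual of the projection of [u] onto [v]. *)
Lemma bform_CS p (A : 'M[R]_p) u v : posdefmx A -> A^T = A ->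
  bform A u v ^+ 2 <= bform A u u * bform A v v.
Proof.
move=> pA At; have [->|v0] := eqVneq v 0.
  by rewrite /bform !mulmx0 mxE expr2 !mulr0.
have c0 : 0 < bform A v v by exact: pA.
set a := bform A u u; set b := bform A u v; set c := bform A v v in c0 *.
have := bform_ge0 (u - (b / c) *: v) pA.
have -> : bform A (u - (b / c) *: v) (u - (b / c) *: v) = a - b ^+ 2 / c.
  have -> : bform A (u - (b / c) *: v) (u - (b / c) *: v) =
      a - (b / c) * b - (b / c) * bform A v u + (b / c) ^+ 2 * c.
    rewrite /a /b /c /bform; set t := _ / _.
    have -> : (u - t *: v)^T = u^T - t *: v^T by rewrite raddfB/= linearZ.
    rewrite !mulmxBl !mulmxBr -!scalemxAl -!scalemxAr -?scalemxAl.
    clearbody t; move: (u^T *m A *m u) (u^T *m A *m v) (v^T *m A *m u) (v^T *m A *m v) => a1 a2 a3 a4.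
    by rewrite !mxE; ring.
  rewrite (bformC v u At) -/b; field.
  by rewrite gt_eqF.
by rewrite subr_ge0 ler_pdivrMr.
Qed.

(** The trace of the inverse replaces the reciprocal of the smallest eigenvalue. For
    [u = invmx A *m e_i] one has [A(u, v) = v_i] and [A(u, u) = (invmx A)_ii], so Cauchy-Schwarz
    bounds each [v_i ^+ 2]. *)
Lemma bform_coercive p (A : 'M[R]_p) (v : 'cV[R]_p) : posdefmx A -> A^T = A ->
  \sum_i v i 0 ^+ 2 <= (\tr (invmx A)) * bform A v v.
Proof.
move=> pA At; have uA := posdefmx_unit pA.
have iAt : (invmx A)^T = invmx A by rewrite trmx_inv At.
rewrite /mxtrace mulr_suml; apply: ler_sum => i _.
pose u := invmx A *m delta_mx i (0 : 'I_1).
have e1 : bform A u v = v i 0.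
  by rewrite /bform /u trmx_mul iAt mulmxKV// trmx_delta -rowE mxE.
have e2 : bform A u u = invmx A i i.
  rewrite /bform {1}/u trmx_mul iAt mulmxKV// trmx_delta -rowE mxE.
  by rewrite /u -colE mxE.
by rewrite -e1 -e2; exact: bform_CS.
Qed.

Lemma bform_perturb p (A B : 'M[R]_p) (delta : R) (v : 'cV[R]_p) :
  (forall i j, `|B i j - A i j| <= delta) ->
  bform A v v - delta * (p%:R * \sum_i v i 0 ^+ 2) <= bform B v v.
Proof.
move=> AB.
have h : `|bform B v v - bform A v v| <= delta * l1 (fun i => v i 0) ^+ 2.
  rewrite !bformE -sumrB (le_trans (ler_norm_sum _ _ _))//.
  rewrite expr2 /l1 mulr_suml mulr_sumr; apply: ler_sum => i _.
  rewrite -sumrB (le_trans (ler_norm_sum _ _ _))// !mulr_sumr; apply: ler_sum => j _.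
  by rewrite -mulrBl !normrM ler_wpM2r// mulr_ge0.
have [p0|p0] := posnP p.
  subst p; rewrite !bformE !big_ord0 !mulr0; lra.
have d0 : 0 <= delta := le_trans (normr_ge0 _) (AB (Ordinal p0) (Ordinal p0)).
have := ler_wpM2l d0 (l1_sqr_le (fun i => v i 0)).
move: h; rewrite ler_norml => /andP[h1 _]; lra.
Qed.

End posdef.

(** * Gram-Schmidt coefficients of the nested designs *)

Section nested_models.
Context {R : realType} (n K : nat) (X : 'M[R]_(n, K)).
Hypothesis pX : posdefmx (X^T *m X).
Implicit Types k j : 'I_K.

Definition selmx (p : nat) : 'M[R]_(K, p) := \matrix_(i, j) ((i : nat) == j)%:R.

Lemma firstcols_sel p : (p <= K)%N -> firstcols X p = X *m selmx p.
Proof.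
move=> pK; apply/matrixP => i j; rewrite !mxE.
have jK : (j < K)%N := leq_trans (ltn_ord j) pK.
rewrite insubT/= (bigD1 (Ordinal jK))//= mxE eqxx mulr1 big1 ?addr0//.
move=> l lj; rewrite mxE (_ : (l == j :> nat) = false) ?mulr0//.
by apply/negbTE; apply: contra lj => /eqP lj; apply/eqP/val_inj.
Qed.

Let Xk k := firstcols X k.+1.
Let A k := (Xk k)^T *m Xk k.

(* [gsrow k *m Y] is the last coordinate of the OLS estimate in the model with
   [k.+1] columns. *)
Definition gsrow k : 'rV[R]_n := row ord_max (invmx (A k) *m (Xk k)^T).
Definition gsvar k : R := invmx (A k) ord_max ord_max.
(** The coordinates of [gsrow k] in the columns of [X], padded with zeros after column [k]; this
    brings all nested models under the one quadratic form of [X^T *m X]. *)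
Definition gscoef k : 'cV[R]_K := selmx k.+1 *m (row ord_max (invmx (A k)))^T.

Lemma XkE k : Xk k = X *m selmx k.+1. Proof. exact: firstcols_sel. Qed.

Lemma selmx_inj p (v : 'cV[R]_p) : (p <= K)%N -> selmx p *m v = 0 -> v = 0.
Proof.
move=> pK /matrixP h; apply/matrixP => i j; rewrite (ord1 j) [RHS]mxE.
have iK : (i < K)%N := leq_trans (ltn_ord i) pK.
have := h (Ordinal iK) 0; rewrite !mxE (bigD1 i)//= mxE eqxx mul1r big1 ?addr0//.
move=> l li; rewrite mxE/= (_ : (i == l :> nat) = false) ?mul0r//.
by apply/negbTE; rewrite eq_sym.
Qed.

Lemma posdef_A k : posdefmx (A k).
Proof.
move=> v v0; rewrite /A XkE trmx_mul -!mulmxA; set E := selmx _.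
have : E *m v != 0 by apply: contra v0 => /eqP/selmx_inj ->.
by move/pX; rewrite trmx_mul -!mulmxA.
Qed.

Lemma A_unit k : A k \in unitmx. Proof. exact/posdefmx_unit/posdef_A. Qed.

Lemma gsrowE k : gsrow k = row ord_max (invmx (A k)) *m (Xk k)^T.
Proof. by rewrite /gsrow row_mul. Qed.

Lemma gsrow_coef k : gsrow k = (X *m gscoef k)^T.
Proof. by rewrite gsrowE /gscoef mulmxA -XkE trmx_mul trmxK. Qed.

Lemma gsrow_Xk k : gsrow k *m Xk k = row ord_max 1%:M.
Proof. by rewrite gsrowE -mulmxA -/(A k) -row_mul mulVmx// A_unit. Qed.

(** [gsrow k] is a row of a left inverse of the first [k.+1] columns, hence dual to them. *)
Lemma gsrow_X k j : (j <= k)%N -> (gsrow k *m X) 0 j = (j == k)%:R.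
Proof.
move=> jk; have jk1 : (j < k.+1)%N by [].
have /matrixP/(_ 0 (Ordinal jk1)) := gsrow_Xk k.
rewrite XkE mulmxA row1 [LHS]mxE [RHS]mxE eqxx/= (bigD1 j)//= [selmx _ _ _]mxE eqxx mulr1 big1 ?addr0.
  by move=> ->; congr (nat_of_bool _)%:R; rewrite -!val_eqE.
move=> l lj; rewrite [selmx _ _ _]mxE/= (_ : (l == j :> nat) = false) ?mulr0//.
exact/negbTE.
Qed.

Lemma gsrow_norm k : (gsrow k *m (gsrow k)^T) 0 0 = gsvar k.
Proof.
by rewrite {2}gsrowE trmx_mul trmxK mulmxA gsrow_Xk row1 -rowE !mxE.
Qed.

(** [gsrow j] lies in the span of columns up to [j], all of which [gsrow k] annihilates when
    [j < k]. *)
Lemma gsrow_orth k j : (j < k)%N -> (gsrow k *m (gsrow j)^T) 0 0 = 0.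
Proof.
move=> jk; rewrite (gsrow_coef j) trmxK mulmxA mxE big1// => i _.
have [ij|ij] := leqP i j.
  rewrite gsrow_X; last by rewrite (leq_trans ij)// ltnW.
  by rewrite (_ : (i == k) = false) ?mul0r//; apply/negbTE; rewrite -val_eqE/= neq_ltn (leq_ltn_trans ij).
rewrite [gscoef j i 0]mxE big1 ?mulr0// => l _; rewrite [selmx _ _ _]mxE (_ : (i == l :> nat) = false) ?mul0r//.
by apply/negbTE; rewrite neq_ltn (leq_ltn_trans _ ij) ?orbT// -ltnS.
Qed.

Lemma gscoef_diag k : gscoef k k 0 = gsvar k.
Proof.
rewrite /gscoef mxE (bigD1 ord_max)//= !mxE eqxx mul1r big1 ?addr0// => l lk.
rewrite mxE (_ : (k == l :> nat) = false) ?mul0r//.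
by apply/negbTE; apply: contra lk => /eqP E; apply/eqP/val_inj.
Qed.

Lemma gsvar_bform k : gsvar k = bform (X^T *m X) (gscoef k) (gscoef k).
Proof.
by rewrite -gsrow_norm gsrow_coef trmxK /bform trmx_mul !mulmxA.
Qed.

Lemma gsvar_gt0 k : 0 < gsvar k.
Proof.
rewrite gsvar_bform; apply: pX; apply/eqP => E.
have := gsrow_X (leqnn k); rewrite gsrow_coef E mulmx0 trmx0 mul0mx mxE eqxx.
by move/esym/eqP; rewrite oner_eq0.
Qed.

Lemma lastcoordE p (v : 'cV[R]_p.+1) : lastcoord v = v ord_max 0.
Proof. by rewrite /lastcoord (insubT (fun i => (i < p.+1)%N) (ltnSn p))/=; congr (v _ 0); exact: val_inj. Qed.

Lemma lastdiagE p (B : 'M[R]_p.+1) : lastdiag B = B ord_max ord_max.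
Proof. by rewrite /lastdiag (insubT (fun i => (i < p.+1)%N) (ltnSn p))/=; congr (B _ _); exact: val_inj. Qed.

(** The factors of [n] cancel: inverting the scaled Gram matrix multiplies the diagonal entry by
    [n], and its root matches the one in the numerator. *)
Lemma Ztilde_gs (Y : 'cV[R]_n) k : (0 < n)%N ->
  Ztilde X Y k.+1 = (gsrow k *m Y) 0 0 / (Num.sqrt (sigma2hat X Y) * Num.sqrt (gsvar k)).
Proof.
move=> n0; rewrite /Ztilde/= ltnS leqNgt ltn_ord/= lastcoordE lastdiagE.
have -> : ols (firstcols X k.+1) Y ord_max 0 = (gsrow k *m Y) 0 0.
  by rewrite /ols /gsrow -row_mul [RHS]mxE.
have nu : (n%:R : R) != 0 by rewrite pnatr_eq0 -lt0n.
rewrite invmxZ; last first.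
  by rewrite unitmxZ ?A_unit// unitfE invr_eq0.
rewrite (_ : (_ *: invmx _) ord_max ord_max = n%:R * gsvar k); last by rewrite mxE invrK.
rewrite (sqrtrM _ (ler0n _ _)).
set s := Num.sqrt n%:R; have s0 : s != 0 by rewrite gt_eqF// sqrtr_gt0 lt0r nu/=.
by rewrite [X in _ / X = _]mulrCA -mulf_div divff// mul1r.
Qed.

(** The hypothesis covers two situations: coefficients vanishing after [k], and an orthogonal
    design. *)
Lemma gsrow_X_sum k (b : 'cV[R]_K) :
  (forall j, (k < j)%N -> b j 0 = 0 \/ (gsrow k *m X) 0 j = 0) ->
  (gsrow k *m (X *m b)) 0 0 = b k 0.
Proof.
move=> hb; rewrite mulmxA mxE (bigD1 k)//= gsrow_X// eqxx mul1r big1 ?addr0// => j jk.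
have [kj|kj] := ltnP k j; first by case: (hb j kj) => ->; rewrite ?mulr0 ?mul0r.
by rewrite gsrow_X// (negbTE jk) mul0r.
Qed.

(** Cauchy-Schwarz separates the norm of the [i]-th row of [X] from that of [gscoef k], and
    coercivity bounds the latter by [gsvar k]. *)
Lemma gsrow_entry_le k (i : 'I_n) (lam : R) : 0 < lam -> (0 < n)%N ->
  (forall v : 'cV[R]_K, lam * n%:R * \sum_j v j 0 ^+ 2 <= bform (X^T *m X) v v) ->
  gsrow k 0 i ^+ 2 <= (\sum_(j < K) X i j ^+ 2) / n%:R * (K%:R / lam) * gsvar k.
Proof.
move=> lam0 n0 hlam.
have n0' : 0 < n%:R :> R by rewrite ltr0n.
set S := \sum_(j < K) X i j ^+ 2.
have S0 : 0 <= S by apply: sumr_ge0 => j _; exact: sqr_ge0.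
have Xle j : `|X i j| <= Num.sqrt S.
  rewrite -sqrtr_sqr ler_wsqrtr// /S (bigD1 j)//= lerDl sumr_ge0// => l _; exact: sqr_ge0.
have h1 : `|gsrow k 0 i| <= Num.sqrt S * l1 (fun j => gscoef k j 0).
  rewrite gsrow_coef mxE mxE (le_trans (ler_norm_sum _ _ _))// mulr_sumr.
  by apply: ler_sum => j _; rewrite normrM ler_wpM2r.
have h2 : gsrow k 0 i ^+ 2 <= S * (K%:R * \sum_j gscoef k j 0 ^+ 2).
  rewrite -[_ ^+ 2]real_normK ?num_real// (le_trans (lerXn2r 2 _ _ h1))// ?nnegrE ?mulr_ge0 ?l1_ge0//.
  by rewrite exprMn sqr_sqrtr// ler_wpM2l// l1_sqr_le.
rewrite (le_trans h2)// -!mulrA ler_wpM2l// mulrCA ler_wpM2l//.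
have := hlam (gscoef k); rewrite -gsvar_bform => h3.
by rewrite mulrA -invfM ler_pdivlMl ?mulr_gt0// [n%:R * _]mulrC.
Qed.

(** [gsvar k] is both the [k]-th entry of [gscoef k] and its quadratic form, so coercivity reads
    [lam n gsvar^2 <= gsvar]. *)
Lemma gsvar_le k (lam : R) : 0 < lam -> (0 < n)%N ->
  (forall v : 'cV[R]_K, lam * n%:R * \sum_j v j 0 ^+ 2 <= bform (X^T *m X) v v) ->
  gsvar k <= (lam * n%:R)^-1.
Proof.
move=> lam0 n0 hlam; have n0' : 0 < n%:R :> R by rewrite ltr0n.
have := hlam (gscoef k); rewrite -gsvar_bform => h.
have h2 : gsvar k ^+ 2 <= \sum_j gscoef k j 0 ^+ 2.
  rewrite -gscoef_diag (bigD1 k)//= lerDl sumr_ge0// => j _; exact: sqr_ge0.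
have g0 := gsvar_gt0 k.
have l0 : 0 < lam * n%:R by exact: mulr_gt0.
rewrite -[leRHS]mul1r ler_pdivlMr// -(ler_pM2l g0) mulr1 mulrA -expr2 mulrC.
by rewrite (le_trans _ h)// ler_wpM2l// ltW.
Qed.

(** * Orthogonal design *)

Section orthogonal_design.
Hypothesis n0 : (0 < n)%N.
Hypothesis oX : n%:R^-1 *: (X^T *m X) = 1%:M.

Let nu : (n%:R : R) != 0. Proof. by rewrite pnatr_eq0 -lt0n. Qed.

Lemma orth_gram : X^T *m X = n%:R%:M.
Proof. by have := congr1 (fun B => n%:R *: B) oX; rewrite scalerA divff// scale1r scale_scalar_mx mulr1. Qed.

Lemma selmx_orth p : (p <= K)%N -> (selmx p)^T *m selmx p = 1%:M.
Proof.
move=> pK; apply/matrixP => i j; rewrite !mxE.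
have iK : (i < K)%N := leq_trans (ltn_ord i) pK.
rewrite (bigD1 (Ordinal iK))//= !mxE eqxx mul1r big1 ?addr0//.
move=> l li; rewrite !mxE (_ : (l == i :> nat) = false) ?mul0r//.
by apply/negbTE; apply: contra li => /eqP li; apply/eqP/val_inj.
Qed.

Lemma orth_invA k : invmx (A k) = n%:R^-1%:M.
Proof.
rewrite /A XkE trmx_mul -mulmxA [X^T *m _]mulmxA orth_gram mul_scalar_mx -scalemxAr selmx_orth//.
by rewrite scale_scalar_mx mulr1 invmx_scalar.
Qed.

Lemma orth_gsvar k : gsvar k = n%:R^-1.
Proof. by rewrite /gsvar orth_invA mxE eqxx. Qed.

Lemma orth_gsrow k i : gsrow k 0 i = n%:R^-1 * X i k.
Proof.
rewrite /gsrow orth_invA mul_scalar_mx !mxE insubT//= => h.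
by congr (_ * X _ _); exact: val_inj.
Qed.

Lemma orth_gsrow_X k j : (gsrow k *m X) 0 j = (j == k)%:R.
Proof.
have := oX => /matrixP/(_ k j); rewrite !mxE eq_sym => <-; rewrite mulr_sumr.
by apply: eq_bigr => i _; rewrite orth_gsrow mxE mulrA.
Qed.

(** All Gram matrices are multiples of the identity, so adding columns changes neither an estimated
    coefficient nor its scale. *)
Lemma orth_Zhat (Y : 'cV[R]_n) k : Zhat X Y k = Ztilde X Y k.+1.
Proof.
rewrite Ztilde_gs// /Zhat oX orth_gsvar invmx1 [1%:M _ _]mxE eqxx sqrtr1 mulr1.
have -> : ols X Y k 0 = (gsrow k *m Y) 0 0.
  rewrite /ols orth_gram invmx_scalar mul_scalar_mx -scalemxAl [LHS]mxE [X in _ * X]mxE mulr_sumr [RHS]mxE.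
  by apply: eq_bigr => i _; rewrite orth_gsrow mxE mulrA.
by rewrite sqrtrV// invfM invrK; ring.
Qed.

End orthogonal_design.

(** * Residual variance through the hat matrix *)

Section residual_variance.

Let uX : X^T *m X \in unitmx. Proof. exact: posdefmx_unit. Qed.

Definition hatmx : 'M[R]_n := X *m invmx (X^T *m X) *m X^T.

Lemma hatmx_X : hatmx *m X = X.
Proof. by rewrite /hatmx -!mulmxA mulVmx// mulmx1. Qed.

Lemma hatmx_sym : hatmx^T = hatmx.
Proof. by rewrite /hatmx !trmx_mul trmxK trmx_inv trmx_mul trmxK mulmxA. Qed.

Lemma hatmx_idem : hatmx *m hatmx = hatmx.
Proof. by rewrite {2}/hatmx !mulmxA hatmx_X. Qed.

Lemma hatmx_tr : \tr hatmx = K%:R.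
Proof. by rewrite /hatmx -mulmxA mxtrace_mulC -mulmxA mulVmx// mxtrace1. Qed.

(** The residual is [(I - H) e], because [H X = X] for the hat matrix [H]; symmetry and idempotence
    reduce its squared norm to [e^T e - e^T H e]. *)
Lemma sigma2hatE (b : 'cV[R]_K) (e : 'cV[R]_n) :
  sigma2hat X (X *m b + e) =
  (\sum_(i < n) e i 0 ^+ 2 - \sum_(i < n) \sum_(j < n) hatmx i j * (e i 0 * e j 0)) / (n - K)%:R.
Proof.
rewrite /sigma2hat; congr (_ / _).
have -> : X *m b + e - X *m ols X (X *m b + e) = e - hatmx *m e.
  rewrite /ols !mulmxA -/hatmx mulmxDr !mulmxA hatmx_X opprD addrACA subrr add0r.
  by [].
have -> : \sum_(i < n) ((e - hatmx *m e) i 0) ^+ 2 = ((e - hatmx *m e)^T *m (e - hatmx *m e)) 0 0.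
  by rewrite mx11_mul; apply: eq_bigr => i _; rewrite expr2.
have -> : (e - hatmx *m e)^T *m (e - hatmx *m e) = e^T *m e - e^T *m hatmx *m e.
  have -> : (e - hatmx *m e)^T = e^T - e^T *m hatmx by rewrite raddfB/= trmx_mul hatmx_sym.
  have -> : (e^T - e^T *m hatmx) *m (e - hatmx *m e) =
      e^T *m e - e^T *m (hatmx *m e) - (e^T *m hatmx *m e - e^T *m (hatmx *m hatmx) *m e).
    by rewrite mulmxBl !mulmxBr !mulmxA.
  by rewrite hatmx_idem subrr subr0 mulmxA.
rewrite mxE [X in _ + X]mxE mx11_mul; congr (_ - _); last exact: bformE.
Qed.

Lemma hatmx_quad_ge0 (e : 'cV[R]_n) :
  0 <= \sum_(i < n) \sum_(j < n) hatmx i j * (e i 0 * e j 0).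
Proof.
rewrite -(bformE hatmx) /bform -hatmx_idem -{1}hatmx_sym mulmxA -trmx_mul -mulmxA mx11_mul.
by apply: sumr_ge0 => i _; rewrite -expr2 sqr_ge0.
Qed.

End residual_variance.

End nested_models.

(** * The three estimators as acceptance patterns *)

Section estimators.
Context {R : realType}.
Implicit Types K k j : nat.

Lemma bigmax_ord_eq K (p : nat -> bool) j : (j < K)%N ->
  (\big[maxn/0%N]_(k < K.+1 | p k) k = j.+1)%N <->
  p j.+1 /\ (forall l, (j < l < K)%N -> ~~ p l.+1).
Proof.
move=> jK; split => [E|[pj h]].
  have le l : (l < K.+1)%N -> p l -> (l <= j.+1)%N.
    move=> lK pl; have /bigmax_leqP := eq_leq E.
    by move=> /(_ (Ordinal lK) pl).
  split.
    apply: contraT => npj; suff : (\big[maxn/0%N]_(k < K.+1 | p k) k <= j)%N by rewrite E ltnn.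
    apply/bigmax_leqP => l pl; have := le l (ltn_ord l) pl.
    by rewrite leq_eqVlt => /predU1P[lE|//]; move: npj; rewrite -lE pl.
  move=> l /andP[jl lK]; apply/negP => pl.
  by have := le l.+1 lK pl; rewrite ltnS leqNgt jl.
apply/eqP; rewrite eqn_leq; apply/andP; split.
  apply/bigmax_leqP => -[[|l] /= lK] pl //; rewrite ltnS leqNgt; apply/negP => jl.
  by have := h l; rewrite jl pl => /(_ lK).
have /bigmax_leqP := leqnn (\big[maxn/0%N]_(k < K.+1 | p k) k)%N.
by move=> /(_ (Ordinal (jK : (j.+1 < K.+1)%N)) pj).
Qed.

Lemma leq_bigmin_seq (I : Type) (s : seq I) (p : pred I) (F : I -> nat) (m b : nat) :
  (m <= \big[minn/b]_(i <- s | p i) F i)%N = (m <= b)%N && all (fun i => p i ==> (m <= F i)%N) s.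
Proof.
elim: s => [|i s IH]; first by rewrite big_nil andbT.
rewrite big_cons /=; case: (p i) => /=; last exact: IH.
by rewrite leq_min IH andbCA.
Qed.

Lemma leq_bigmin_ord K (q : nat -> bool) m : (m <= \big[minn/K]_(k < K.+2 | (0 < k) && q k) k.-1)%N <->
  ((m <= K)%N /\ forall l, (l < m)%N -> ~~ q l.+1).
Proof.
rewrite leq_bigmin_seq; split.
  move=> /andP[mK /allP h]; split => // l lm; apply/negP => ql.
  have lK : (l.+1 < K.+2)%N by rewrite ltnS ltnW// ltnS (leq_trans lm).
  have := h (Ordinal lK) (mem_index_enum _); by rewrite /= ql/= leqNgt lm.
move=> [mK h]; rewrite mK/=; apply/allP => -[[|l] lK] _ //=.
by apply/implyP => ql; rewrite leqNgt; apply/negP => /h; rewrite ql.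
Qed.

(** The default value [K] of the minimum stands for the outcome where all [K] tests reject, so
    acceptance of test [k.+1] is demanded only for [k < K]. *)
Lemma bigmin_ord_eq K (q : nat -> bool) k : (k <= K)%N ->
  (\big[minn/K]_(k < K.+2 | (0 < k) && q k) k.-1 = k)%N <->
  ((forall l, (l < k)%N -> ~~ q l.+1) /\ ((k < K)%N -> q k.+1)).
Proof.
move=> kK; have h1 := leq_bigmin_ord K q k; have h2 := leq_bigmin_ord K q k.+1.
split => [E|[ha hb]].
  rewrite E leqnn in h1; rewrite E ltnn in h2.
  have [_ hl] := h1.1 isT; split => // kK'; apply: contraT => nq.
  suff : false by []; apply/h2; split => // l; rewrite ltnS leq_eqVlt => /predU1P[->//|]; exact: hl.
apply/eqP; rewrite eqn_leq; apply/andP; split; last by apply/h1.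
rewrite leqNgt; apply/negP => /h2[kK' hl].
by have := hl k (ltnSn k); rewrite hb.
Qed.

Lemma khatB_eq (alpha z : nat -> R) n K (X : 'M[R]_(n, K)) (Y : 'cV[R]_n) j :
  (forall i, (i < K)%N -> zq (alpha i.+1 / 2) = (z i)%:E) -> (j < K)%N ->
  khatB alpha X Y = j.+1 <->
  ~~ (`|Ztilde X Y j.+1| < z j) /\ (forall l, (j < l < K)%N -> `|Ztilde X Y l.+1| < z l).
Proof.
move=> hz jK; have h l : (l < K)%N ->
    (thr alpha l.+1 <= (`|Ztilde X Y l.+1|)%:E)%E = ~~ (`|Ztilde X Y l.+1| < z l).
  by move=> lK; rewrite /thr/= hz// lee_fin -leNgt.
have := bigmax_ord_eq (fun k => (thr alpha k <= (`|Ztilde X Y k|)%:E)%E) jK.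
rewrite -/(khatB alpha X Y) => ->; rewrite h//; split => -[h1 h2]; split => // l /andP[jl lK].
  by have := h2 l; rewrite h// jl lK negbK => /(_ isT).
by rewrite h// negbK h2// jl.
Qed.

Lemma khatF_eq (alpha z : nat -> R) n K (X : 'M[R]_(n, K)) (Y : 'cV[R]_n) k :
  (forall i, (i < K)%N -> zq (alpha i.+1 / 2) = (z i)%:E) -> (k <= K)%N ->
  khatF alpha X Y = k <->
  (forall l, (l < k)%N -> ~~ (`|Ztilde X Y l.+1| < z l)) /\
  ((k < K)%N -> `|Ztilde X Y k.+1| < z k).
Proof.
move=> hz kK; have h l : (l < K)%N ->
    ((`|Ztilde X Y l.+1|)%:E < thr alpha l.+1)%E = (`|Ztilde X Y l.+1| < z l).
  by move=> lK; rewrite /thr/= hz// lte_fin.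
have := bigmin_ord_eq (fun k => ((`|Ztilde X Y k|)%:E < thr alpha k)%E) kK.
rewrite -/(khatF alpha X Y) => ->; split => -[h1 h2]; split => [l lk|kK'].
- by rewrite -h ?h1// (leq_trans lk).
- by rewrite -h// h2.
- by rewrite h ?h1// (leq_trans lk).
- by rewrite h// h2.
Qed.

Lemma khatO_eq (alpha z : nat -> R) n K (X : 'M[R]_(n, K)) (Y : 'cV[R]_n) :
  (forall i, (i < K)%N -> zq (alpha i.+1 / 2) = (z i)%:E) ->
  khatO alpha X Y = #|[pred i : 'I_K | ~~ (`|Zhat X Y i| < z i)]|.
Proof.
move=> hz; rewrite /khatO; apply: eq_card => i; rewrite [RHS]inE/= -leNgt -lee_fin -hz//.
by apply/idP/idP; rewrite inE.
Qed.

Lemma prodr_bool (I : finType) (b : I -> bool) :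
  \prod_(i : I) (b i)%:R = ([forall i, b i])%:R :> R.
Proof.
case: forallP => [h|h] /=; first by rewrite big1// => i _; rewrite h.
have [i /negbTE bi] : exists i, ~~ b i by apply/existsP; rewrite -negb_forall; exact/forallP.
by rewrite (bigD1 i)//= bi mul0r.
Qed.

(** Exactly one pattern [b] agrees with [x], so a statement about the count becomes a finite sum of
    products over coordinates. *)
Lemma card_indicator K (x : 'I_K -> bool) (k : nat) :
  (#|[pred i | ~~ x i]| == k)%:R =
  \sum_(b : {ffun 'I_K -> bool} | #|[pred i | ~~ b i]| == k)
    \prod_(j < K) (x j == b j)%:R :> R.
Proof.
have e (b : {ffun 'I_K -> bool}) : \prod_(j < K) (x j == b j)%:R = (b == [ffun j => x j])%:R :> R.
  rewrite prodr_bool; congr (nat_of_bool _)%:R; apply/forallP/eqP => [h|->].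
    by apply/ffunP => j; rewrite ffunE; apply/esym/eqP.
  by move=> j; rewrite ffunE.
under eq_bigr do rewrite e.
have xE : #|[pred i | ~~ [ffun j => x j] i]| = #|[pred i | ~~ x i]|.
  by apply: eq_card => i; rewrite !inE ffunE.
case: eqP => [E|E].
  rewrite (bigD1 [ffun j => x j])/=; last by rewrite xE E.
  by rewrite eqxx big1 ?addr0// => b /andP[_ /negbTE ->].
rewrite big1// => b /eqP bk; case: eqP => // bE.
by exfalso; apply: E; rewrite -xE -bE.
Qed.

(** Used both for the tests and for the Bernoulli variables: the two laws of counts are compared as
    the same finite sum, without being evaluated. *)
Lemma prob_card d (T : measurableType d) (P : probability T R) K (x : T -> 'I_K -> bool) k :
  (forall j : 'I_K, measurable [set w | x w j]) ->
  measurable [set w | #|[pred i | ~~ x w i]| = k] /\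
  P [set w | #|[pred i | ~~ x w i]| = k] =
  (\sum_(b : {ffun 'I_K -> bool} | #|[pred i | ~~ b i]| == k)
    Ex P (fun w => \prod_(j < K) (x w j == b j)%:R))%:E.
Proof.
move=> mx.
have mxb (j : 'I_K) (b : bool) : measurable_fun setT (fun w => (x w j == b)%:R : R).
  rewrite (_ : (fun w => _) = if b then \1_[set w | x w j] else (fun w => 1 - \1_[set w | x w j] w)).
    by case: b; [exact: measurable_indic|apply: measurable_funB => //; exact: measurable_indic].
  apply/funext => w; have e : (w \in [set w | x w j]) = x w j by apply/idP/idP; rewrite inE.
  by case: b; rewrite !indicE e; case: (x w j); rewrite ?subrr ?subr0.
have mp (b : {ffun 'I_K -> bool}) : measurable_fun setT (fun w => \prod_(j < K) (x w j == b j)%:R : R).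
  by apply: measurable_prod.
have ip (b : {ffun 'I_K -> bool}) : intg P (fun w => \prod_(j < K) (x w j == b j)%:R).
  apply: (@intg_bounded _ _ _ _ _ 1) => // w; rewrite prodr_bool.
  by case: [forall _, _]; rewrite ?normr1 ?normr0.
pose f w : R := \sum_(b : {ffun 'I_K -> bool} | #|[pred i | ~~ b i]| == k) \prod_(j < K) (x w j == b j)%:R.
have fE w : f w = (#|[pred i | ~~ x w i]| == k)%:R by rewrite card_indicator.
have mf : measurable_fun setT f.
  rewrite /f; under eq_fun do rewrite -big_filter.
  exact: measurable_sum.
have mE : measurable [set w | #|[pred i | ~~ x w i]| = k].
  rewrite (_ : [set w | _] = f @^-1` [set 1]).
    by rewrite -[X in measurable X]setTI; apply: mf.
  apply/seteqP; split => w /=; rewrite fE; first by move=> ->; rewrite eqxx.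
  by case: eqP => // _ /eqP; rewrite eq_sym oner_eq0.
split => //; rewrite -(Ex_indic P mE); congr (_%:E).
rewrite -big_filter -Ex_sum//; apply: eq_Ex => w; rewrite big_filter -/(f w) fE indicE.
by congr (nat_of_bool _)%:R; apply/idP/eqP; rewrite inE.
Qed.

Lemma prod_nat_split K k (F : nat -> R) : (k < K)%N ->
  \prod_(0 <= i < K) F i = \prod_(0 <= i < k) F i * F k * \prod_(k.+1 <= i < K) F i.
Proof.
by move=> kK; rewrite (@big_cat_nat _ _ _ k)//= ?(ltnW kK)// [X in _ * X]big_ltn// mulrA.
Qed.

End estimators.

(* Index [j] stands for the test of coefficient [j.+1] in the paper. *)
Definition accprob {R : realType} (k0 : nat) (alpha : nat -> R) (j : nat) : R :=
  if (j < k0)%N then 0 else 1 - alpha j.+1.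

(** * Law of a sum of independent Bernoulli variables *)

Section bernoulli_sum.
Context {R : realType} (d : measure_display) (T : measurableType d) (Q : probability T R).
Variables (K k0 : nat) (alpha : nat -> R) (B : nat -> T -> R).
Hypothesis k0K : (k0 <= K)%N.
Hypothesis mB : forall j, (k0 < j <= K)%N -> measurable_fun setT (B j).
Hypothesis iB : mutual_indep Q [set j | (k0 < j <= K)%N] B.
Hypothesis hB : forall j, (k0 < j <= K)%N ->
  Q [set w | B j w = 1] = (alpha j)%:E /\ Q [set w | B j w = 0] = (1 - alpha j)%:E.

(** Imitates the limiting tests: the value [false] is a rejection, certain below [k0] and otherwise
    the event that the Bernoulli variable is 1. *)
Let x w (j : 'I_K) := (k0 <= j)%N && (B j.+1 w != 1).

Let mB1 (j : nat) (C : set R) : (k0 <= j < K)%N -> measurable C -> measurable (B j.+1 @^-1` C).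
Proof. by move=> jK mC; rewrite -[X in measurable X]setTI; apply: mB. Qed.

Let mx j : measurable [set w | x w j].
Proof.
rewrite /x; case: (leqP k0 j) => jk /=; last first.
  by rewrite (_ : [set w | _] = set0)//; apply/seteqP; split.
rewrite (_ : [set w | _] = ~` (B j.+1 @^-1` [set 1])); last first.
  by apply/seteqP; split => w /= /eqP.
by apply: measurableC; apply: mB1 => //; rewrite jk/=.
Qed.

Let Q_neq1 j : (k0 < j <= K)%N -> Q (B j @^-1` (~` [set 1])) = (1 - alpha j)%:E.
Proof.
case: j => // j jK; have [h1 _] := hB jK.
rewrite -preimage_setC probability_setC; last exact: mB1.
by rewrite (_ : B j.+1 @^-1` [set 1] = [set w | B j.+1 w = 1])// h1 EFinB.
Qed.

Let prod_seq_bool (s : seq nat) (b : nat -> bool) :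
  \prod_(i <- s) (b i)%:R = (all b s)%:R :> R.
Proof.
elim: s => [|i s IH]; first by rewrite big_nil.
by rewrite big_cons IH /=; case: (b i); rewrite ?mul1r ?mul0r.
Qed.

Let prod_seq_EFin (s : seq nat) (F : nat -> \bar R) (G : nat -> R) :
  (forall i, i \in s -> F i = (G i)%:E) -> (\prod_(i <- s) F i)%E = (\prod_(i <- s) G i)%:E.
Proof.
elim: s => [|i s IH] h; first by rewrite !big_nil.
rewrite !big_cons h ?mem_head// IH// => j js; apply: h.
by rewrite inE js orbT.
Qed.

Lemma Ex_bernoulli_pattern (b : {ffun 'I_K -> bool}) :
  Ex Q (fun w => \prod_(j < K) (x w j == b j)%:R) =
  \prod_(j < K) (if b j then accprob k0 alpha j else 1 - accprob k0 alpha j).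
Proof.
pose bn (i : nat) : bool := oapp b false (insub i).
have bnE (j : 'I_K) : bn j = b j by rewrite /bn valK.
(* The complement of [{1}] is used instead of [{0}], since the variables are 0 or 1 only almost
   surely. *)
pose C i : set R := if bn i.-1 then ~` [set 1] else [set 1].
have mC i : measurable (C i) by rewrite /C; case: (bn _) => //; exact: measurableC.
pose s := index_iota k0.+1 K.+1.
have sE i : (i \in s) = (k0 < i <= K)%N by rewrite mem_index_iota.
pose G i : R := if bn i.-1 then 1 - alpha i else alpha i.
have QC i : i \in s -> Q (B i @^-1` C i) = (G i)%:E.
  by rewrite sE /C /G => iK; case: (bn _); [exact: Q_neq1|have [] := hB iK].
pose E := \bigcap_(i in [set j | j \in s]) (B i @^-1` C i).
have mE : measurable E.
  apply: bigcap_measurableType => -[|i] /=; rewrite sE// => iK.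
  exact: mB1.
have QE : Q E = (\prod_(i <- s) G i)%:E.
  rewrite /E iB//; [exact: prod_seq_EFin|exact: iota_uniq|].
  by move=> i; rewrite sE.
have EE : Ex Q \1_E = \prod_(i <- s) G i by apply: EFin_inj; rewrite Ex_indic.
pose c : R := \prod_(0 <= i < k0) (~~ bn i)%:R.
have pw w : \prod_(j < K) (x w j == b j)%:R = c * \1_E w.
  rewrite (eq_bigr (fun j : 'I_K => (((k0 <= j)%N && (B j.+1 w != 1)) == bn j)%:R)); last first.
    by move=> j _; rewrite bnE.
  rewrite -(big_mkord xpredT (fun j => (((k0 <= j)%N && (B j.+1 w != 1)) == bn j)%:R)).
  rewrite (@big_cat_nat _ _ _ k0)//=; congr (_ * _).
    rewrite big_nat [RHS]big_nat; apply: eq_bigr => i /andP[_ ik].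
    by rewrite leqNgt ik/=; case: (bn i).
  rewrite (_ : \1_E w = \prod_(i <- s) (((B i w != 1)) == bn i.-1)%:R).
    rewrite /s big_add1/= big_nat [RHS]big_nat; apply: eq_bigr => i /andP[ik _].
    by rewrite ik.
  rewrite prod_seq_bool indicE; congr (nat_of_bool _)%:R; apply/idP/allP.
    rewrite inE => h i /h; rewrite /C /=; case: (bn _) => /=.
      by move/eqP => ->.
    by move=> ->; rewrite eqxx.
  move=> h; rewrite inE => i /h; rewrite /C; case: (bn _) => /=.
    by move=> /eqP/negP h1 h2; apply: h1; apply/eqP.
  by move=> /eqP/negbFE/eqP.
rewrite (eq_Ex _ pw) ExZ ?EE; last exact: intg_indic.
rewrite [RHS](eq_bigr (fun j : 'I_K => if bn j then accprob k0 alpha j else 1 - accprob k0 alpha j)); last first.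
  by move=> j _; rewrite bnE.
rewrite -(big_mkord xpredT (fun j => if bn j then accprob k0 alpha j else 1 - accprob k0 alpha j)).
rewrite [RHS](@big_cat_nat _ _ _ k0)//=; congr (_ * _).
  rewrite /c big_nat [RHS]big_nat; apply: eq_bigr => i /andP[_ ik].
  by rewrite /accprob ik; case: (bn i); rewrite ?subr0.
rewrite /s big_add1/= big_nat [RHS]big_nat; apply: eq_bigr => i /andP[ik _].
by rewrite /accprob ltnNge ik/= /G/=; case: (bn i) => //; rewrite opprB addrC subrK.
Qed.

Let null_bigsetU (s : seq nat) (N : nat -> set T) :
  (forall j, j \in s -> measurable (N j) /\ Q (N j) = 0%E) ->
  measurable (\big[setU/set0]_(j <- s) N j) /\ Q (\big[setU/set0]_(j <- s) N j) = 0%E.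
Proof.
elim: s => [|i s IH] h; first by rewrite big_nil measure0.
have [m1 q1] := h i (mem_head _ _).
have [j js|m2 q2] := IH; first by apply: h; rewrite inE js orbT.
rewrite big_cons; split; first exact: measurableU.
by rewrite setUC measureU0.
Qed.

Let null_diff (A D N : set T) : measurable A -> measurable D -> measurable N -> Q N = 0%E ->
  (forall w, ~ N w -> (A w <-> D w)) -> Q A = Q D.
Proof.
move=> mA mD mN N0 h.
have le A' D' : measurable A' -> measurable D' -> (forall w, ~ N w -> A' w -> D' w) -> (Q A' <= Q D')%E.
  move=> mA' mD' h'; rewrite -(measureU0 mD' mN N0) le_measure ?inE//; first exact: measurableU.
  by move=> w Aw; have [Nw|Nw] := pselect (N w); [right|left; exact: h'].
by apply/eqP; rewrite eq_le !le// => w /h[].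
Qed.

(** Off a null set every [B j] is 0 or 1, and the number of rejections is the sum plus the [k0]
    certain ones. *)
Lemma bernoulli_sum_prob k : (k0 <= k)%N ->
  Q [set w | \sum_(k0.+1 <= j < K.+1) B j w = (k - k0)%:R] =
  (\sum_(b : {ffun 'I_K -> bool} | #|[pred i | ~~ b i]| == k)
    \prod_(j < K) (if b j then accprob k0 alpha j else 1 - accprob k0 alpha j))%:E.
Proof.
move=> k0k.
under eq_bigr do rewrite -Ex_bernoulli_pattern.
have [mcard <-] := prob_card Q k mx.
pose s := index_iota k0.+1 K.+1.
have sE i : (i \in s) = (k0 < i <= K)%N by rewrite mem_index_iota.
pose N j := ~` (B j @^-1` [set 1] `|` B j @^-1` [set 0]).
have hN j : j \in s -> measurable (N j) /\ Q (N j) = 0%E.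
  case: j => [|j]; rewrite sE// => jK.
  have m1 : measurable (B j.+1 @^-1` [set 1]) by exact: mB1.
  have m0 : measurable (B j.+1 @^-1` [set 0]) by exact: mB1.
  have mU := measurableU _ _ m1 m0.
  split; first exact: measurableC.
  rewrite probability_setC// measureU//.
    have [h1 h0] := hB jK.
    transitivity (1 - ((alpha j.+1)%:E + (1 - alpha j.+1)%:E))%E; first by rewrite -h1 -h0.
    by rewrite -EFinD (_ : alpha j.+1 + (1 - alpha j.+1) = 1) ?subrr//; ring.
  by apply/seteqP; split => w //= [->] /eqP; rewrite oner_eq0.
have [mN QN] := null_bigsetU hN.
apply: (null_diff _ _ mN QN).
- rewrite (_ : [set w | _] = (fun w => \sum_(j <- s) B j w) @^-1` [set (k - k0)%:R])//.
  rewrite -[X in measurable X]setTI.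
  suff mS : measurable_fun setT (fun w => \sum_(j <- s) B j w) by apply: mS.
  rewrite (_ : (fun w => _) = fun w => \sum_(j <- s) (if (k0 < j <= K)%N then B j w else 0)).
    apply: measurable_sum => j; case: (boolP (k0 < j <= K)%N) => jK; first exact: mB.
    exact: measurable_cst.
  by apply/funext => w; rewrite big_seq [RHS]big_seq; apply: eq_bigr => j; rewrite sE => ->.
- exact: mcard.
move=> w Nw.
have B01 j : (k0 < j <= K)%N -> B j w = (B j w == 1)%:R.
  move=> jK; apply: contrapT => h; apply: Nw; rewrite -bigcup_seq; exists j => /=; first by rewrite sE.
  move=> [] /= E; apply: h; rewrite E ?eqxx//.
  by rewrite eq_sym oner_eq0.
rewrite /=; have -> : \sum_(k0.+1 <= j < K.+1) B j w = (\sum_(k0 <= j < K) (B j.+1 w == 1%R))%N%:R.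
  rewrite big_add1/= natr_sum big_nat [RHS]big_nat; apply: eq_bigr => j jK.
  exact: B01.
have -> : #|[pred i | ~~ x w i]| = (k0 + \sum_(k0 <= j < K) (B j.+1 w == 1%R))%N.
  rewrite -sum1_card big_mkcond/=.
  rewrite (eq_bigr (fun j : 'I_K => nat_of_bool (~~ ((k0 <= j)%N && (B j.+1 w != 1))))); last first.
    by move=> j _; rewrite inE /x; case: ifP.
  rewrite -(big_mkord xpredT (fun j => nat_of_bool (~~ ((k0 <= j)%N && (B j.+1 w != 1))))).
  rewrite (@big_cat_nat _ _ _ k0)//=; congr (_ + _)%N.
    rewrite big_nat (eq_bigr (fun=> 1%N)); last by move=> i /andP[_ ik]; rewrite leqNgt ik.
    by rewrite -big_nat sum_nat_const_nat subn0 muln1.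
  by rewrite big_nat [RHS]big_nat; apply: eq_bigr => i /andP[ik _]; rewrite ik negbK.
split => [/eqP|<-]; last by rewrite addKn.
by rewrite eqr_nat => /eqP ->; rewrite subnKC.
Qed.

End bernoulli_sum.

Lemma leq_double_sub (n K : nat) : (2 * K < n)%N -> (n <= 2 * (n - K))%N.
Proof. lia. Qed.

(** * Asymptotic independence of the tests *)

Section asymptotics.
Context (R : realType) (d : measure_display) (T : measurableType d) (P : probability T R).
Variables (K : nat) (beta0 : 'cV[R]_K) (X : forall n : nat, 'M[R]_(n, K)) (Sigma0 : 'M[R]_K).
Variables (eps : nat -> T -> R) (sigma0 M : R).
Hypothesis Xmax : (fun n => \big[Num.max/0]_(i < n)
  (Num.sqrt (\sum_(k < K) X n i k ^+ 2) / Num.sqrt n%:R)) @ \oo --> 0.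
Hypothesis Xpd : forall n, (K < n)%N -> posdefmx ((X n)^T *m X n).
Hypothesis Xcvg : forall i j : 'I_K,
  (fun n => (n%:R^-1 *: ((X n)^T *m X n)) i j) @ \oo --> Sigma0 i j.
Hypothesis Spd : posdefmx Sigma0.
Hypothesis meps : forall i, measurable_fun setT (eps i).
Hypothesis ieps : mutual_indep P setT eps.
Hypothesis e4i : forall i, intg P (fun w => eps i w ^+ 4).
Hypothesis e1 : forall i, Ex P (eps i) = 0.
Hypothesis e2 : forall i, Ex P (fun w => eps i w ^+ 2) = sigma0 ^+ 2.
Hypothesis e4 : forall i, Ex P (fun w => eps i w ^+ 4) <= M.
Hypothesis sig0 : 0 < sigma0.

Let s2 := sigma0 ^+ 2.
Let s20 : 0 < s2. Proof. by rewrite exprn_gt0. Qed.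
Let M0 : 0 <= M. Proof. exact: (M_ge0 e4). Qed.

Lemma near_and (A B : nat -> Prop) : (\forall n \near \oo, A n) ->
  (\forall n \near \oo, B n) -> \forall n \near \oo, A n /\ B n.
Proof. by move=> hA hB; apply: filterS2 hA hB. Qed.

Lemma near_gtK : \forall n \near \oo, (K < n)%N.
Proof. exact: nbhs_infty_gt. Qed.

Lemma Sigma0_sym : Sigma0^T = Sigma0.
Proof.
apply/matrixP => i j; rewrite mxE.
have h := @Xcvg i j; have h' := @Xcvg j i.
rewrite -(cvg_lim (@Rhausdorff R) h') -(cvg_lim (@Rhausdorff R) h).
congr (lim (_ @ \oo)); apply/funext => n.
by rewrite !mxE; congr (_ * _); apply: eq_bigr => l _; rewrite !mxE mulrC.
Qed.

(** The limit form is coercive with constant at least [1 / tau], and closeness of the entries costs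
    at most half of it. *)
Lemma eventually_coercive : exists2 lam : R, 0 < lam & \forall n \near \oo,
  forall v : 'cV[R]_K, lam * n%:R * \sum_j v j 0 ^+ 2 <= bform ((X n)^T *m X n) v v.
Proof.
pose tau := `|\tr (invmx Sigma0)| + 1.
have tau0 : 0 < tau by rewrite ltr_wpDl.
exists ((2 * tau)^-1); first by rewrite invr_gt0 mulr_gt0.
(* Entrywise errors [del] change the form by at most [del * K] times the squared norm, which is
   below [1 / (2 tau)] times it. *)
pose del := (2 * tau * (K%:R + 1))^-1.
have K1 : 0 < K%:R + 1 :> R by rewrite ltr_wpDl.
have del0 : 0 < del by rewrite invr_gt0 !mulr_gt0.
have hn : \forall n \near \oo, forall i j : 'I_K,
    `|(n%:R^-1 *: ((X n)^T *m X n)) i j - Sigma0 i j| <= del.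
  apply: filter_forall => i; apply: filter_forall => j.
  have /cvgrPdist_le/(_ _ del0) := @Xcvg i j.
  by apply: filterS => n; rewrite distrC.
apply: filterS2 hn near_gtK => n hn nK v.
have n0 : 0 < n%:R :> R by rewrite ltr0n (leq_ltn_trans _ nK).
have nE : bform (n%:R^-1 *: ((X n)^T *m X n)) v v = n%:R^-1 * bform ((X n)^T *m X n) v v.
  by rewrite /bform -scalemxAr -scalemxAl mxE.
have S0 : 0 <= \sum_j v j 0 ^+ 2 by apply: sumr_ge0 => j _; exact: sqr_ge0.
have := bform_perturb v hn; rewrite nE.
have := bform_coercive v Spd Sigma0_sym.
have := bform_ge0 v Spd.
move: (\sum_j _) S0 => S S0; set b := bform Sigma0 v v; set B := bform (_ *m _) v v => b0 hc hp.
have h1 : S <= tau * b.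
  rewrite (le_trans hc)// ler_wpM2r// (le_trans (ler_norm _))// lerDl//.
have h2 : del * (K%:R * S) <= (2 * tau)^-1 * S.
  rewrite mulrA ler_wpM2r// /del invfM -mulrA ler_piMr ?invr_ge0 ?mulr_ge0 ?ltW//.
  by rewrite mulrC ltr_pdivrMr// mul1r ltrDl.
have h3 : tau^-1 * S <= b by rewrite ler_pdivrMl.
have h4 : (2 * tau)^-1 * S <= n%:R^-1 * B.
  apply: le_trans hp; rewrite lerBrDr (le_trans (lerD (lexx _) h2))//.
  by rewrite (le_trans _ h3)// le_eqVlt; apply/orP; left; apply/eqP; field; rewrite gt_eqF.
by rewrite mulrAC -ler_pdivlMr// [B / _]mulrC.
Qed.

Definition coef n (i : 'I_n) (k : 'I_K) : R :=
  gsrow (X n) k 0 i / (Num.sqrt (gsvar (X n) k) * sigma0).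

Lemma coef_orth n : (K < n)%N -> orthonormal_coefs s2 (@coef n).
Proof.
move=> nK k l.
have pX := Xpd nK.
have sq j : Num.sqrt (gsvar (X n) j) != 0 by rewrite gt_eqF// sqrtr_gt0 gsvar_gt0.
have -> : \sum_(i < n) coef i k * coef i l =
    (gsrow (X n) k *m (gsrow (X n) l)^T) 0 0 /
    (Num.sqrt (gsvar (X n) k) * Num.sqrt (gsvar (X n) l) * s2).
  rewrite mxE mulr_suml; apply: eq_bigr => i _; rewrite [(gsrow _ _)^T _ _]mxE /coef /s2; field.
  by rewrite !sq gt_eqF.
have [->|kl] := eqVneq k l.
  rewrite gsrow_norm// -expr2 sqr_sqrtr; last by rewrite ltW// gsvar_gt0.
  by rewrite invfM mulrA divff// gt_eqF// gsvar_gt0.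
rewrite (_ : fun_of_matrix _ _ _ = 0) ?mul0r//.
case: (ltngtP k l) kl => [kl _|kl _|/val_inj ->]; last by rewrite eqxx.
  by rewrite -[LHS](mxE trmx_key (fun i j => (gsrow (X n) k *m (gsrow (X n) l)^T) j i) 0 0) -/(trmx _) trmx_mul trmxK gsrow_orth.
by rewrite gsrow_orth.
Qed.

(** The Lindeberg-type condition: up to a constant the coefficients are bounded by the largest row
    norm of [X] over [sqrt n]. *)
Lemma coef_small : exists2 delta : nat -> R, delta @ \oo --> 0 &
  \forall n \near \oo, forall i k, `|@coef n i k| <= delta n.
Proof.
have [lam lam0 hlam] := eventually_coercive.
pose mx n := \big[Num.max/0]_(i < n) (Num.sqrt (\sum_(k < K) X n i k ^+ 2) / Num.sqrt n%:R).
exists (fun n => mx n * (Num.sqrt (K%:R / lam) / sigma0)).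
  by rewrite -[X in _ --> X](mul0r (Num.sqrt (K%:R / lam) / sigma0)); apply: cvgMl.
apply: filterS2 hlam near_gtK => n hl nK i k.
have n0 : (0 < n)%N by rewrite (leq_ltn_trans _ nK).
have pX := Xpd nK; have gv := gsvar_gt0 pX k.
have sg : 0 < Num.sqrt (gsvar (X n) k) by rewrite sqrtr_gt0.
have := gsrow_entry_le pX k i lam0 n0 hl.
set S := \sum_(j < K) X n i j ^+ 2 => h.
have S0 : 0 <= S by apply: sumr_ge0 => j _; exact: sqr_ge0.
have h1 : `|gsrow (X n) k 0 i| <= Num.sqrt S / Num.sqrt n%:R * Num.sqrt (K%:R / lam) * Num.sqrt (gsvar (X n) k).
  rewrite -sqrtr_sqr (le_trans (ler_wsqrtr h))//.
  rewrite sqrtrM; last by rewrite !mulr_ge0// ?invr_ge0// ltW.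
  rewrite sqrtrM; last by rewrite !mulr_ge0// ?invr_ge0// ltW.
  by rewrite sqrtrM// sqrtrV.
have h2 : Num.sqrt S / Num.sqrt n%:R <= mx n.
  exact: (@le_bigmax _ _ _ _ (fun i : 'I_n => Num.sqrt (\sum_(k < K) X n i k ^+ 2) / Num.sqrt n%:R)).
rewrite /coef normrM normfV (gtr0_norm (mulr_gt0 sg sig0)) ler_pdivrMr ?mulr_gt0//.
apply: (le_trans h1).
have -> : mx n * (Num.sqrt (K%:R / lam) / sigma0) * (Num.sqrt (gsvar (X n) k) * sigma0) =
  mx n * Num.sqrt (K%:R / lam) * Num.sqrt (gsvar (X n) k) by field; rewrite gt_eqF.
by rewrite ler_wpM2r// ler_wpM2r.
Qed.

Let Y n w := Yvec (X n) beta0 eps w.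
Let s2h n w := sigma2hat (X n) (Y n w).
Let W n w k := linstat eps (@coef n) w k.
Let rho n w := Num.sqrt (s2h n w) / sigma0.
Definition drift n k :=
  (gsrow (X n) k *m (X n *m beta0)) 0 0 / (Num.sqrt (gsvar (X n) k) * sigma0).
Let mu := drift.

Lemma Z_decomp n (k : 'I_K) w : (K < n)%N ->
  Ztilde (X n) (Y n w) k.+1 = (W n w k + mu n k) / rho n w.
Proof.
move=> nK; have n0 : (0 < n)%N by rewrite (leq_ltn_trans _ nK).
have pX := Xpd nK.
have sq : Num.sqrt (gsvar (X n) k) != 0 by rewrite gt_eqF// sqrtr_gt0 gsvar_gt0.
rewrite Ztilde_gs// /rho -/(s2h n w).
have -> : (gsrow (X n) k *m Y n w) 0 0 = (W n w k + mu n k) * (Num.sqrt (gsvar (X n) k) * sigma0).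
  rewrite /Y /Yvec mulmxDr mxE addrC mulrDl; congr (_ + _); last first.
    by rewrite /mu /drift divfK// mulf_neq0// gt_eqF.
  rewrite mxE /W /linstat mulr_suml; apply: eq_bigr => i _; rewrite [(\col__ _) _ _]mxE /coef; field.
  by rewrite sq gt_eqF.
(* If the variance estimate is 0, both quotients are 0 by the convention on division. *)
have [->|s0] := eqVneq (Num.sqrt (s2h n w)) 0; first by rewrite !mul0r !invr0 !mulr0.
by field; rewrite s0 sq gt_eqF.
Qed.

Lemma s2hE n w : (K < n)%N -> s2h n w = (\sum_(i < n) eps i w ^+ 2 -
  \sum_(i < n) \sum_(j < n) hatmx (X n) i j * (eps i w * eps j w)) / (n - K)%:R.
Proof.
move=> nK; rewrite /s2h /Y /Yvec (sigma2hatE (Xpd nK)); congr ((_ - _) / _).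
  by apply: eq_bigr => i _; rewrite mxE.
by apply: eq_bigr => i _; apply: eq_bigr => j _; rewrite !mxE.
Qed.

Lemma measurable_s2h n : (K < n)%N -> measurable_fun setT (s2h n).
Proof.
move=> nK; rewrite (_ : s2h n = fun w => (\sum_(i < n) eps i w ^+ 2 -
  \sum_(i < n) \sum_(j < n) hatmx (X n) i j * (eps i w * eps j w)) / (n - K)%:R); last first.
  by apply/funext => w; exact: s2hE.
apply: measurable_funM => //; apply: measurable_funB; apply: measurable_sum => i.
  exact: measurable_funX.
by apply: measurable_sum => j; apply: measurable_funM => //; exact: measurable_funM.
Qed.

Lemma measurable_rho n : (K < n)%N -> measurable_fun setT (rho n).
Proof.
move=> nK; apply: measurable_funM => //.
apply: measurableT_comp (measurable_s2h nK).
exact: continuous_measurable_fun (@sqrt_continuous R).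
Qed.

(** The error is [(S + K s2 - Q) / (n - K)], with [S] the centered sum of squares and [Q] the
    hat-matrix form. [Q] is nonnegative with mean [K s2], the trace of a projection of rank [K]
    times [s2]. *)
Lemma Ex_s2h n : (K < n)%N -> intg P (fun w => `|s2h n w - s2|) /\
  Ex P (fun w => `|s2h n w - s2|) <= ((M + 1) * Num.sqrt n%:R + 2 * K%:R * s2) / (n - K)%:R.
Proof.
move=> nK; have n0 : (0 < n)%N by rewrite (leq_ltn_trans _ nK).
set N : R := (n - K)%:R; have N0 : 0 < N by rewrite ltr0n subn_gt0.
have NE : N = n%:R - K%:R by rewrite /N natrB// ltnW.
set r : R := Num.sqrt n%:R; have r0 : 0 < r by rewrite sqrtr_gt0 ltr0n.
have rr : r * r = n%:R by rewrite -expr2 sqr_sqrtr.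
pose S w := \sum_(i < n) (eps i w ^+ 2 - s2).
pose Q w := \sum_(i < n) \sum_(j < n) hatmx (X n) i j * (eps i w * eps j w).
have [iS2 ES2] := Ex_centered_sqr meps ieps e4i e2 e4 n.
have [iQ EQ] := Ex_quadratic meps ieps e4i e1 e2 (hatmx (X n)).
have Q0 w : 0 <= Q w.
  have := hatmx_quad_ge0 (Xpd nK) (\col_i eps i w).
  congr (0 <= _); apply: eq_bigr => i _; apply: eq_bigr => j _; by rewrite !mxE.
(* [|S| <= S^2 / r + r] with [r = sqrt n] balances the two terms, as [S^2] has mean at most
   [n M]. *)
pose B w := (N * r)^-1 * S w ^+ 2 + (r + K%:R * s2) / N + N^-1 * Q w.
have hB w : `|s2h n w - s2| <= B w.
  have -> : s2h n w - s2 = (S w + K%:R * s2 - Q w) / N.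
    rewrite s2hE// -/N -/(Q w) /S sumrB sumr_const card_ord -[s2 *+ n]mulr_natl.
    by rewrite -[n%:R](subrK K%:R) -NE; field; rewrite gt_eqF.
  have -> : B w = (S w ^+ 2 / r + r + K%:R * s2 + Q w) / N by rewrite /B; field; rewrite !gt_eqF.
  rewrite normrM (gtr0_norm (_ : 0 < N^-1)) ?invr_gt0// ler_wpM2r ?invr_ge0 ?(ltW N0)//.
  have hS : `|S w| <= S w ^+ 2 / r + r.
    have [Sr|Sr] := leP `|S w| r; first by rewrite (le_trans Sr)// lerDr mulr_ge0 ?sqr_ge0// invr_ge0 ltW.
    rewrite (@le_trans _ _ (S w ^+ 2 / r))// ?lerDl ?(ltW r0)// ler_pdivlMr//.
    by rewrite -[S w ^+ 2]real_normK ?num_real// expr2 ler_wpM2l// ltW.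
  have Ks : 0 <= K%:R * s2 by rewrite mulr_ge0// ltW.
  have Qw := Q0 w.
  have h1 := ler_normD (S w + K%:R * s2) (- Q w); have h2 := ler_normD (S w) (K%:R * s2).
  rewrite normrN (ger0_norm Qw) in h1; rewrite (ger0_norm Ks) in h2.
  by move: hS h1 h2; lra.
have iB : intg P B.
  apply: intgD; last exact: intgZ.
  by apply: intgD; [exact: intgZ|exact: intg_cst].
have EB : Ex P B <= ((M + 1) * r + 2 * K%:R * s2) / N.
  rewrite /B ExD; [|by apply: intgD; [exact: intgZ|exact: intg_cst]|exact: intgZ].
  rewrite ExD; [|exact: intgZ|exact: intg_cst].
  rewrite (ExZ _ (iS2 : intg P (fun w => S w ^+ 2))) (ExZ _ (iQ : intg P Q)) Ex_cst EQ.
  have -> : \sum_(i < n) hatmx (X n) i i = K%:R by exact: (hatmx_tr (Xpd nK)).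
  have h : (N * r)^-1 * Ex P (fun w => S w ^+ 2) <= (M * r) / N.
    rewrite ler_pdivrMl ?mulr_gt0// (le_trans ES2)// -rr le_eqVlt; apply/orP; left; apply/eqP.
    by field; rewrite gt_eqF.
  rewrite -/s2 -[leRHS](_ : (M * r) / N + (r + K%:R * s2) / N + N^-1 * (s2 * K%:R) = _); last by ring.
  by rewrite lerD2r lerD2r.
have ms : measurable_fun setT (fun w => `|s2h n w - s2|).
  apply: measurableT_comp (@normr_measurable _ _) _.
  by apply: measurable_funB => //; exact: measurable_s2h.
have is2 : intg P (fun w => `|s2h n w - s2|).
  by apply: (intg_le ms iB) => w; rewrite normr_id.
by split => //; apply: le_trans EB; exact: Ex_le.
Qed.

Lemma s2h_L1 (e : R) : 0 < e -> \forall n \near \oo, Ex P (fun w => `|s2h n w - s2|) <= e.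
Proof.
move=> e0.
pose c := 2 * (M + 1 + 2 * K%:R * s2).
have Ks : 0 <= K%:R * s2 by rewrite mulr_ge0// ltW.
have c0 : 0 < c by rewrite /c; move: Ks M0; lra.
have h1 : \forall n \near \oo, (c / e) ^+ 2 <= n%:R by exact: nbhs_infty_ger.
have h2 : \forall n \near \oo, (2 * K < n)%N by exact: nbhs_infty_gt.
apply: filterS2 h1 h2 => n h1 h2.
have nK : (K < n)%N by apply: leq_ltn_trans h2; rewrite leq_pmull.
have n0 : (0 < n)%N by rewrite (leq_ltn_trans _ nK).
have [_ h] := Ex_s2h nK; apply: (le_trans h).
set r : R := Num.sqrt n%:R; have r0 : 0 < r by rewrite sqrtr_gt0 ltr0n.
have rr : r * r = n%:R by rewrite -expr2 sqr_sqrtr.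
have r1 : 1 <= r by rewrite -sqrtr1 ler_wsqrtr// ler1n.
have rce : c / e <= r.
  by rewrite /r -[leLHS]ger0_norm ?divr_ge0 ?(ltW c0) ?(ltW e0)// -sqrtr_sqr ler_wsqrtr.
have N0 : 0 < (n - K)%:R :> R by rewrite ltr0n subn_gt0.
have NE : n%:R <= 2 * (n - K)%:R :> R.
  by rewrite -natrM ler_nat leq_double_sub.
rewrite ler_pdivrMr//.
have a1 : 2 * ((M + 1) * r + 2 * K%:R * s2) <= c * r.
  have -> : c * r = 2 * ((M + 1) * r + 2 * K%:R * s2 * r) by rewrite /c; ring.
  by rewrite ler_wpM2l// lerD2l ler_peMr// -mulrA mulr_ge0.
have a2 : c * r <= e * n%:R.
  by rewrite -rr mulrA ler_wpM2r ?(ltW r0)// mulrC -ler_pdivrMr.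
have a3 := ler_wpM2l (ltW e0) NE.
by rewrite -(ler_pM2l (ltr0Sn R 1)) (le_trans a1)// (le_trans a2)// (le_trans a3)// mulrCA.
Qed.

(** [|rho^2 - 1| = |rho - 1| (rho + 1)] and [rho >= 0]. *)
Lemma rho_dist n w : (K < n)%N -> `|rho n w - 1| <= `|s2h n w - s2| / s2.
Proof.
move=> nK; have s0 : 0 <= s2h n w.
  by rewrite /s2h /sigma2hat divr_ge0// sumr_ge0// => i _; exact: sqr_ge0.
have rh0 : 0 <= rho n w by rewrite /rho divr_ge0// ltW.
have -> : `|s2h n w - s2| / s2 = `|rho n w - 1| * (rho n w + 1).
  rewrite -[X in _ = _ * X]ger0_norm ?addr_ge0// -normrM -[X in _ / X]ger0_norm ?(ltW s20)//.
  rewrite -normf_div; congr `|_|.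
  have -> : (rho n w - 1) * (rho n w + 1) = rho n w ^+ 2 - 1 by ring.
  by rewrite /rho expr_div_n sqr_sqrtr// /s2; field; rewrite gt_eqF.
by rewrite ler_peMr// lerDr.
Qed.

Definition accept n (k : 'I_K) (z : R) (w : T) : R :=
  ((`|Ztilde (X n) (Y n w) k.+1| < z)%R)%:R.

Lemma acceptE n (k : 'I_K) (z : R) w : (K < n)%N -> 0 < z -> 0 < rho n w ->
  (`|Ztilde (X n) (Y n w) k.+1| < z) = (`|W n w k + mu n k| < z * rho n w).
Proof.
by move=> nK z0 r0; rewrite Z_decomp// normrM normfV (gtr0_norm r0) ltr_pdivrMr.
Qed.

Lemma rho_ge0 n w : 0 <= rho n w.
Proof. by rewrite /rho divr_ge0// ltW. Qed.

Lemma measurable_accept_set n (k : 'I_K) (z : R) : (K < n)%N -> 0 < z ->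
  measurable [set w | `|Ztilde (X n) (Y n w) k.+1| < z].
Proof.
move=> nK z0.
have mW : measurable_fun setT (fun w => W n w k + mu n k).
  by apply: measurable_funD => //; exact: (measurable_linstat meps).
(* Where [rho] vanishes the statistic has value 0 by convention, and the test accepts. *)
have -> : [set w | `|Ztilde (X n) (Y n w) k.+1| < z] =
  (fun w => `|W n w k + mu n k| < z * rho n w) @^-1` [set true] `|`
  (fun w => rho n w <= 0) @^-1` [set true].
  apply/seteqP; split => w /=.
    have := rho_ge0 n w; rewrite le_eqVlt => /predU1P[<-|r0].
      by right; rewrite lexx.
    by rewrite (acceptE k nK z0 r0) => ->; left.
  have := rho_ge0 n w; rewrite le_eqVlt => /predU1P[r0 _|r0].
    by rewrite Z_decomp// -r0 invr0 mulr0 normr0.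
  by rewrite (acceptE k nK z0 r0) leNgt r0 => -[].
apply: measurableU; rewrite -[X in measurable X]setTI.
  apply: (measurable_fun_ltr _ _) => //.
    exact: measurableT_comp (@normr_measurable _ _) mW.
  by apply: measurable_funM => //; exact: measurable_rho.
by apply: (measurable_fun_ler _ _) => //; exact: measurable_rho.
Qed.

Lemma measurable_accept n k z : (K < n)%N -> 0 < z -> measurable_fun setT (accept n k z).
Proof.
move=> nK z0; rewrite (_ : accept n k z = \1_[set w | `|Ztilde (X n) (Y n w) k.+1| < z]).
  exact/measurable_indic/measurable_accept_set.
apply/funext => w; rewrite indicE /accept; congr (nat_of_bool _)%:R.
by apply/idP/idP; rewrite inE.
Qed.

Lemma accept01 n k z w : 0 <= accept n k z w <= 1.
Proof. by rewrite /accept; case: (_ < _); rewrite /= ?lexx ler01. Qed.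

(* [J] is L1-close to smooth test functions of the [k]-th standardized
   statistic whose Gaussian mean is exactly [p]; the same [p] for every error
   [e], so that products converge to products by [stein_clt]. *)
Definition asym (J : nat -> T -> R) (k : 'I_K) (p : R) :=
  [/\ forall n w, 0 <= J n w <= 1,
    (\forall n \near \oo, measurable_fun setT (J n)) &
    forall e : R, 0 < e -> exists g, [/\ stein_nice g p, (forall x, 0 <= g x <= 1) &
      \forall n \near \oo, Ex P (fun w => `|J n w - g (W n w k)|) <= e]].

Lemma nice_measurable g c : stein_nice g c -> measurable_fun setT (g : R -> R).
Proof. by move=> [g' [f [f' [C [h _ _]]]]]; have [] := C11_measurable h. Qed.

Lemma measurable_gW n (g : R -> R) (k : 'I_K) : measurable_fun setT g -> measurable_fun setT (fun w => g (W n w k)).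
Proof. by move=> mg; apply: measurableT_comp mg _; exact: (measurable_linstat meps). Qed.

Lemma asym_one k : asym (fun _ _ => 1) k 1.
Proof.
split=> [n w|//|e e0]; first by rewrite ler01 lexx.
  by apply: filterE.
exists (fun=> 1); split; [exact: stein_nice_cst|by move=> x; rewrite ler01 lexx|].
apply: filterE => n.
rewrite (_ : Ex P _ = 0) ?ltW// -[RHS](Ex_cst P 0); apply: eq_Ex => w.
by rewrite subrr normr0.
Qed.

Lemma asym_compl J k p : asym J k p -> asym (fun n w => 1 - J n w) k (1 - p).
Proof.
move=> [J01 mJ hJ]; split.
- by move=> n w; have /andP[h1 h2] := J01 n w; rewrite subr_ge0 h2/= lerBlDr lerDl.
- by apply: filterS mJ => n mJ; exact: measurable_funB.
- move=> e /hJ[g [ng g01 hg]]; exists (fun x => 1 * 1 + (-1) * g x); split.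
  + have -> : 1 - p = 1 * 1 + (-1) * p by ring.
    exact: (stein_nice_lin 1 (-1) (stein_nice_cst 1) ng).
  + by move=> x; have /andP[h1 h2] := g01 x; rewrite mul1r mulN1r subr_ge0 h2/= lerBlDr lerDl.
  + apply: filterS hg => n; congr (_ <= _); apply: eq_Ex => w.
    rewrite -normrN; congr `|_|; ring.
Qed.

(** The budget [e] is spent in thirds: the mean of the bump [b], the error of [stein_clt] for [b],
    and the event that [rho] is far from 1. *)
Lemma asym_accept_null (a z : R) k : 0 < a < 1 -> 0 < z -> Phi z = 1 - a / 2 ->
  (\forall n \near \oo, mu n k = 0) -> asym (fun n => accept n k z) k (1 - a).
Proof.
move=> a01 z0 Pz hmu; split; first by move=> n w; exact: accept01.
  by apply: filterS near_gtK => n nK; exact: measurable_accept.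
move=> e e0; have e30 : 0 < e / 3 by rewrite divr_gt0.
have [g [b [cb [kap [[ng nb] cbe kap0 g01 hgb]]]]] := acceptance_approx a01 z0 Pz e30.
exists g; split => //.
(* The cap at 1 forces [rho > 0] on the good event, as [acceptE] requires. *)
pose kap' := Num.min kap 1.
have kap'0 : 0 < kap' by rewrite lt_min kap0 ltr01.
have [C HC] := stein_clt meps ieps e4i e1 e2 e4 s20 (fun _ : 'I_K => nb) (isT : uniq [:: k]).
have [delta d0 hd] := coef_small.
have hCd : \forall n \near \oo, C * delta n <= e / 3.
  have : (fun n => C * delta n) @ \oo --> 0.
    by rewrite -[X in _ --> X](mulr0 C); apply: cvgMr.
  move/cvgrPdist_le => /(_ _ e30); apply: filterS => n; rewrite sub0r normrN => h.
  exact: le_trans (ler_norm _) h.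
have hs := s2h_L1 (_ : 0 < e / 3 * (kap' * s2)).
have {}hs := hs (mulr_gt0 e30 (mulr_gt0 kap'0 s20)).
have hall := near_and (near_and hmu hd) (near_and hCd (near_and hs near_gtK)).
apply: filterS hall => n [[mu0 hdn] [hCdn [hsn nK]]].
have co := coef_orth nK.
have := HC n (@coef n) (delta n) co hdn.
have -> : Ex P (fun w => \prod_(j <- [:: k]) b (linstat eps (@coef n) w j)) = Ex P (fun w => b (W n w k)).
  by apply: eq_Ex => w; rewrite big_seq1.
rewrite big_seq1 => hb.
have [is2 _] := Ex_s2h nK.
have ib : intg P (fun w => b (W n w k)).
  have [b' [f [f' [C' [[_ bb _ _] _ _]]]]] := nb.
  apply: intg_bounded (measurable_gW n k (nice_measurable nb)) _ => w; exact: bb.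
(* Markov's inequality in pointwise form: [D >= 1] as soon as [|rho - 1| >= kap']. *)
pose D w := (kap' * s2)^-1 * `|s2h n w - s2|.
have iD : intg P D by exact: intgZ.
have ED : Ex P D <= e / 3.
  by rewrite ExZ// ler_pdivrMl ?mulr_gt0// mulrC.
have mJ := measurable_accept k nK z0.
have mg := measurable_gW n k (nice_measurable ng).
have b0 w : 0 <= b w.
  apply: le_trans (normr_ge0 _) (hgb w 1 _); by rewrite subrr normr0.
have pw w : `|accept n k z w - g (W n w k)| <= b (W n w k) + D w.
  have D0 : 0 <= D w by rewrite mulr_ge0// invr_ge0 ltW// mulr_gt0.
  have [bad|good] := leP kap' `|rho n w - 1|.
    have : 1 <= D w.
      rewrite ler_pdivlMl ?mulr_gt0// mulr1 -ler_pdivlMr//.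
      exact: le_trans bad (rho_dist w nK).
    have /andP[j0 j1] := accept01 n k z w; have /andP[g0 g1] := g01 (W n w k).
    have := b0 (W n w k); rewrite ler_norml => h1 h2; apply/andP; split; lra.
  have rk : `|rho n w - 1| < kap by apply: (lt_le_trans good); rewrite ge_min lexx.
  have r1 : `|rho n w - 1| < 1 by apply: (lt_le_trans good); rewrite ge_min lexx orbT.
  have r0 : 0 < rho n w by move: r1; rewrite ltr_norml => /andP[? _]; lra.
  rewrite /accept acceptE// mu0 addr0 (le_trans (hgb _ _ rk))// lerDl//.
have iJ : intg P (fun w => `|accept n k z w - g (W n w k)|).
  apply: (intg_le _ (intgD ib iD)) => [|w]; last by rewrite normr_id.
  by apply: measurableT_comp (@normr_measurable _ _) _; exact: measurable_funB.
apply: (le_trans (Ex_le iJ (intgD ib iD) pw)); rewrite ExD//.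
have hb' : Ex P (fun w => b (W n w k)) <= cb + C * delta n.
  by move: hb; rewrite ler_norml => /andP[_]; rewrite lerBlDl.
by move: hb' hCdn cbe ED; lra.
Qed.

(** With [rho < 2], acceptance under a drift of size at least [2 z + L] forces [|W| >= L], which
    Chebyshev makes unlikely since [W] has second moment 1. *)
Lemma asym_accept_div (z : R) k : 0 < z ->
  (forall L, \forall n \near \oo, L <= `|mu n k|) -> asym (fun n => accept n k z) k 0.
Proof.
move=> z0 hmu; split; first by move=> n w; exact: accept01.
  by apply: filterS near_gtK => n nK; exact: measurable_accept.
move=> e e0; have e20 : 0 < e / 2 by rewrite divr_gt0.
exists (fun=> 0); split; [exact: stein_nice_cst|by move=> x; rewrite lexx ler01|].
(* Large enough for [1 / L^2 <= e / 2]. *)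
pose L := 1 + 2 / e.
have L0 : 0 < L by rewrite ltr_wpDr// divr_ge0// ltW.
have Le : (L ^+ 2)^-1 <= e / 2.
  have eE : e / 2 = (2 / e)^-1 by field; rewrite gt_eqF.
  rewrite eE lef_pV2 ?posrE ?exprn_gt0 ?divr_gt0//.
  have : 0 < 2 / e by rewrite divr_gt0.
  by rewrite /L; move: (2 / e) => u; rewrite expr2; nra.
have hs := s2h_L1 (mulr_gt0 e20 s20).
have hall := near_and (hmu (2 * z + L)) (near_and hs near_gtK).
apply: filterS hall => n [mun [hsn nK]].
have co := coef_orth nK.
have [iW EW] := Ex_linstat_sqr meps ieps e4i e1 e2 s20 k co.
have [is2 _] := Ex_s2h nK.
pose D w := s2^-1 * `|s2h n w - s2|.
have iD : intg P D by exact: intgZ.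
have ED : Ex P D <= e / 2 by rewrite ExZ// ler_pdivrMl// mulrC.
pose V w := (L ^+ 2)^-1 * W n w k ^+ 2.
have iV : intg P V by exact: intgZ.
have EV : Ex P V <= e / 2 by rewrite ExZ// EW mulr1.
have mJ := measurable_accept k nK z0.
have pw w : `|accept n k z w - 0| <= V w + D w.
  have D0 : 0 <= D w by rewrite mulr_ge0// invr_ge0 ltW.
  have V0 : 0 <= V w by rewrite mulr_ge0 ?sqr_ge0// invr_ge0 sqr_ge0.
  rewrite subr0 ger0_norm; last by have /andP[] := accept01 n k z w.
  have [bad|good] := leP 1 `|rho n w - 1|.
    have D1 : 1 <= D w.
      by rewrite /D mulrC; exact: le_trans bad (rho_dist w nK).
    have /andP[_ j1] := accept01 n k z w.
    by rewrite (le_trans j1)// (le_trans D1)// lerDr.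
  move: good; rewrite ltr_norml => /andP[r1 r2].
  have r0 : 0 < rho n w by lra.
  rewrite /accept acceptE//; case: ltP => [h|_]; last by rewrite addr_ge0.
  have LW : L <= `|W n w k|.
    have := ler_normB (W n w k + mu n k) (W n w k); rewrite addrAC subrr add0r => h2.
    have : z * rho n w <= 2 * z by rewrite mulrC ler_wpM2r ?(ltW z0)//; lra.
    by move: mun h h2; lra.
  have : 1 <= V w.
    rewrite ler_pdivlMl ?exprn_gt0// mulr1 -[W n w k ^+ 2]real_normK ?num_real//.
    by apply: lerXn2r => //; rewrite nnegrE ?ltW.
  by move=> V1; rewrite (le_trans V1)// lerDl.
have iJ : intg P (fun w => `|accept n k z w - 0|).
  apply: (intg_le _ (intgD iV iD)) => [|w]; last by rewrite normr_id.
  by apply: measurableT_comp (@normr_measurable _ _) _; exact: measurable_funB.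
apply: (le_trans (Ex_le iJ (intgD iV iD) pw)); rewrite ExD//.
by move: EV ED; lra.
Qed.

Lemma prod_dist (I : Type) (s : seq I) (x y : I -> R) :
  (forall i, 0 <= x i <= 1) -> (forall i, 0 <= y i <= 1) ->
  `|\prod_(i <- s) x i - \prod_(i <- s) y i| <= \sum_(i <- s) `|x i - y i|.
Proof.
move=> hx hy; elim: s => [|i s IH]; first by rewrite !big_nil subrr normr0.
rewrite !big_cons.
have -> : x i * \prod_(j <- s) x j - y i * \prod_(j <- s) y j =
  (x i - y i) * \prod_(j <- s) x j + y i * (\prod_(j <- s) x j - \prod_(j <- s) y j) by ring.
rewrite (le_trans (ler_normD _ _))// lerD// normrM.
  rewrite ler_piMr// ger0_norm; last by apply: prodr_ge0 => j _; have /andP[] := hx j.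
  by apply: prodr_ile1 => j _; exact: hx.
have /andP[y0 y1] := hy i.
by rewrite (ger0_norm y0) (le_trans _ IH)// ler_piMl.
Qed.

(** All factors lie in [[0, 1]], so the product errs by at most the sum of the L1 errors, and
    [stein_clt] handles the product of test functions. *)
Lemma asym_prod (J : 'I_K -> nat -> T -> R) (p : 'I_K -> R) :
  (forall k, asym (J k) k (p k)) ->
  (fun n => Ex P (fun w => \prod_(k < K) J k n w)) @ \oo --> \prod_(k < K) p k.
Proof.
move=> hJ; apply/cvgrPdist_le => e e0.
have K1 : 0 < K%:R + 1 :> R by rewrite ltr_wpDl.
pose e' := e / (2 * (K%:R + 1)).
have e'0 : 0 < e' by rewrite divr_gt0// mulr_gt0.
have : forall k, exists g, [/\ stein_nice g (p k), (forall x, 0 <= g x <= 1) &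
      \forall n \near \oo, Ex P (fun w => `|J k n w - g (W n w k)|) <= e'].
  by move=> k; have [_ _ /(_ _ e'0)] := hJ k.
move=> /choice[g hg].
have ng k : stein_nice (g k) (p k) by have [] := hg k.
have g01 k x : 0 <= g k x <= 1 by have [] := hg k.
have hgn : \forall n \near \oo, forall k, Ex P (fun w => `|J k n w - g k (W n w k)|) <= e'.
  by apply: filter_forall => k; have [] := hg k.
have hmJ : \forall n \near \oo, forall k, measurable_fun setT (J k n).
  by apply: filter_forall => k; have [] := hJ k.
have J01 k n w : 0 <= J k n w <= 1 by have [h _ _] := hJ k.
have [C HC] := stein_clt meps ieps e4i e1 e2 e4 s20 ng (index_enum_uniq 'I_K).
have [delta d0 hd] := coef_small.
have e20 : 0 < e / 2 by rewrite divr_gt0.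
have hCd : \forall n \near \oo, C * delta n <= e / 2.
  have : (fun n => C * delta n) @ \oo --> 0.
    by rewrite -[X in _ --> X](mulr0 C); apply: cvgMr.
  move/cvgrPdist_le => /(_ _ e20); apply: filterS => n; rewrite sub0r normrN => h.
  exact: le_trans (ler_norm _) h.
have hall := near_and (near_and hgn hmJ) (near_and hd (near_and hCd near_gtK)).
apply: filterS hall => n [[hgn' mJ] [hdn [hCdn nK]]].
have := HC n (@coef n) (delta n) (coef_orth nK) hdn.
set Eg := Ex P (fun w => \prod_(k <- index_enum _) g k (linstat eps (@coef n) w k)) => hEg.
have mgW k : measurable_fun setT (fun w => g k (W n w k)) by exact: measurable_gW (nice_measurable (ng k)).
have norm01 (x : R) : 0 <= x <= 1 -> `|x| <= 1 by move=> /andP[h1 h2]; rewrite ger0_norm.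
have prod01 (x : 'I_K -> R) : (forall k, 0 <= x k <= 1) -> 0 <= \prod_(k < K) x k <= 1.
  move=> hx; rewrite prodr_ge0 => [|k _]; last by have /andP[] := hx k.
  by rewrite prodr_ile1.
have iJ : intg P (fun w => \prod_(k < K) J k n w).
  apply: (@intg_bounded _ _ _ _ _ 1); first by apply: measurable_prod.
  by move=> w; apply/norm01/prod01.
have ig : intg P (fun w => \prod_(k < K) g k (W n w k)).
  apply: (@intg_bounded _ _ _ _ _ 1); first by apply: measurable_prod.
  by move=> w; apply/norm01/prod01.
have iD k : intg P (fun w => `|J k n w - g k (W n w k)|).
  apply/intg_norm/intgB; [apply: (@intg_bounded _ _ _ _ _ 1) => // w; exact: norm01|].
  by apply: (@intg_bounded _ _ _ _ _ 1) => // w; exact: norm01.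
have hJg : `|Ex P (fun w => \prod_(k < K) J k n w) - Ex P (fun w => \prod_(k < K) g k (W n w k))| <= e / 2.
  rewrite -ExB//.
  apply: (le_trans (ler_norm_Ex_le (intgB iJ ig) (intg_sum (index_enum 'I_K) iD) _)).
    by move=> w; exact: prod_dist.
  rewrite Ex_sum// (le_trans (ler_sum _ (fun k _ => hgn' k)))//.
  rewrite sumr_const card_ord -[_ *+ K]mulr_natl /e' mulrA ler_pdivrMr ?mulr_gt0//.
  by have : 0 <= K%:R :> R by []; nra.
have := hEg; rewrite distrC -/(Ex P _) => hEg'.
have := ler_distD Eg (\prod_(k < K) p k) (Ex P (fun w => \prod_(k < K) J k n w)).
rewrite [`|Eg - Ex _ _|]distrC => h.
by move: h hEg' hJg hCdn; rewrite -/Eg; lra.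
Qed.

(** The drift is [beta0 k 0] over [sqrt (gsvar) * sigma0], and [gsvar] is at most [1 / (lam n)]. *)
Lemma drift_div k : beta0 k 0 != 0 ->
  (\forall n \near \oo, (gsrow (X n) k *m (X n *m beta0)) 0 0 = beta0 k 0) ->
  forall L, \forall n \near \oo, L <= `|mu n k|.
Proof.
move=> b0 hb L.
have [lam lam0 hlam] := eventually_coercive.
set b := beta0 k 0 in b0 hb.
have b2 : 0 < b ^+ 2 by rewrite exprn_even_gt0.
have hn : \forall n \near \oo, L ^+ 2 * s2 / (b ^+ 2 * lam) <= n%:R by exact: nbhs_infty_ger.
have hall := near_and (near_and hb hlam) (near_and hn near_gtK).
apply: filterS hall => n [[hbn hl] [hnn nK]].
have n0 : (0 < n)%N by rewrite (leq_ltn_trans _ nK).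
have pX := Xpd nK; have gv := gsvar_gt0 pX k.
have gl := gsvar_le pX k lam0 n0 hl.
have n0' : 0 < n%:R :> R by rewrite ltr0n.
apply: le_trans (ler_norm L) _; rewrite -ler_sqr ?nnegrE// !real_normK ?num_real//.
rewrite /mu /drift hbn expr_div_n exprMn sqr_sqrtr ?(ltW gv)// -/s2.
rewrite ler_pdivlMr ?mulr_gt0//.
have h1 : gsvar (X n) k * (lam * n%:R) <= 1 by rewrite -ler_pdivlMr ?mulr_gt0// mul1r.
have h2 : L ^+ 2 * s2 <= b ^+ 2 * lam * n%:R by rewrite [leRHS]mulrC -ler_pdivrMr// mulr_gt0.
have -> : L ^+ 2 * (gsvar (X n) k * s2) = gsvar (X n) k * (L ^+ 2 * s2) by ring.
rewrite (le_trans (ler_wpM2l (ltW gv) h2))//.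
have -> : gsvar (X n) k * (b ^+ 2 * lam * n%:R) = b ^+ 2 * (gsvar (X n) k * (lam * n%:R)) by ring.
by rewrite ler_piMr// ltW.
Qed.

Section patterns.
Variable z : nat -> R.
Hypothesis z0 : forall j, (j < K)%N -> 0 < z j.

Definition accepted n w (j : 'I_K) : bool := `|Ztilde (X n) (Y n w) j.+1| < z j.

(* An entry [Some b] of a pattern prescribes the outcome of a test, [None]
   leaves it free. *)
Definition matches (o : option bool) (a : bool) := if o is Some b then a == b else true.

Definition matchprob (p : R) (o : option bool) : R :=
  if o is Some b then if b then p else 1 - p else 1.

Lemma matches_natr o (a : bool) : (matches o a)%:R =
  (if o is Some b then if b then a%:R else 1 - a%:R else 1) :> R.
Proof. by case: o a => [[] []|] //=; rewrite ?subrr ?subr0. Qed.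

Lemma measurable_matches n (j : 'I_K) o : (K < n)%N ->
  measurable_fun setT (fun w => (matches o (accepted n w j))%:R : R).
Proof.
move=> nK; have mJ := measurable_accept j nK (z0 (ltn_ord j)).
under eq_fun do rewrite matches_natr.
by case: o => [[]|]; [exact: mJ|exact: measurable_funB|exact: measurable_cst].
Qed.

Lemma measurable_pattern n (c : nat -> option bool) : (K < n)%N ->
  measurable [set w | [forall j : 'I_K, matches (c j) (accepted n w j)]].
Proof.
move=> nK.
pose f w : R := \prod_(j < K) (matches (c j) (accepted n w j))%:R.
have mf : measurable_fun setT f by apply: measurable_prod => j _; exact: measurable_matches.
have -> : [set w | [forall j : 'I_K, matches (c j) (accepted n w j)]] = f @^-1` [set 1].
  apply/seteqP; split => w /=; rewrite /f prodr_bool; first by move=> ->.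
  by case: [forall _, _] => // /eqP; rewrite eq_sym oner_eq0.
by rewrite -[X in measurable X]setTI; apply: mf.
Qed.

Lemma prob_pattern n (c : nat -> option bool) : (K < n)%N ->
  P [set w | [forall j : 'I_K, matches (c j) (accepted n w j)]] =
  (Ex P (fun w => \prod_(j < K) (matches (c j) (accepted n w j))%:R))%:E.
Proof.
move=> nK; rewrite -(Ex_indic P (measurable_pattern c nK)); congr (_%:E); apply: eq_Ex => w.
by rewrite prodr_bool indicE; congr (nat_of_bool _)%:R; apply/idP/idP; rewrite inE.
Qed.

Lemma asym_matches (j : 'I_K) o p : (o = None \/ asym (fun n => accept n j (z j)) j p) ->
  asym (fun n w => (matches o (accepted n w j))%:R) j (matchprob p o).
Proof.
have -> : (fun n w => (matches o (accepted n w j))%:R : R) = (fun n w =>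
    if o is Some b then if b then accept n j (z j) w else 1 - accept n j (z j) w else 1).
  by apply/funext => n; apply/funext => w; rewrite matches_natr.
case: o => [b|_]; last exact: asym_one.
by case=> // h; case: b => /=; [exact: h|exact: asym_compl].
Qed.

Lemma Ex_pattern_cvg (c : nat -> option bool) (p : nat -> R) :
  (forall j : 'I_K, c j = None \/ asym (fun n => accept n j (z j)) j (p j)) ->
  (fun n => Ex P (fun w => \prod_(j < K) (matches (c j) (accepted n w j))%:R)) @ \oo -->
  \prod_(j < K) matchprob (p j) (c j).
Proof. by move=> h; apply: asym_prod => j; exact: asym_matches. Qed.

Lemma event_cvg (E : nat -> T -> Prop) (c : nat -> option bool) (p : nat -> R) (l : R) :
  (forall n w, (K < n)%N -> E n w <-> [forall j : 'I_K, matches (c j) (accepted n w j)]) ->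
  (forall j : 'I_K, c j = None \/ asym (fun n => accept n j (z j)) j (p j)) ->
  \prod_(0 <= j < K) matchprob (p j) (c j) = l ->
  (fun n => P [set w | E n w]) @ \oo --> l%:E.
Proof.
move=> hE hc hl; have := Ex_pattern_cvg hc.
rewrite -(big_mkord xpredT (fun j => matchprob (p j) (c j))) hl => h.
have {}h : (fun n => (Ex P (fun w => \prod_(j < K) (matches (c j) (accepted n w j))%:R))%:E) @ \oo --> l%:E.
  by apply/fine_cvgP; split; [exact: filterE|exact: h].
apply: cvg_trans h; apply: near_eq_cvg; apply: filterS near_gtK => n nK.
rewrite -prob_pattern//; by congr (P _); apply/seteqP; split => w /=; have [] := hE n w nK.
Qed.

(** The event may also prescribe tests without a known limit; domination by the acceptance of the
    single test [j] avoids them. *)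
Lemma event_cvg0 (E : nat -> T -> Prop) (c : nat -> option bool) (j : 'I_K) :
  (forall n w, (K < n)%N -> E n w <-> [forall j : 'I_K, matches (c j) (accepted n w j)]) ->
  (forall n w, (K < n)%N -> E n w -> accepted n w j) ->
  asym (fun n => accept n j (z j)) j 0 ->
  (fun n => P [set w | E n w]) @ \oo --> 0%E.
Proof.
move=> hE hj has.
pose c' i := if i == j :> nat then Some true else None.
have h : (fun n => P [set w | accepted n w j]) @ \oo --> (0 : R)%:E.
  apply: (@event_cvg _ c' (fun=> 0)).
  - move=> n w nK; split => [aj|/forallP/(_ j)]; last by rewrite /c' eqxx/= => /eqP.
    by apply/forallP => i; rewrite /c'; case: eqP => //= /val_inj ->; rewrite aj.
  - move=> i; rewrite /c'; case: eqP => [/val_inj ->|_]; [by right|by left].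
  - rewrite (big_mkord xpredT (fun i => matchprob 0 (c' i))) (bigD1 j)//= /c' eqxx/= mul0r.
    by [].
apply: (squeeze_cvge _ (cvg_cst _) h); apply: filterS near_gtK => n nK.
rewrite measure_ge0/= le_measure// ?inE.
- rewrite (_ : [set w | E n w] = [set w | [forall j : 'I_K, matches (c j) (accepted n w j)]]).
    exact: measurable_pattern.
  by apply/seteqP; split => w /=; have [] := hE n w nK.
- exact: (measurable_accept_set j nK (z0 (ltn_ord j))).
- by move=> w /=; exact: hj.
Qed.

(** * Limits of the selection probabilities *)

Section selection.
Variables (k0 : nat) (alpha : nat -> R).
Hypothesis k01 : (1 <= k0 <= K)%N.
Hypothesis beta_neq0 : forall j : 'I_K, (j < k0)%N -> beta0 j 0 != 0.
Hypothesis beta_eq0 : forall j : 'I_K, (k0 <= j)%N -> beta0 j 0 = 0.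
Hypothesis alpha01 : forall j, (j < K)%N -> 0 < alpha j.+1 < 1.
Hypothesis zE : forall j, (j < K)%N -> zq (alpha j.+1 / 2) = (z j)%:E.
Hypothesis PhizE : forall j, (j < K)%N -> Phi (z j) = 1 - alpha j.+1 / 2.

Let ap := accprob k0 alpha.

Lemma asym_null (j : 'I_K) : (k0 <= j)%N -> asym (fun n => accept n j (z j)) j (ap j).
Proof.
move=> kj; rewrite /ap /accprob ltnNge kj/=.
apply: asym_accept_null; [exact: alpha01|exact: z0|exact: PhizE|].
apply: filterS near_gtK => n nK; rewrite /mu /drift (gsrow_X_sum (Xpd nK)) ?beta_eq0 ?mul0r//.
by move=> l jl; left; rewrite beta_eq0// (leq_trans kj)// ltnW.
Qed.

Lemma asym_last (j : 'I_K) : j.+1 = k0 -> asym (fun n => accept n j (z j)) j (ap j).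
Proof.
move=> jk; have jk0 : (j < k0)%N by rewrite -jk.
rewrite /ap /accprob jk0; apply: asym_accept_div; first exact: z0.
apply: drift_div; first exact: beta_neq0.
apply: filterS near_gtK => n nK; rewrite (gsrow_X_sum (Xpd nK))//.
by move=> l jl; left; rewrite beta_eq0// -jk.
Qed.

(** Encodes the value [k.+1] of the estimator: test [k] rejects, later tests accept, earlier ones
    are free. *)
Definition patternB k i : option bool := if (i < k)%N then None else Some (i != k).

Lemma khatB_pattern k n w : (k < K)%N ->
  khatB alpha (X n) (Y n w) = k.+1 <->
  [forall j : 'I_K, matches (patternB k j) (accepted n w j)].
Proof.
move=> kK; rewrite (khatB_eq _ _ zE kK); split => [[h1 h2]|/forallP h].
  apply/forallP => j; rewrite /patternB /accepted; case: ltngtP => //= [kj|jk].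
    by rewrite h2// kj/=.
  by rewrite jk; move: h1 => /negbTE ->.
split; first by have := h (Ordinal kK); rewrite /patternB /accepted/= ltnn eqxx /= => /eqP ->.
move=> l /andP[kl lK]; have := h (Ordinal lK).
by rewrite /patternB /accepted/= ltnNge (ltnW kl)/= (gtn_eqF kl)/= => /eqP.
Qed.

Lemma khatB_cvg k : (k < K)%N -> (k0 <= k.+1)%N ->
  (fun n => P [set w | khatB alpha (X n) (Y n w) = k.+1]) @ \oo -->
  ((1 - ap k) * \prod_(k.+2 <= j < K.+1) (1 - alpha j))%:E.
Proof.
move=> kK k0k; apply: (event_cvg (c := patternB k) (p := ap)).
- by move=> n w _; exact: khatB_pattern.
- move=> j; rewrite /patternB; case: (ltnP j k) => jk; [by left|right].
  have [kj|jk0] := leqP k0 j; first exact: asym_null.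
  by apply: asym_last; apply/eqP; rewrite eqn_leq jk0 (leq_trans k0k).
rewrite (prod_nat_split _ kK) /patternB ltnn eqxx/= big_nat big1 ?mul1r; last first.
  by move=> i /andP[_ ->].
congr (_ * _); rewrite [RHS]big_add1/= big_nat [RHS]big_nat; apply: eq_bigr => i /andP[ki _].
rewrite ltnNge (ltnW ki)/= eq_sym (ltn_eqF ki)/= /ap /accprob.
by rewrite ltnNge (leq_trans k0k ki).
Qed.

Lemma khatB_cvg0 k : (k.+1 < k0)%N ->
  (fun n => P [set w | khatB alpha (X n) (Y n w) = k.+1]) @ \oo --> 0%E.
Proof.
move=> kk0; have [k0pos k0K] := andP k01.
have kK : (k < K)%N by rewrite (leq_trans (ltnW kk0)).
have lK : (k0.-1 < K)%N by rewrite prednK.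
pose j := Ordinal lK; have jk : j.+1 = k0 by rewrite /= prednK.
apply: (event_cvg0 (c := patternB k) (j := j)).
- by move=> n w _; exact: khatB_pattern.
- move=> n w _ /(khatB_eq _ _ zE kK)[_]; apply.
  by rewrite lK andbT -ltnS jk.
- by have := asym_last jk; rewrite /ap /accprob -jk leqnn.
Qed.

Section orthogonal.
Hypothesis orthX : forall n, (K < n)%N -> n%:R^-1 *: ((X n)^T *m X n) = 1%:M.

Lemma asym_orth (j : 'I_K) : asym (fun n => accept n j (z j)) j (ap j).
Proof.
have [kj|jk0] := leqP k0 j; first exact: asym_null.
rewrite /ap /accprob jk0; apply: asym_accept_div; first exact: z0.
apply: drift_div; first exact: beta_neq0.
apply: filterS near_gtK => n nK; rewrite (gsrow_X_sum (Xpd nK))//.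
move=> l jl; right; rewrite (orth_gsrow_X (leq_ltn_trans (leq0n K) nK) (orthX nK)).
by rewrite -val_eqE/= eq_sym (ltn_eqF jl).
Qed.

(** Encodes the value [k]: the tests at indices below [k] reject, the next one accepts if it exists,
    later ones are free. *)
Definition patternF k i : option bool := if (i <= k)%N then Some (i == k) else None.

Lemma khatF_pattern k n w : (k <= K)%N ->
  khatF alpha (X n) (Y n w) = k <->
  [forall j : 'I_K, matches (patternF k j) (accepted n w j)].
Proof.
move=> kK; rewrite (khatF_eq _ _ zE kK); split => [[h1 h2]|/forallP h].
  apply/forallP => j; rewrite /patternF /accepted; case: ltngtP => //= [jk|jk].
    by have /negbTE -> := h1 j jk.
  by rewrite jk h2// -jk.
split => [l lk|kK'].
  have lK := leq_trans lk kK; have := h (Ordinal lK).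
  by rewrite /patternF /accepted/= (ltnW lk) (ltn_eqF lk)/= => /eqP ->.
by have := h (Ordinal kK'); rewrite /patternF /accepted/= leqnn eqxx/= => /eqP.
Qed.

Lemma khatF_cvg k (l : R) : (k <= K)%N ->
  \prod_(0 <= j < K) matchprob (ap j) (patternF k j) = l ->
  (fun n => P [set w | khatF alpha (X n) (Y n w) = k]) @ \oo --> l%:E.
Proof.
move=> kK; apply: (event_cvg (c := patternF k) (p := ap)).
- by move=> n w _; exact: khatF_pattern.
- by move=> j; right; exact: asym_orth.
Qed.

Lemma patternF_below k : (k < k0)%N ->
  \prod_(0 <= j < K) matchprob (ap j) (patternF k j) = 0.
Proof.
move=> kk0; have kK : (k < K)%N by have /andP[_] := k01; exact: leq_trans.
by rewrite (prod_nat_split _ kK) /patternF leqnn eqxx/= /ap /accprob kk0 mulr0 mul0r.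
Qed.

Lemma patternF_above k : (k0 <= k <= K)%N -> alpha K.+1 = 0 ->
  \prod_(0 <= j < K) matchprob (ap j) (patternF k j) =
  (1 - alpha k.+1) * \prod_(k0.+1 <= j < k.+1) alpha j.
Proof.
move=> /andP[k0k kK] aK.
have e : \prod_(0 <= j < k) matchprob (ap j) (patternF k j) = \prod_(k0.+1 <= j < k.+1) alpha j.
  rewrite (@big_cat_nat _ _ _ k0)//= big_nat big1 ?mul1r; last first.
    move=> i /andP[_ ik0]; have ik := leq_trans ik0 k0k.
    by rewrite /patternF (ltnW ik) (ltn_eqF ik)/= /ap /accprob ik0 subr0.
  rewrite big_add1/= big_nat [RHS]big_nat; apply: eq_bigr => i /andP[k0i ik].
  rewrite /patternF (ltnW ik) (ltn_eqF ik)/= /ap /accprob ltnNge k0i/=; ring.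
move: kK; rewrite leq_eqVlt => /predU1P[kK|kK].
  (* For [k = K] no accepting test remains; the factor [1 - alpha K.+1] is 1 by convention. *)
  by rewrite -kK e kK aK subr0 mul1r.
rewrite (prod_nat_split _ kK) e /patternF leqnn eqxx/= /ap /accprob ltnNge k0k/=.
rewrite [X in _ * X]big_nat [X in _ * X]big1 ?mulr1 1?mulrC// => i /andP[ki _].
by rewrite (leqNgt i k) ki.
Qed.

Lemma khatO_cvg k :
  (fun n => P [set w | khatO alpha (X n) (Y n w) = k]) @ \oo -->
  (\sum_(b : {ffun 'I_K -> bool} | #|[pred i | ~~ b i]| == k)
    \prod_(j < K) (if b j then ap j else 1 - ap j))%:E.
Proof.
pose c (b : {ffun 'I_K -> bool}) (i : nat) : option bool := omap b (insub i).
have cE b (j : 'I_K) : c b j = Some (b j) by rewrite /c valK.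
have h : (fun n => \sum_(b : {ffun 'I_K -> bool} | #|[pred i | ~~ b i]| == k)
    Ex P (fun w => \prod_(j < K) (accepted n w j == b j)%:R)) @ \oo -->
    \sum_(b : {ffun 'I_K -> bool} | #|[pred i | ~~ b i]| == k)
    \prod_(j < K) (if b j then ap j else 1 - ap j).
  apply: cvg_big => [|b _]; first exact: add_continuous.
  have := @Ex_pattern_cvg (c b) ap; rewrite (eq_bigr _ (fun j _ => congr1 _ (cE b j))) => hb.
  have -> : (fun n => Ex P (fun w => \prod_(j < K) (accepted n w j == b j)%:R)) =
      (fun n => Ex P (fun w => \prod_(j < K) (matches (c b j) (accepted n w j))%:R)).
    apply/funext => n; apply: eq_Ex => w; apply: eq_bigr => j _; by rewrite cE.
  by apply: hb => j; right; exact: asym_orth.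
have {}h : (fun n => (\sum_(b : {ffun 'I_K -> bool} | #|[pred i | ~~ b i]| == k)
    Ex P (fun w => \prod_(j < K) (accepted n w j == b j)%:R))%:E) @ \oo -->
    (\sum_(b : {ffun 'I_K -> bool} | #|[pred i | ~~ b i]| == k)
    \prod_(j < K) (if b j then ap j else 1 - ap j))%:E.
  by apply/fine_cvgP; split; [exact: filterE|exact: h].
apply: cvg_trans h; apply: near_eq_cvg; apply: filterS near_gtK => n nK.
have [|_ <-] := @prob_card _ _ _ P K (accepted n) k.
  by move=> j; exact: (measurable_accept_set j nK (z0 (ltn_ord j))).
congr (P _); apply/funext => w /=; congr (_ = _).
rewrite (khatO_eq _ _ zE); apply: eq_card => i.
by rewrite !inE (orth_Zhat (Xpd nK) (leq_ltn_trans (leq0n K) nK) (orthX nK)).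
Qed.

(** With fewer than [k0] rejections some test below [k0] accepts, and its limiting acceptance
    probability is 0. *)
Lemma count_below k : (k < k0)%N ->
  \sum_(b : {ffun 'I_K -> bool} | #|[pred i | ~~ b i]| == k)
    \prod_(j < K) (if b j then ap j else 1 - ap j) = 0.
Proof.
move=> kk0; have /andP[_ k0K] := k01; apply: big1 => b /eqP bk.
have [j /andP[jk0 bj]] : exists j : 'I_K, (j < k0)%N && b j.
  apply/existsP; apply: contraTT kk0; rewrite negb_exists => /forallP h.
  have wi : injective (widen_ord k0K) by move=> i j [] /val_inj.
  rewrite -leqNgt -bk -(card_ord k0) -(card_imset predT wi).
  apply/subset_leq_card/fintype.subsetP => _ /imsetP[i _ ->]; rewrite inE.
  by have := h (widen_ord k0K i); rewrite negb_and /= ltn_ord.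
by rewrite (bigD1 j)//= bj /ap /accprob jk0 mul0r.
Qed.

End orthogonal.
End selection.

End patterns.

End asymptotics.

Unset Implicit Arguments.
Theorem theorem8 (R : realType) (d : measure_display) (T : measurableType d)
  (P : probability T R) (K k0 : nat) (beta0 : 'cV[R]_K)
  (X : forall n : nat, 'M[R]_(n, K)) (Sigma0 : 'M[R]_K)
  (eps : nat -> T -> R) (sigma0 M : R) (alpha : nat -> R) :
  (1 <= K)%N -> (1 <= k0 <= K)%N ->
  (forall j : 'I_K, (j < k0)%N -> beta0 j 0 != 0) ->
  (forall j : 'I_K, (k0 <= j)%N -> beta0 j 0 = 0) ->
  (* (i) *)
  (forall n, (K < n)%N -> forall k : 'I_K,
      \sum_(i < n) X n i k = 0 /\ \sum_(i < n) X n i k ^+ 2 = n%:R) ->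
  (* (ii) *)
  (fun n => \big[Num.max/0]_(i < n)
              (Num.sqrt (\sum_(k < K) X n i k ^+ 2) / Num.sqrt n%:R)) @ \oo --> 0 ->
  (* (iii) *)
  (forall n, (K < n)%N -> posdefmx ((X n)^T *m X n)) ->
  (* (iv) *)
  (forall i j : 'I_K, (fun n => (n%:R^-1 *: ((X n)^T *m X n)) i j) @ \oo --> Sigma0 i j) ->
  posdefmx Sigma0 ->
  (* errors *)
  (forall i, measurable_fun setT (eps i)) ->
  mutual_indep P setT eps ->
  (forall i, ('E_P[eps i] = 0)%E) ->
  0 < sigma0 ->
  (forall i, ('E_P[(fun w => eps i w ^+ 2)%R] = (sigma0 ^+ 2)%:E)%E) ->
  (forall i, ('E_P[(fun w => eps i w ^+ 4)%R] <= M%:E)%E) ->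
  (* levels *)
  (forall k, (1 <= k <= K)%N -> 0 < alpha k < 1) ->
  alpha K.+1 = 0 ->
  (* (a) *)
  (forall k, (1 <= k <= K)%N ->
     let p := fun n => P [set w | khatB alpha (X n) (Yvec (X n) beta0 eps w) = k] in
     ((k < k0)%N -> p @ \oo --> 0%E) /\
     (k = k0 -> p @ \oo --> (\prod_(k0.+1 <= j < K.+1) (1 - alpha j))%:E) /\
     ((k0 < k)%N -> p @ \oo --> (alpha k * \prod_(k.+1 <= j < K.+1) (1 - alpha j))%:E)) /\
  (Sigma0 = 1%:M ->
   (forall n, (K < n)%N -> n%:R^-1 *: ((X n)^T *m X n) = 1%:M) ->
   (* (b) *)
   (forall k, (1 <= k <= K)%N ->
     let p := fun n => P [set w | khatF alpha (X n) (Yvec (X n) beta0 eps w) = k] in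
     ((k < k0)%N -> p @ \oo --> 0%E) /\
     (k = k0 -> p @ \oo --> (1 - alpha k0.+1)%:E) /\
     ((k0 < k)%N -> p @ \oo -->
        ((1 - alpha k.+1) * \prod_(k0.+1 <= j < k.+1) alpha j)%:E)) /\
   (* (c) *)
   (forall k, (1 <= k <= K)%N ->
     let p := fun n => P [set w | khatO alpha (X n) (Yvec (X n) beta0 eps w) = k] in
     ((k < k0)%N -> p @ \oo --> 0%E) /\
     ((k0 <= k)%N ->
       forall (d' : measure_display) (T' : measurableType d') (Q : probability T' R)
              (B : nat -> T' -> R),
         (forall j, (k0 < j <= K)%N -> measurable_fun setT (B j)) ->
         mutual_indep Q [set j | (k0 < j <= K)%N] B ->
         (forall j, (k0 < j <= K)%N ->
            Q [set w | B j w = 1] = (alpha j)%:E /\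
            Q [set w | B j w = 0] = (1 - alpha j)%:E) ->
         p @ \oo --> Q [set w | \sum_(k0.+1 <= j < K.+1) B j w = (k - k0)%:R]))).
Proof.
move=> K1 k01 bnz bz _ Xmax Xpd Xcvg Spd meps ieps e1 sig0 e2 e4 alpha01 aK.
(* For a nonnegative function the finite bound on the extended-real expectation already gives
   integrability. *)
have e4i i : intg P (fun w => eps i w ^+ 4).
  apply/integrableP; split; first by apply/measurable_EFinP; exact: measurable_funX.
  rewrite (_ : (\int[P]_x _)%E = 'E_P[(fun w => eps i w ^+ 4)%R]%E).
    by rewrite (le_lt_trans (e4 i))// ltry.
  rewrite unlock; apply: eq_integral => w _ /=; congr (_%:E).
  by rewrite ger0_norm// -[4%N]/(2 * 2)%N exprM sqr_ge0.
have E4 i : Ex P (fun w => eps i w ^+ 4) <= M.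
  rewrite -lee_fin; apply: le_trans (e4 i); rewrite unlock /Ex /Rintegral fineK//.
  exact: (integrable_fin_num measurableT (e4i i)).
have E1 i : Ex P (eps i) = 0 by apply: expectation_Ex (e1 i); exact: (intg1 meps e4i).
have E2 i : Ex P (fun w => eps i w ^+ 2) = sigma0 ^+ 2.
  by apply: expectation_Ex (e2 i); exact: (intg2 meps e4i).
have al j : (j < K)%N -> 0 < alpha j.+1 < 1 by move=> jK; apply: alpha01.
have [z hz] : {z : nat -> R & forall j, (j < K)%N ->
    [/\ 0 < z j, zq (alpha j.+1 / 2) = (z j)%:E & Phi (z j) = 1 - alpha j.+1 / 2]}.
  apply: (choice (P := fun j x => (j < K)%N ->
    [/\ 0 < x, zq (alpha j.+1 / 2) = x%:E & Phi x = 1 - alpha j.+1 / 2])) => j.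
  case: (ltnP j K) => jK; last by exists 0.
  by have [x hx] := zq_half (al j jK); exists x.
have z0 j (jK : (j < K)%N) : 0 < z j by have [] := hz j jK.
have zE j (jK : (j < K)%N) : zq (alpha j.+1 / 2) = (z j)%:E by have [] := hz j jK.
have PhizE j (jK : (j < K)%N) : Phi (z j) = 1 - alpha j.+1 / 2 by have [] := hz j jK.
split=> [[//|k] /andP[_ kK] p|_ oX].
  split; last split.
  - move=> kk0; rewrite /p.
    exact: (khatB_cvg0 Xmax Xpd Xcvg Spd meps ieps e4i E1 E2 E4 sig0 z0 k01 bnz bz zE kk0).
  - move=> kk0.
    have := khatB_cvg Xmax Xpd Xcvg Spd meps ieps e4i E1 E2 E4 sig0 z0 bnz bz al zE PhizE kK (eq_leq (esym kk0)).
    by rewrite /accprob -kk0 ltnSn subr0 mul1r; apply.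
  - move=> k0k.
    have := khatB_cvg Xmax Xpd Xcvg Spd meps ieps e4i E1 E2 E4 sig0 z0 bnz bz al zE PhizE kK (ltnW k0k).
    by rewrite /accprob ltnNge -ltnS k0k/= opprB addrC subrK; apply.
split=> k /andP[_ kK] p.
  have cvgF := khatF_cvg Xmax Xpd Xcvg Spd meps ieps e4i E1 E2 E4 sig0 z0 bnz bz al zE PhizE oX kK.
  split; last split.
  - by move=> kk0; apply: cvgF; exact: patternF_below.
  - move=> kk0; apply: cvgF; rewrite patternF_above ?kk0 ?leqnn -?kk0//.
    by rewrite big_geq ?mulr1.
  - by move=> k0k; apply: cvgF; rewrite patternF_above// (ltnW k0k).
have cvgO := khatO_cvg Xmax Xpd Xcvg Spd meps ieps e4i E1 E2 E4 sig0 z0 bnz bz al zE PhizE oX.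
split=> [kk0|k0k d' T' Q B mB iB hB].
  by have := cvgO k; rewrite count_below.
have /andP[_ k0K] := k01.
by rewrite (bernoulli_sum_prob k0K mB iB hB k0k); exact: cvgO.
Qed.
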